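(* Define integers $N_r$ for $r=0,1,\ldots,13$ by $N_0=294$, $N_1=589$, $N_2=394$, $N_3=367$, $N_4=396$, $N_5=439$, $N_6=510$, $N_7=329$, $N_8=540$, $N_9=457$, $N_{10}=430$, $N_{11}=459$, $N_{12}=432$, $N_{13}=447$. For each $r\in\{0,1,\ldots,13\}$, if $n\equiv r \pmod{14}$ and $n\ge N_r+42$, then the groups $SL_n(q)$ and $L_n(q)$ are doubly Hurwitz Beauville groups for all prime powers $q$. In particular, this applies for all $n\ge 631$.
   Context: $SL_n(q)$ is the special linear group of degree $n$ over the field of $q$ elements, and $L_n(q)=PSL_n(q)$ is its quotient by its centre. A generating triple of type $(2,3,7)$ (a Hurwitz triple) for a finite group $G$ is a triple $(x,y,z)$ of elements of $G$ of orders $2,3,7$ respectively, with $xyz=1$ and $G=\langle x,y,z\rangle$. A finite group $G$ is a doubly Hurwitz Beauville group (dHB group) if it has two generating triples $(x_1,y_1,z_1)$ and $(x_2,y_2,z_2)$ of type $(2,3,7)$ such that no non-identity power of $x_1$, $y_1$ or $z_1$ is conjugate in $G$ to a power of $x_2$, $y_2$ or $z_2$. *)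

(* Defs.v *)
From mathcomp Require Import all_boot all_order all_algebra all_fingroup all_solvable.

Set Implicit Arguments.
Unset Strict Implicit.
Unset Printing Implicit Defensive.

Import GroupScope GRing.Theory.

(* {'GL_n[F]} consists of matrices of size n.-1.+1, so SLgroup n F is the
   special linear group of degree n only for n > 0 (SLgroup 0 F is SL_1). *)
Definition SLgroup (n : nat) (F : finFieldType) : {set {'GL_n[F]}} :=
  [set u : {'GL_n[F]} | (\det (GLval u) == 1)%R].

Lemma SLgroup_group_set (n : nat) (F : finFieldType) : group_set (SLgroup n F).
Proof.
apply/group_setP; split=> [|u v]; first by rewrite inE GL_1E det1.
by rewrite !inE GL_MxE det_mulmx => /eqP-> /eqP->; rewrite mulr1.
Qed.

Canonical SLgroup_group (n : nat) (F : finFieldType) : {group {'GL_n[F]}} :=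
  Group (SLgroup_group_set n F).

Definition PSLgroup (n : nat) (F : finFieldType) :
    {group coset_of 'Z(SLgroup n F)} :=
  (SLgroup n F / 'Z(SLgroup n F))%G.

Definition hurwitz_triple (gT : finGroupType) (G : {group gT})
    (x y z : gT) : Prop :=
  [/\ [/\ x \in G, y \in G & z \in G],
      [/\ #[x] = 2, #[y] = 3 & #[z] = 7],
      x * y * z = 1
    & <<[set x; y; z]>> = G].

Definition doubly_hurwitz_beauville (gT : finGroupType) (G : {group gT}) :
    Prop :=
  exists x1 y1 z1 x2 y2 z2 : gT,
    [/\ hurwitz_triple G x1 y1 z1,
        hurwitz_triple G x2 y2 z2
      & forall (a b g : gT) (i j : nat),
          a \in [set x1; y1; z1] -> b \in [set x2; y2; z2] -> g \in G ->
          a ^+ i != 1 -> (a ^+ i) ^ g <> b ^+ j].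

Definition N_mod14 (r : nat) : nat :=
  nth 0 [:: 294; 589; 394; 367; 396; 439; 510;
            329; 540; 457; 430; 459; 432; 447] r.

(* Main.v *)
(** A permutation representation of the group <x, y | x^2 = y^3 = (x y)^7 = 1> has a handle at a
    if x fixes a and y a and the commutator w = [x, y] satisfies w^7 a = y^2 a. Two representations
    are glued by multiplying x by the transpositions that exchange their handle points, and this
    conjugates w on the union. The same computation holds when the exchange of two points is
    replaced by any involutory matrix on the span of several handle points of one representation,
    and now it yields a linear representation in which w^K is still conjugate to a permutation
    matrix. For suitable K a commutator of conjugates of w^K is a 3-cycle; the group then contains
    all even permutation matrices, so also the matrix that was used for gluing, and from it one
    gets all transvections. Two handles suffice to generate SL_n; three handles with a matrix
    fixing the all-ones vector generate a group with quotient SL_(n-1).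

    For two triples of one degree, corresponding powers are compared by the ranks of g - a. For a
    permutation the kernel of g - a has largest dimension at a = 1, where it is the number of
    cycles; so different numbers of fixed points exclude conjugacy, even up to scalars, and the
    triples separate both in SL_n and in its central quotient. *)

Require Import Defs.
From mathcomp Require Import all_boot all_order all_algebra all_fingroup all_solvable.
From mathcomp Require Import zify ring.

Set Implicit Arguments.
Unset Strict Implicit.
Unset Printing Implicit Defensive.

Import GroupScope.

(** The obstacle is that conjugation by the glued involution agrees with conjugation by x only on
    permutations fixing all handle points. A seed is therefore phrased for every permutation group
    closed under conjugation by y and, away from the handle points, by x. This property passes to
    the left half of a glued pair and to the permutations whose matrices lie in a linear group, so
    the 3-cycle is computed once, inside a small block. K is a multiple of 13 and of the other
    periods of w in the blocks, and is 1 modulo 5. So w^K is trivial on unseeded blocks, commutes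
    with the strands, and keeps exactly the 5-cycles of a seeded block. The two-handle matrix
    depends on a scalar g whose powers give all nonzero scalars up to sign. It fixes the all-ones
    vector exactly when g = 2, so this value is avoided; the three-handle matrix fixes that vector
    for every g. Block G adds 42 points without changing the fixed points of y and x y and with the
    same effect on x in every configuration; hence finitely many pairs, three for each class modulo
    14, suffice. *)

(** * Gluing in an abstract group *)

(* The commutator of x and y when x is an involution; with x^2 = y^3 = (x y)^7 = 1
   its cycles are what survives gluing. *)
Definition hword (gT : finGroupType) (x y : gT) : gT := x * y^-1 * x * y.

Definition strand_prod (gT : finGroupType) (A w : gT) : gT :=
  \prod_(1 <= j < 7) A ^ (w ^+ j).

Lemma expg3_inv (gT : finGroupType) (y : gT) : y ^+ 3 = 1 -> y^-1 = y ^+ 2.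
Proof. by move=> y3; apply: (mulgI y); rewrite mulgV -expgS y3. Qed.

(* Gluing multiplies x by A and A ^ y and only conjugates the commutator w: the conjugates
   A ^ (w ^ j) with 0 < j < 7 form the strand that leads from A to A ^ (y ^ 2). *)
Lemma glue_word (gT : finGroupType) (x y A : gT) (w := hword x y) :
  y ^+ 3 = 1 -> A * A = 1 -> commute A x ->
  (forall i j, commute (A ^ (w ^+ i)) (A ^ (w ^+ j))) ->
  A ^ (w ^+ 7) = A ^ (y ^+ 2) ->
  hword (x * A * A ^ y) y = w ^ strand_prod A w.
Proof.
move=> y3 A2 cAx cw A7.
have Ax : A ^ x = A by rewrite /conjg cAx mulKg.
have AV : A^-1 = A by apply: (mulgI A); rewrite mulgV A2.
set B := A ^ y; set C := A ^ (y ^+ 2).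
have By : B ^ y = C by rewrite /B /C expgS expg1 conjgM.
have AyV : A ^ y^-1 = C by rewrite expg3_inv.
have ByV : B ^ y^-1 = A by rewrite /B conjgK.
(* Conjugation by w runs through x, y^-1, x, y: it leaves A, then sends it to C, [C ^ x] and
   [(C ^ x) ^ y]. *)
have Aw : A ^ w = (C ^ x) ^ y.
  by rewrite /w /hword -!mulgA !conjgM Ax AyV.
have step : hword (x * A * B) y = w * (A ^ w * C).
  have e1 : A * B * y^-1 = y^-1 * (C * A).
    by rewrite [LHS]conjgC conjMg AyV ByV.
  have e2 : C * A * x * A = x * C ^ x.
    by rewrite -(mulgA C A x) cAx -mulgA -(mulgA x A A) A2 mulg1 conjgC.
  have e3 : x * C ^ x * B * y = x * y * (A ^ w * C).
    by rewrite Aw -By -conjMg -!mulgA -conjgC !mulgA.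
  rewrite /hword -(mulgA x A) -(mulgA x (A * B)) e1.
  have -> : x * (y^-1 * (C * A)) * (x * (A * B)) * y =
            x * y^-1 * (C * A * x * A) * B * y by rewrite !mulgA.
  rewrite e2; transitivity (x * y^-1 * (x * C ^ x * B * y)); first by rewrite !mulgA.
  by rewrite e3 /w /hword !mulgA.
rewrite step.
set Q := \prod_(2 <= j < 7) A ^ (w ^+ j).
have EL : strand_prod A w = A ^ w * Q.
  by rewrite /strand_prod big_ltn // expg1.
(* Conjugation by w shifts the strand by one place: it loses [A ^ w] and gains [A ^ (w ^+ 7) = C].
   The quotient of the two products is the factor [A ^ w * C] found in [step]. *)
have ELw : strand_prod A w ^ w = Q * C.
  rewrite /strand_prod (big_morph (fun u => u ^ w) (id1 := 1) (op1 := *%g));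
    [|by move=> u v; rewrite conjMg|exact: conj1g].
  rewrite big_nat_recr //= -conjgM -expgSr A7; congr (_ * C).
  rewrite /Q [RHS]big_add1 /=; apply: eq_bigr => j _.
  by rewrite -conjgM -expgSr.
have cQ j : commute (A ^ (w ^+ j)) Q.
  by rewrite /Q; apply: big_ind => [|u v|i _]; [exact: commute1| exact: commuteM|exact: cw].
have CC : C * C = 1 by rewrite /C -conjMg A2 conj1g.
have CV : C^-1 = C by rewrite -[LHS]mulg1 -CC mulKg.
have -> : w ^ strand_prod A w = w * ((strand_prod A w ^ w)^-1 * strand_prod A w).
  by rewrite -conjVg !conjgE !mulgA mulgV mul1g.
have c1 : A ^ w * Q = Q * A ^ w := cQ 1%N.
have c2 : C * A ^ w = A ^ w * C by rewrite /C -A7; apply: (cw 7 1%N).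
congr (w * _); rewrite ELw EL invMg CV c1.
by rewrite -(mulgA C) mulKg c2.
Qed.

Lemma glue_involution (gT : finGroupType) (x y A : gT) :
  x * x = 1 -> A * A = 1 -> commute A x -> commute (A ^ y) x ->
  commute A (A ^ y) -> (x * A * A ^ y) * (x * A * A ^ y) = 1.
Proof.
move=> x2 A2 cAx cBx cAB; set B := A ^ y.
have BB : B * B = 1 by rewrite /B -conjMg A2 conj1g.
have cP : commute (A * B) x by apply/commute_sym/commuteM; apply/commute_sym.
have PP : A * B * (A * B) = 1.
  by rewrite [in X in X * _]cAB -mulgA (mulgA A) A2 mul1g BB.
rewrite -(mulgA x A B); set P := A * B in PP cP *.
by rewrite (mulgA (x * P)) -(mulgA x P x) cP (mulgA x x) x2 mul1g PP.
Qed.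

(** Moving y to the left turns A and [A ^ y] into [A ^ y] and [A ^ (y ^+ 2)], which is what
    conjugation by the involution [A ^ y] produces. So x y keeps its order and its number of fixed
    points. *)
Lemma glue_conj (gT : finGroupType) (x y A : gT) :
  A * A = 1 -> commute (A ^ y) x -> commute (A ^ y) (A ^ (y ^+ 2)) ->
  x * A * A ^ y * y = (x * y) ^ (A ^ y).
Proof.
move=> A2 cBx cBC; set B := A ^ y; set C := A ^ (y ^+ 2).
have By : B ^ y = C by rewrite /B /C expgS expg1 conjgM.
have BB : B * B = 1 by rewrite /B -conjMg A2 conj1g.
have BV : B^-1 = B by apply: (mulgI B); rewrite mulgV BB.
have -> : x * A * B * y = x * y * (B * C).
  by rewrite -By /B -conjMg -!mulgA -conjgC !mulgA.
have e : B * (x * y) = x * y * C by rewrite mulgA (cBx : B * x = x * B) -mulgA [B * y]conjgC By mulgA.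
by rewrite conjgE BV (mulgA B (x * y)) e -(mulgA _ C) -(cBC : B * C = C * B).
Qed.

(** * Three-cycles *)

Definition cyc3 (T : finType) (i j k : T) : {perm T} := tperm i j * tperm i k.

Lemma cyc3J (T : finType) (i j k : T) (s : {perm T}) :
  cyc3 i j k ^ s = cyc3 (s i) (s j) (s k).
Proof. by rewrite conjMg !tpermJ. Qed.

Lemma cyc3E (T : finType) (i j k : T) : i != j -> k != i -> k != j ->
  forall p, cyc3 i j k p =
    if p == i then j else if p == j then k else if p == k then i else p.
Proof.
move=> ij ki kj p; rewrite permM.
have [->|pi] := eqVneq p i; first by rewrite tpermL tpermD // eq_sym.
have [->|pj] := eqVneq p j; first by rewrite tpermR tpermL.
rewrite (@tpermD _ i j p) 1?eq_sym //.
by have [->|pk] := eqVneq p k; [rewrite tpermR | rewrite tpermD // eq_sym].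
Qed.

Lemma cyc3_rot (T : finType) (i j k : T) : i != j -> k != i -> k != j ->
  cyc3 i j k = cyc3 j k i.
Proof.
move=> ij ki kj; apply/permP => p; rewrite !cyc3E // 1?eq_sym //.
have [->|pi] := eqVneq p i; last by case: (p == j); case: (p == k).
by rewrite (negPf ij) (negPf (_ : i != k)) // eq_sym.
Qed.

Lemma cyc3V (T : finType) (i j k : T) : i != j -> k != i -> k != j ->
  (cyc3 i j k)^-1 = cyc3 j i k.
Proof.
move=> ij ki kj; apply/eqP; rewrite eq_invg_mul; apply/eqP/permP => p.
have ji : j != i by rewrite eq_sym.
rewrite permM perm1 (cyc3E ji) // (cyc3E ij) //.
have [->|pi] := eqVneq p i; first by rewrite eqxx.
have [->|pj] := eqVneq p j; first by rewrite (negPf kj) (negPf ki) eqxx.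
have [->|pk] := eqVneq p k; first by rewrite (negPf ij) eqxx.
by rewrite (negPf pj) (negPf pi) (negPf pk).
Qed.

(** The third point of the 3-cycle is left open. This makes the relation an equivalence, and on each
    of its classes H contains every 3-cycle. *)
Definition link (T : finType) (H : {group {perm T}}) (i j : T) : Prop :=
  i = j \/ exists k, [/\ i != j, k != i, k != j & cyc3 i j k \in H].

Lemma link_refl (T : finType) (H : {group {perm T}}) i : link H i i.
Proof. by left. Qed.

Lemma link_sym (T : finType) (H : {group {perm T}}) i j :
  link H i j -> link H j i.
Proof.
case=> [->|[k [ij ki kj h]]]; [exact: link_refl | right; exists k].
by split=> //; [rewrite eq_sym | rewrite -cyc3V // groupV].
Qed.

Lemma link_trans (T : finType) (H : {group {perm T}}) i j l :
  link H i j -> link H j l -> link H i l.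
Proof.
case=> [->//|[k [ij ki kj h1]]]; case=> [<-|[m [jl mj ml h2]]].
  by right; exists k.
have [->|il] := eqVneq i l; first exact: link_refl.
have ji : j != i by rewrite eq_sym.
have li : l != i by rewrite eq_sym.
have lj : l != j by rewrite eq_sym.
have [E|kl] := eqVneq k l.
  right; exists j; split=> //.
  by rewrite -(@cyc3V _ l i j) // groupV cyc3_rot // -E.
have [E|mi] := eqVneq m i.
  apply: link_sym; right; exists j; split=> //.
  by rewrite -cyc3_rot // -E // eq_sym.
(* The 3-cycle j l m fixes i and sends j to l, so it conjugates i j k into a 3-cycle through i and
   l. *)
have := groupJ h1 h2; rewrite cyc3J !(cyc3E jl) // eqxx.
rewrite (negPf ij) (negPf il) (eq_sym i m) (negPf mi) (negPf kj) (negPf kl).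
case: (eqVneq k m) => [_|km] h3; right.
  by exists j.
by exists k.
Qed.

Lemma link_cyc3 (T : finType) (H : {group {perm T}}) i j k :
  i != j -> k != i -> k != j -> link H i j -> link H i k ->
  cyc3 i j k \in H.
Proof.
move=> ij ki kj; have ji : j != i by rewrite eq_sym.
have ik : i != k by rewrite eq_sym.
have jk : j != k by rewrite eq_sym.
case=> [E|[u [_ ui uj h1]]]; first by rewrite E eqxx in ij.
case=> [E|[v [_ vi vk h2]]]; first by rewrite E eqxx in ik.
have [<-//|uk] := eqVneq u k.
have iu : i != u by rewrite eq_sym.
have ku : k != u by rewrite eq_sym.
have ju : j != u by rewrite eq_sym.
have [E|vj] := eqVneq v j.
  by rewrite -(@cyc3_rot _ k i j) // -(@cyc3V _ i k j) // groupV -E.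
have rev : cyc3 k j i \in H -> cyc3 i j k \in H.
  by move=> h; rewrite cyc3_rot // -(@cyc3V _ k j i) // groupV.
have [E|vu] := eqVneq v u.
  have := groupJ h1 h2; rewrite cyc3J !(cyc3E ik) //.
  rewrite eqxx (negPf ji) (negPf jk) (eq_sym j v) (negPf vj) (negPf ui) (negPf uk).
  by rewrite E eqxx => /rev.
(* In the generic case i k v conjugates i j u to k j u. Conjugating i j u twice by k j u gives first
   i u k and then i k j, the inverse of the cycle wanted. *)
have := groupJ h1 h2; rewrite cyc3J !(cyc3E ik) //.
rewrite eqxx (negPf ji) (negPf jk) (eq_sym j v) (negPf vj) (negPf ui) (negPf uk).
rewrite (eq_sym u v) (negPf vu) => h3.
have ci : cyc3 k j u i = i by rewrite cyc3E // (negPf ik) (negPf ij) (negPf iu).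
have cj : cyc3 k j u j = u by rewrite cyc3E // (negPf jk) eqxx.
have cu : cyc3 k j u u = k by rewrite cyc3E // (negPf uk) (negPf uj) eqxx.
have ck : cyc3 k j u k = j by rewrite cyc3E // eqxx.
have := groupJ (groupJ h1 h3) h3; rewrite !cyc3J !ci cj !cu ck.
by rewrite -(@cyc3_rot _ k i j) // -(@cyc3V _ i k j) // groupV.
Qed.

Lemma linkJ (T : finType) (H : {group {perm T}}) (y : {perm T}) i j :
  (forall s, s \in H -> s ^ y \in H) -> link H i j -> link H (y i) (y j).
Proof.
move=> Hy [->|[k [ij ki kj h]]]; [exact: link_refl | right; exists (y k)].
by rewrite !(inj_eq perm_inj) -cyc3J; split=> //; apply: Hy.
Qed.

(** Transitivity in the form of an induction principle, which can be restricted to each half of a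
    glued set. *)
Definition transitive_pair (T : finType) (x y : {perm T}) : Prop :=
  forall P : T -> Prop, (forall i, P i -> P (x i)) -> (forall i, P i -> P (y i)) ->
  forall i j, P i -> P j.

(* After gluing, the new involution still acts as x on the permutations that fix every
   handle point (the points of Q). *)
Definition core_closed (T : finType) (x y : {perm T}) (Q : pred T)
    (H : {group {perm T}}) : Prop :=
  (forall s, s \in H -> s ^ y \in H) /\
  (forall s, s \in H -> (forall q, Q q -> s q = q) -> s ^ x \in H).

(* The conjugation by x is available only away from Q, which is why three spare points
   e1, e2, e3 are required. *)
Lemma link_all (T : finType) (x y : {perm T}) (Q : pred T)
    (H : {group {perm T}}) (c e f e1 e2 e3 : T) :
  core_closed x y Q H -> (forall q, Q q -> x q = q) -> transitive_pair x y ->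
  link H c e -> link H c (y e) ->
  link H c f -> link H c (x f) -> ~~ Q f ->
  [/\ link H c e1, link H c e2 & link H c e3] ->
  [/\ ~~ Q e1, ~~ Q e2 & ~~ Q e3] -> [/\ e1 != e2, e1 != e3 & e2 != e3] ->
  forall i j, link H i j.
Proof.
move=> [Hy Hx] xQ tr le lye lf lxf nf [l1 l2 l3] [n1 n2 n3] [d12 d13 d23].
suff main i : link H c i.
  by move=> i j; apply: link_trans (main j); apply: link_sym.
(* A class of [link] that meets its image under y is stable under y; here both e and [y e] lie in
   it. For x the same is done with f and [x f], using a 3-cycle on f, i and a spare point so that Q
   stays fixed. *)
apply: (tr (link H c) _ _ c); last exact: link_refl; last first.
  move=> {}i li; apply: link_trans lye _; apply: linkJ => //.
  exact: link_trans (link_sym le) li.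
move=> {}i li; have [/xQ->//|ni] := boolP (Q i).
apply: link_trans lxf _; have [<-|fi] := eqVneq f i; first exact: link_refl.
have [k [lk nk kf ki]] : exists k, [/\ link H c k, ~~ Q k, k != f & k != i].
  have [E1|E1] := boolP (e1 \in [:: f; i]); last first.
    by exists e1; move: E1; rewrite !inE negb_or => /andP[].
  have [E2|E2] := boolP (e2 \in [:: f; i]); last first.
    by exists e2; move: E2; rewrite !inE negb_or => /andP[].
  exists e3; split=> //.
    by apply: contraNneq d12 => E3; move: E1 E2 d13 d23; rewrite !inE E3;
       do 2![case/orP => /eqP->]; rewrite ?eqxx.
  by apply: contraNneq d12 => E3; move: E1 E2 d13 d23; rewrite !inE E3;
     do 2![case/orP => /eqP->]; rewrite ?eqxx.
right; exists (x k); rewrite !(inj_eq perm_inj); split=> //; rewrite -cyc3J.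
apply: Hx => [|q Qq].
  by apply: link_cyc3 => //; apply: link_trans (link_sym lf) _.
rewrite cyc3E // !ifN //; apply: contraTneq Qq => -> //.
Qed.

(** The supports of a and b meet in u only, so [a ^ b] is a with u renamed to [b u], and it differs
    from a only near u. *)
Lemma comm_cyc3 (T : finType) (a b : {perm T}) (u : T) :
  a u != u -> b u != u -> (forall p, p != u -> a p = p \/ b p = p) ->
  [~ a, b] = cyc3 u (b u) (a u).
Proof.
move=> au bu ab; have ba1 : b (a u) = a u.
  by case: (ab (a u)) => // /perm_inj E; rewrite E eqxx in au.
have ab1 : a (b u) = b u.
  by case: (ab (b u)) => // /perm_inj E; rewrite E eqxx in bu.
have aub : a u != b u.
  by apply: contraNneq bu => E; rewrite -E in ab1; move/perm_inj: ab1 => E1; rewrite -E E1.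
have aV p : a p = p -> a^-1 p = p by move=> E; rewrite -{1}E permK.
have bV p : b p = p -> b^-1 p = p by move=> E; rewrite -{1}E permK.
apply/permP => p; rewrite cyc3E // 1?eq_sym // commgEl conjgE !permM.
have [->|pu] := eqVneq p u.
  have [v Ev] : exists v, a v = u by exists (a^-1 u); rewrite permKV.
  have vu : v != u by apply: contraNneq au => E; rewrite -{1}E Ev.
  rewrite -{1}Ev permK bV ?Ev //; case: (ab v vu) => // E.
  by rewrite Ev in E; rewrite E eqxx in vu.
have [->|pb] := eqVneq p (b u).
  by rewrite (aV _ ab1) permK ba1.
have [->|pa] := eqVneq p (a u).
  have [v Ev] : exists v, b v = u by exists (b^-1 u); rewrite permKV.
  have vu : v != u by apply: contraNneq bu => E; rewrite -{1}E Ev.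
  rewrite permK -{1}Ev permK.
  suff -> : a v = v by [].
  case: (ab v vu) => // E; rewrite Ev in E; by rewrite E eqxx in vu.
case: (ab p pu) => [Ea|Eb].
  rewrite (aV _ Ea); set q := b^-1 p.
  have bq : b q = p by rewrite permKV.
  have qu : q != u by apply: contraNneq pb => <-; rewrite bq.
  case: (ab q qu) => [->//|Eb]; move: bq; rewrite Eb => Eq; rewrite Eq Ea -[in RHS]Eq.
  by rewrite -Eq.
set r := a^-1 p.
have ar : a r = p by rewrite permKV.
have ru : r != u by apply: contraNneq pa => <-; rewrite ar.
have br : b r = r.
  by case: (ab r ru) => // E; move: ar; rewrite E => ->.
by rewrite (bV _ br) ar.
Qed.

(** * Handles *)

(* The seven step return from a to y^2 a is the hypothesis of glue_word; the length 13 of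
   the cycle is a choice that makes one exponent serve all handles. *)
Definition handle (T : finType) (x y : {perm T}) (a : T) : Prop :=
  let w := hword x y in
  [/\ x a = a, x (y a) = y a, (w ^+ 13) a = a, w a != a & (w ^+ 7) a = (y ^+ 2) a].

(** Since w moves every handle but fixes its image under y, no point [y b] lies on the w-cycle of a
    handle; the transpositions at handles and at their images are thus disjoint. *)
Lemma handle_wy (T : finType) (x y : {perm T}) a :
  handle x y a -> hword x y (y a) = y a.
Proof. by case=> xa xya _ _ _; rewrite /hword !permM xya permK xa. Qed.

(** As 13 is prime, a moved point with [(w ^+ 13) a = a] has an orbit of exactly 13 points. *)
Lemma orbit13 (T : finType) (w : {perm T}) (a : T) i j :
  (w ^+ 13) a = a -> w a != a -> ((w ^+ i) a == (w ^+ j) a) = (i == j %[mod 13]).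
Proof.
move=> w13 wa.
have red m : (w ^+ m) a = (w ^+ (m %% 13)) a.
  rewrite {1}(divn_eq m 13) addnC expgD mulnC expgM permM.
  have fixe l p : (w ^+ 13) p = p -> ((w ^+ 13) ^+ l) p = p.
    by move=> E; elim: l => [|l IH]; rewrite ?expg0 ?perm1 // expgS permM E.
  apply: fixe; rewrite -permM -expgD addnC expgD permM w13 //.
apply/idP/idP => [|/eqP E]; last by rewrite red [in eqbRHS]red E.
rewrite red [in eqbRHS]red.
have lt m : m %% 13 < 13 by rewrite ltn_mod.
move: (i %% 13) (j %% 13) (lt i) (lt j) => {lt}i {}j.
wlog ij : i j / i <= j.
  move=> H hi hj E; case/orP: (leq_total i j) => h; first exact: H.
  by rewrite eq_sym; apply: H => //; rewrite eq_sym.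
move=> hi hj /eqP E.
have Ed : (w ^+ (j - i)) a = a.
  by apply: (@perm_inj _ (w ^+ i)); rewrite -permM -expgD subnK.
apply: contraNT wa => nij; have dp : 0 < j - i by rewrite subn_gt0 ltn_neqAle nij.
have co : coprime (j - i) 13.
  rewrite coprime_sym prime_coprime //; apply/negP => /dvdn_leq; rewrite dp => /(_ isT).
  by rewrite leqNgt (leq_ltn_trans (leq_subr _ _) hj).
have fixe m l : (w ^+ m) a = a -> (w ^+ (m * l)) a = a.
  by move=> Em; elim: l => [|l IH]; rewrite ?muln0 ?expg0 ?perm1 // mulnS expgD permM Em.
case: (egcdnP 13 dp) => km kn Ek _; move: Ek; rewrite (eqP co) => Ek.
have := fixe _ km Ed; rewrite mulnC Ek addn1 expgSr permM mulnC fixe //.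
by move=> ->.
Qed.

Lemma handle_orbit_y (T : finType) (x y : {perm T}) a b i :
  handle x y a -> handle x y b -> ((hword x y ^+ i) a == y b) = false.
Proof.
move=> ha hb; apply/eqP => E; case: (ha) => _ _ _ /eqP wa _; apply: wa.
apply: (@perm_inj _ (hword x y ^+ i)).
by rewrite -permM -expgS expgSr permM E (handle_wy hb).
Qed.

(** By [sys_far] different handles lie on different cycles of w, so the strand of a gluing at one
    handle leaves the others intact. *)
Record handle_system (T : finType) (x y : {perm T}) (hs : seq T) : Prop := Sys {
  sys_x2 : x * x = 1;
  sys_y3 : y ^+ 3 = 1;
  sys_z7 : (x * y) ^+ 7 = 1;
  sys_handle : forall a, a \in hs -> handle x y a;
  sys_far : forall a b, a \in hs -> b \in hs -> a != b ->
              forall i, (hword x y ^+ i) a != b;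
  sys_uniq : uniq hs;
  sys_tr : transitive_pair x y
}.

Definition handle_point (T : finType) (y : {perm T}) (hs : seq T) : pred T :=
  fun p => (p \in hs) || (p \in map y hs).

(* From a power w^K of the commutator, and conjugations that remain available after gluing,
   one obtains a 3-cycle, hence all even permutations. *)
Definition seed (K : nat) (T : finType) (x y : {perm T}) (hs : seq T) : Prop :=
  exists d,
    [/\ y d != d, x (y d) != y d, x (y d) != d,
        [/\ ~~ handle_point y hs d, ~~ handle_point y hs (y d) & ~~ handle_point y hs (x (y d))]
      & forall H : {group {perm T}}, core_closed x y (handle_point y hs) H ->
          hword x y ^+ K \in H -> cyc3 d (y d) (x (y d)) \in H].

Definition fixn (T : finType) (s : {perm T}) : nat := #|[set p | s p == p]|.

Lemma fixnJ (T : finType) (s t : {perm T}) : fixn (s ^ t) = fixn s.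
Proof.
rewrite /fixn -(card_imset [set p | s p == p] (@perm_inj _ t)); congr #|pred_of_set _|.
apply/setP => p; rewrite [LHS]inE; apply/eqP/imsetP => [E|[q]].
  exists (t^-1 p); last by rewrite permKV.
  rewrite inE; apply/eqP/(@perm_inj _ t); rewrite permKV.
  by rewrite -[in RHS]E conjgE !permM.
by rewrite inE => /eqP E ->; rewrite conjgE !permM permK E.
Qed.

(** * Gluing two permutation representations *)

Definition perm_sum_fun m n (s : 'S_m) (t : 'S_n) (p : 'I_(m + n)) : 'I_(m + n) :=
  match split p with inl i => lshift n (s i) | inr j => rshift m (t j) end.

Lemma perm_sum_inj m n (s : 'S_m) (t : 'S_n) : injective (perm_sum_fun s t).
Proof.
move=> p q; rewrite /perm_sum_fun; case: (split_ordP p) => i ->; case: (split_ordP q) => j ->.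
- by move/lshift_inj/perm_inj->.
- by move/eqP; rewrite eq_lrshift.
- by move/eqP; rewrite eq_rlshift.
- by move/rshift_inj/perm_inj->.
Qed.

Definition perm_sum m n (s : 'S_m) (t : 'S_n) : 'S_(m + n) := perm (@perm_sum_inj m n s t).

Lemma perm_sumL m n (s : 'S_m) (t : 'S_n) i : perm_sum s t (lshift n i) = lshift n (s i).
Proof. by rewrite permE /perm_sum_fun (unsplitK (inl i)). Qed.

Lemma perm_sumR m n (s : 'S_m) (t : 'S_n) i : perm_sum s t (rshift m i) = rshift m (t i).
Proof. by rewrite permE /perm_sum_fun (unsplitK (inr i)). Qed.

Lemma perm_sumM m n (s s' : 'S_m) (t t' : 'S_n) :
  perm_sum s t * perm_sum s' t' = perm_sum (s * s') (t * t').
Proof.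
by apply/permP => p; rewrite permM; case: (split_ordP p) => i ->;
   rewrite ?perm_sumL ?perm_sumR permM.
Qed.

Lemma perm_sum1 m n : perm_sum 1 1 = 1 :> 'S_(m + n).
Proof.
by apply/permP => p; case: (split_ordP p) => i ->; rewrite ?perm_sumL ?perm_sumR !perm1.
Qed.

Lemma perm_sumX m n (s : 'S_m) (t : 'S_n) k : perm_sum s t ^+ k = perm_sum (s ^+ k) (t ^+ k).
Proof. by elim: k => [|k IH]; rewrite ?perm_sum1 // !expgS IH perm_sumM. Qed.

Lemma perm_sumV m n (s : 'S_m) (t : 'S_n) : (perm_sum s t)^-1 = perm_sum s^-1 t^-1.
Proof. by apply/eqP; rewrite eq_invg_mul perm_sumM !mulgV perm_sum1. Qed.

Lemma perm_sum_hword m n (x y : 'S_m) (x' y' : 'S_n) :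
  hword (perm_sum x x') (perm_sum y y') = perm_sum (hword x y) (hword x' y').
Proof. by rewrite /hword perm_sumV !perm_sumM. Qed.

Lemma fixn_perm_sum m n (s : 'S_m) (t : 'S_n) : fixn (perm_sum s t) = (fixn s + fixn t)%N.
Proof.
rewrite /fixn -(card_imset _ (@lshift_inj m n)) -(card_imset _ (@rshift_inj m n)).
rewrite -cardsUI [X in (_ + #|pred_of_set X|)%N](_ : _ = set0) ?cards0 ?addn0; last first.
  apply/setP => p; rewrite !inE; apply/negP => /andP[/imsetP[i _ ->] /imsetP[j _]].
  by move/eqP; rewrite eq_lrshift.
congr #|pred_of_set _|; apply/setP => p; rewrite [in LHS]inE [in RHS]inE.
case: (split_ordP p) => i ->; rewrite ?perm_sumL ?perm_sumR.
  rewrite (inj_eq (@lshift_inj m n)) mem_imset ?inE; last exact: lshift_inj.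
  rewrite [X in _ || X](_ : _ = false) ?orbF //.
  by apply/imsetP => -[j _ /eqP]; rewrite eq_lrshift.
rewrite (inj_eq (@rshift_inj m n)) orbC mem_imset ?inE; last exact: rshift_inj.
rewrite [X in _ || X](_ : _ = false) ?orbF //.
by apply/imsetP => -[j _ /eqP]; rewrite eq_rlshift.
Qed.

Definition joint m n (a : 'I_m) (b : 'I_n) : 'S_(m + n) :=
  tperm (lshift n a) (rshift m b).

Definition glue_inv m n (x1 y1 : 'S_m) (x2 y2 : 'S_n) a b : 'S_(m + n) :=
  perm_sum x1 x2 * joint a b * joint a b ^ perm_sum y1 y2.

Lemma jointJ m n (s : 'S_m) (t : 'S_n) a b : joint a b ^ perm_sum s t = joint (s a) (t b).
Proof. by rewrite tpermJ perm_sumL perm_sumR. Qed.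

Lemma joint2 m n (a : 'I_m) (b : 'I_n) : joint a b * joint a b = 1.
Proof. exact: tperm2. Qed.

Lemma jointL m n (a : 'I_m) (b : 'I_n) i : i != a -> joint a b (lshift n i) = lshift n i.
Proof.
move=> ia; rewrite tpermD // ?eq_rlshift //.
by rewrite (inj_eq (@lshift_inj m n)) eq_sym.
Qed.

Lemma jointR m n (a : 'I_m) (b : 'I_n) i : i != b -> joint a b (rshift m i) = rshift m i.
Proof.
move=> ia; rewrite tpermD // ?eq_lrshift //.
by rewrite (inj_eq (@rshift_inj m n)) eq_sym.
Qed.

Lemma commute_conj (gT : finGroupType) (s t : gT) : s ^ t = s -> commute s t.
Proof. by move=> E; rewrite /commute conjgC E. Qed.

Lemma joint_commute m n (a a' : 'I_m) (b b' : 'I_n) :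
  (a == a') = (b == b') -> commute (joint a b) (joint a' b').
Proof.
have [<-|ab] := eqVneq a a'; first by move/esym/eqP <-.
move/esym/negbT => bb; apply: commute_conj.
by rewrite tpermJ jointL // jointR.
Qed.

Lemma joint_commute_psum m n (s : 'S_m) (t : 'S_n) a b :
  s a = a -> t b = b -> commute (joint a b) (perm_sum s t).
Proof. by move=> sa tb; apply: commute_conj; rewrite jointJ sa tb. Qed.

Lemma handle_ya (T : finType) (x y : {perm T}) a b :
  handle x y a -> handle x y b -> (a == y b) = false.
Proof. by move=> ha hb; have := handle_orbit_y 0 ha hb; rewrite expg0 perm1. Qed.

Lemma glue_joint_word m n (x1 y1 : 'S_m) (x2 y2 : 'S_n) a b :
  handle x1 y1 a -> handle x2 y2 b -> y1 ^+ 3 = 1 -> y2 ^+ 3 = 1 ->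
  hword (glue_inv x1 y1 x2 y2 a b) (perm_sum y1 y2) =
  perm_sum (hword x1 y1) (hword x2 y2)
    ^ strand_prod (joint a b) (perm_sum (hword x1 y1) (hword x2 y2)).
Proof.
move=> ha hb y13 y23; case: (ha) => xa xya wa13 wa1 wa7.
case: (hb) => xb xyb wb13 wb1 wb7; rewrite -perm_sum_hword.
apply: glue_word.
- by rewrite perm_sumX y13 y23 perm_sum1.
- exact: joint2.
- exact: joint_commute_psum.
- move=> i j; rewrite perm_sum_hword !perm_sumX !jointJ; apply: joint_commute.
  by rewrite !orbit13.
- by rewrite perm_sum_hword !perm_sumX !jointJ wa7 wb7.
Qed.

Lemma strand_fixL m n (u : 'S_m) (v : 'S_n) a b c :
  (u ^+ 13) a = a -> (forall i, (u ^+ i) a != c) ->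
  strand_prod (joint a b) (perm_sum u v) (lshift n c) = lshift n c.
Proof.
move=> u13 far; rewrite /strand_prod.
apply: (big_ind (fun s : {perm _} => s (lshift n c) = lshift n c)) => [|s t Es Et|i _].
- by rewrite perm1.
- by rewrite permM Es Et.
- by rewrite perm_sumX jointJ jointL // eq_sym.
Qed.

Lemma strand_fixR m n (u : 'S_m) (v : 'S_n) a b c :
  (forall i, (v ^+ i) b != c) ->
  strand_prod (joint a b) (perm_sum u v) (rshift m c) = rshift m c.
Proof.
move=> far; rewrite /strand_prod.
apply: (big_ind (fun s : {perm _} => s (rshift m c) = rshift m c)) => [|s t Es Et|i _].
- by rewrite perm1.
- by rewrite permM Es Et.
- by rewrite perm_sumX jointJ jointR // eq_sym.
Qed.

Lemma far_orbit (T : finType) (w : {perm T}) (a c : T) :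
  (w ^+ 13) c = c -> (forall i, (w ^+ i) a != c) ->
  forall i j, (w ^+ i) a != (w ^+ j) c.
Proof.
(* On the orbit of c the power [w ^+ (12 * j)] inverts [w ^+ j]. *)
move=> c13 far i j; apply: contraNneq (far (i + 12 * j)%N) => E.
rewrite expgD permM E -permM -expgD -mulSn expgM.
by elim: j {E} => [|j IH]; rewrite ?perm1 // expgS permM c13.
Qed.

Lemma conjX_fix (T : finType) (w l : {perm T}) p k :
  l p = p -> l ((w ^+ k) p) = (w ^+ k) p -> ((w ^ l) ^+ k) p = (w ^+ k) p.
Proof.
move=> lp lw; rewrite -conjXg conjgE !permM.
by rewrite -{1}lp permK lw.
Qed.

(** The new commutator is the old one conjugated by the strand, and the strand moves only points on
    the cycles through a and b. On the cycle of c nothing changes. *)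
Lemma glue_wL m n (x1 y1 : 'S_m) (x2 y2 : 'S_n) a b c k :
  handle x1 y1 a -> handle x2 y2 b -> y1 ^+ 3 = 1 -> y2 ^+ 3 = 1 ->
  (hword x1 y1 ^+ 13) c = c -> (forall i, (hword x1 y1 ^+ i) a != c) ->
  (hword (glue_inv x1 y1 x2 y2 a b) (perm_sum y1 y2) ^+ k) (lshift n c) =
  lshift n ((hword x1 y1 ^+ k) c).
Proof.
move=> ha hb y13 y23 c13 far; case: (ha) => _ _ a13 _ _.
rewrite glue_joint_word // conjX_fix ?perm_sumX ?perm_sumL ?strand_fixL // => i.
exact: far_orbit.
Qed.

Lemma glue_wR m n (x1 y1 : 'S_m) (x2 y2 : 'S_n) a b c k :
  handle x1 y1 a -> handle x2 y2 b -> y1 ^+ 3 = 1 -> y2 ^+ 3 = 1 ->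
  (hword x2 y2 ^+ 13) c = c -> (forall i, (hword x2 y2 ^+ i) b != c) ->
  (hword (glue_inv x1 y1 x2 y2 a b) (perm_sum y1 y2) ^+ k) (rshift m c) =
  rshift m ((hword x2 y2 ^+ k) c).
Proof.
move=> ha hb y13 y23 c13 far.
rewrite glue_joint_word // conjX_fix ?perm_sumX ?perm_sumR ?strand_fixR // => i.
exact: far_orbit.
Qed.

Lemma handle13 (T : finType) (x y : {perm T}) a : handle x y a -> (hword x y ^+ 13) a = a.
Proof. by case. Qed.

Lemma handleL m n (x1 y1 : 'S_m) (x2 y2 : 'S_n) a b c :
  handle x1 y1 a -> handle x2 y2 b -> y1 ^+ 3 = 1 -> y2 ^+ 3 = 1 ->
  handle x1 y1 c -> (forall i, (hword x1 y1 ^+ i) a != c) ->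
  handle (glue_inv x1 y1 x2 y2 a b) (perm_sum y1 y2) (lshift n c).
Proof.
move=> ha hb y13 y23 hc far; case: (hc) => xc xyc c13 c1 c7.
have ca : c != a by rewrite eq_sym; have := far 0; rewrite expg0 perm1.
have cya : c != y1 a by rewrite (handle_ya hc ha).
have yca : y1 c != a by rewrite eq_sym (handle_ya ha hc).
have ycya : y1 c != y1 a by rewrite (inj_eq perm_inj).
have wE k := glue_wL k ha hb y13 y23 c13 far.
split.
- by rewrite /glue_inv jointJ !permM perm_sumL xc !jointL.
- by rewrite perm_sumL /glue_inv jointJ !permM perm_sumL xyc !jointL.
- by rewrite wE c13.
- by have := wE 1%N; rewrite !expg1 => ->; rewrite (inj_eq (@lshift_inj m n)).
- by rewrite wE perm_sumX perm_sumL c7.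
Qed.

Lemma handleR m n (x1 y1 : 'S_m) (x2 y2 : 'S_n) a b c :
  handle x1 y1 a -> handle x2 y2 b -> y1 ^+ 3 = 1 -> y2 ^+ 3 = 1 ->
  handle x2 y2 c -> (forall i, (hword x2 y2 ^+ i) b != c) ->
  handle (glue_inv x1 y1 x2 y2 a b) (perm_sum y1 y2) (rshift m c).
Proof.
move=> ha hb y13 y23 hc far; case: (hc) => xc xyc c13 c1 c7.
have ca : c != b by rewrite eq_sym; have := far 0; rewrite expg0 perm1.
have cya : c != y2 b by rewrite (handle_ya hc hb).
have yca : y2 c != b by rewrite eq_sym (handle_ya hb hc).
have ycya : y2 c != y2 b by rewrite (inj_eq perm_inj).
have wE k := glue_wR k ha hb y13 y23 c13 far.
split.
- by rewrite /glue_inv jointJ !permM perm_sumR xc !jointR.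
- by rewrite perm_sumR /glue_inv jointJ !permM perm_sumR xyc !jointR.
- by rewrite wE c13.
- by have := wE 1%N; rewrite !expg1 => ->; rewrite (inj_eq (@rshift_inj m n)).
- by rewrite wE perm_sumX perm_sumR c7.
Qed.

Lemma glue_inv_L m n (x1 y1 : 'S_m) (x2 y2 : 'S_n) a b i :
  x1 a = a -> x1 (y1 a) = y1 a -> i != a -> i != y1 a ->
  glue_inv x1 y1 x2 y2 a b (lshift n i) = lshift n (x1 i).
Proof.
move=> xa xya ia iya; rewrite /glue_inv jointJ !permM perm_sumL !jointL //.
  by rewrite -xya (inj_eq perm_inj).
by rewrite -xa (inj_eq perm_inj).
Qed.

Lemma glue_inv_R m n (x1 y1 : 'S_m) (x2 y2 : 'S_n) a b i :
  x2 b = b -> x2 (y2 b) = y2 b -> i != b -> i != y2 b ->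
  glue_inv x1 y1 x2 y2 a b (rshift m i) = rshift m (x2 i).
Proof.
move=> xa xya ia iya; rewrite /glue_inv jointJ !permM perm_sumR !jointR //.
  by rewrite -xya (inj_eq perm_inj).
by rewrite -xa (inj_eq perm_inj).
Qed.

Lemma glue_inv_a m n (x1 y1 : 'S_m) (x2 y2 : 'S_n) a b :
  x1 a = a -> x2 b = b -> a != y1 a -> b != y2 b ->
  glue_inv x1 y1 x2 y2 a b (lshift n a) = rshift m b /\
  glue_inv x1 y1 x2 y2 a b (rshift m b) = lshift n a.
Proof.
move=> xa xb aya byb; rewrite /glue_inv jointJ !permM perm_sumL perm_sumR xa xb.
by rewrite tpermL tpermR jointR // jointL.
Qed.

Lemma glue_inv_ya m n (x1 y1 : 'S_m) (x2 y2 : 'S_n) a b :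
  x1 (y1 a) = y1 a -> x2 (y2 b) = y2 b -> a != y1 a -> b != y2 b ->
  glue_inv x1 y1 x2 y2 a b (lshift n (y1 a)) = rshift m (y2 b) /\
  glue_inv x1 y1 x2 y2 a b (rshift m (y2 b)) = lshift n (y1 a).
Proof.
move=> xa xb aya byb; rewrite /glue_inv jointJ !permM perm_sumL perm_sumR xa xb.
by rewrite jointL 1?eq_sym // jointR 1?eq_sym // tpermL tpermR.
Qed.

Lemma handle_aya (T : finType) (x y : {perm T}) a : handle x y a -> a != y a.
Proof. by move=> h; rewrite (handle_ya h h). Qed.

(** On each half the new involution differs from the old one only at the handle and its image under
    y, which the old one fixes; so each half stays connected, and a is sent to b. *)
Lemma glue_transitive_pair m n (x1 y1 : 'S_m) (x2 y2 : 'S_n) a b :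
  handle x1 y1 a -> handle x2 y2 b -> transitive_pair x1 y1 -> transitive_pair x2 y2 ->
  transitive_pair (glue_inv x1 y1 x2 y2 a b) (perm_sum y1 y2).
Proof.
move=> ha hb tr1 tr2 P Px Py p q; set X := glue_inv _ _ _ _ _ _ in Px.
case: (ha) => xa xya _ _ _; case: (hb) => xb xyb _ _ _.
have aya := handle_aya ha; have byb := handle_aya hb.
have [XLa XRb] := glue_inv_a xa xb aya byb.
have left i j : P (lshift n i) -> P (lshift n j).
  apply: (tr1 (fun i => P (lshift n i))) => {}i Pi; last by rewrite -(perm_sumL y1 y2); apply: Py.
  have [E|ia] := eqVneq i a; first by rewrite E xa -E.
  have [E|iya] := eqVneq i (y1 a); first by rewrite E xya -E.
  by rewrite -(glue_inv_L x2 y2 b xa xya ia iya); apply: Px.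
have right i j : P (rshift m i) -> P (rshift m j).
  apply: (tr2 (fun i => P (rshift m i))) => {}i Pi; last by rewrite -(perm_sumR y1 y2); apply: Py.
  have [E|ia] := eqVneq i b; first by rewrite E xb -E.
  have [E|iya] := eqVneq i (y2 b); first by rewrite E xyb -E.
  by rewrite -(glue_inv_R x1 y1 a xb xyb ia iya); apply: Px.
case: (split_ordP p) => i -> Pi; case: (split_ordP q) => j ->.
- exact: left Pi.
- apply: (right b); rewrite -XLa; apply: Px; exact: left Pi.
- apply: (left a); rewrite -XRb; apply: Px; exact: right Pi.
- exact: right Pi.
Qed.

Lemma sys_far_head (T : finType) (x y : {perm T}) a hs c :
  handle_system x y (a :: hs) -> c \in hs -> forall i, (hword x y ^+ i) a != c.
Proof.
move=> S ch; apply: (sys_far S); rewrite ?mem_head ?inE ?ch ?orbT //.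
by have /= /andP[an _] := sys_uniq S; apply: contraNneq an => ->.
Qed.

Lemma glue_sys m n (x1 y1 : 'S_m) (x2 y2 : 'S_n) a b hs1 hs2 :
  handle_system x1 y1 (a :: hs1) -> handle_system x2 y2 (b :: hs2) ->
  handle_system (glue_inv x1 y1 x2 y2 a b) (perm_sum y1 y2) (map (lshift n) hs1 ++ map (@rshift m n) hs2).
Proof.
move=> S1 S2; have ha := sys_handle S1 (mem_head _ _).
have hb := sys_handle S2 (mem_head _ _).
have y13 := sys_y3 S1; have y23 := sys_y3 S2.
have f1 c (hc : c \in hs1) := sys_far_head S1 hc.
have f2 c (hc : c \in hs2) := sys_far_head S2 hc.
have h1 c : c \in hs1 -> handle x1 y1 c.
  by move=> hc; apply: (sys_handle S1); rewrite inE hc orbT.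
have h2 c : c \in hs2 -> handle x2 y2 c.
  by move=> hc; apply: (sys_handle S2); rewrite inE hc orbT.
case: (ha) => xa xya _ _ _; case: (hb) => xb xyb _ _ _.
have /= /andP[an1 un1] := sys_uniq S1; have /= /andP[bn2 un2] := sys_uniq S2.
have aya := handle_aya ha; have byb := handle_aya hb.
split.
- apply: glue_involution; rewrite ?jointJ.
  + by rewrite perm_sumM (sys_x2 S1) (sys_x2 S2) perm_sum1.
  + exact: joint2.
  + exact: joint_commute_psum.
  + exact: joint_commute_psum.
  + by apply: joint_commute; rewrite (negPf aya) (negPf byb).
- by rewrite perm_sumX y13 y23 perm_sum1.
- rewrite glue_conj ?joint2 //.
  + by rewrite -conjXg perm_sumM perm_sumX (sys_z7 S1) (sys_z7 S2) perm_sum1 conj1g.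
  + by rewrite jointJ; apply: joint_commute_psum.
  + rewrite perm_sumX !jointJ; apply: joint_commute.
    have yy k (y : 'S_k) c : (y ^+ 2) c = y (y c) by rewrite expgS permM expg1.
    by rewrite !yy !(inj_eq perm_inj) (negPf aya) (negPf byb).
- move=> c; rewrite mem_cat => /orP[] /mapP[d hd ->].
    by apply: handleL; auto.
  by apply: handleR; auto.
- move=> c d; rewrite !mem_cat => /orP[] /mapP[c' hc' ->] /orP[] /mapP[d' hd' ->] cd i.
  + rewrite glue_wL // ?(handle13 (h1 _ hc')) ?(inj_eq (@lshift_inj m n)) //; last exact: f1.
    apply: (sys_far S1); rewrite ?inE ?hc' ?hd' ?orbT //.
  + by rewrite glue_wL // ?(handle13 (h1 _ hc')) ?eq_lrshift //; apply: f1.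
  + by rewrite glue_wR // ?(handle13 (h2 _ hc')) ?eq_rlshift //; apply: f2.
  + rewrite glue_wR // ?(handle13 (h2 _ hc')) ?(inj_eq (@rshift_inj m n)) //; last exact: f2.
    apply: (sys_far S2); rewrite ?inE ?hc' ?hd' ?orbT //.
    by move: cd; rewrite (inj_eq (@rshift_inj m n)).
- rewrite cat_uniq !map_inj_uniq ?un1 ?un2 /= ?andbT; try exact: lshift_inj; try exact: rshift_inj.
  by apply/hasPn => c /mapP[d _ ->]; apply/mapP => -[e _ /eqP]; rewrite eq_rlshift.
- by apply: glue_transitive_pair => //; [exact: (sys_tr S1) | exact: (sys_tr S2)].
Qed.

(** * Seeds survive gluing *)

Definition lift_group m n (H : {group 'S_(m + n)}) : {set 'S_m} :=
  [set s | perm_sum s 1 \in H].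

Lemma lift_group_set m n (H : {group 'S_(m + n)}) : group_set (lift_group H).
Proof.
apply/group_setP; split=> [|s t]; first by rewrite inE perm_sum1 group1.
by rewrite !inE => hs ht; rewrite -[X in perm_sum _ X](mulg1 1) -perm_sumM groupM.
Qed.

Canonical lift_group_group m n (H : {group 'S_(m + n)}) : {group 'S_m} :=
  Group (lift_group_set H).

Lemma hpoint_map m n (y1 : 'S_m) (y2 : 'S_n) hs1 hs2 p :
  (handle_point (perm_sum y1 y2) (map (lshift n) hs1 ++ map (@rshift m n) hs2) (lshift n p)
     = handle_point y1 hs1 p).
Proof.
rewrite /handle_point map_cat !mem_cat !mem_map; try exact: lshift_inj.
have no (u : seq 'I_n) : (lshift n p \in map (@rshift m n) u) = false.
  by apply/mapP => -[e _ /eqP]; rewrite eq_lrshift.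
have -> : map (perm_sum y1 y2) (map (lshift n) hs1) = map (lshift n) (map y1 hs1).
  by rewrite -!map_comp; apply: eq_map => i /=; rewrite perm_sumL.
have -> : map (perm_sum y1 y2) (map (@rshift m n) hs2) = map (@rshift m n) (map y2 hs2).
  by rewrite -!map_comp; apply: eq_map => i /=; rewrite perm_sumR.
by rewrite !no !orbF mem_map //; apply: lshift_inj.
Qed.

(** The strand consists of transpositions of points on 13-cycles. They are fixed by the K-th power,
    so conjugation by the strand has no effect on it. *)
Lemma glue_hword_exp K m n (x1 y1 : 'S_m) (x2 y2 : 'S_n) a b :
  handle x1 y1 a -> handle x2 y2 b -> y1 ^+ 3 = 1 -> y2 ^+ 3 = 1 -> 13 %| K ->
  hword (glue_inv x1 y1 x2 y2 a b) (perm_sum y1 y2) ^+ K =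
  perm_sum (hword x1 y1 ^+ K) (hword x2 y2 ^+ K).
Proof.
move=> ha hb y13 y23 /dvdnP[k ->]; rewrite glue_joint_word // -conjXg perm_sumX.
set u := hword x1 y1; set v := hword x2 y2.
case: (ha) => _ _ wa13 _ _; case: (hb) => _ _ wb13 _ _.
have fixe (T : finType) (w : {perm T}) p : (w ^+ 13) p = p -> (w ^+ (k * 13)) p = p.
  by move=> E; rewrite mulnC expgM; elim: k => [|l IH]; rewrite ?expg0 ?perm1 // expgS permM E.
suff c : commute (strand_prod (joint a b) (perm_sum u v)) (perm_sum (u ^+ (k * 13)) (v ^+ (k * 13))).
  by rewrite [LHS]conjgE -(c : _ = _) mulKg.
apply: (big_ind (fun s => commute s (perm_sum (u ^+ (k * 13)) (v ^+ (k * 13)))));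
  [exact/commute_sym/commute1 | move=> s t cs ct; apply/commute_sym/commuteM; exact/commute_sym |].
move=> i _; rewrite perm_sumX jointJ; apply: joint_commute_psum.
  by rewrite -!permM -!expgD addnC expgD permM fixe.
by rewrite -!permM -!expgD addnC expgD permM fixe.
Qed.

Lemma cyc3_perm_sum m n (i j k : 'I_m) : i != j -> k != i -> k != j ->
  perm_sum (cyc3 i j k) (1 : 'S_n) = cyc3 (lshift n i) (lshift n j) (lshift n k).
Proof.
move=> ij ki kj; apply/permP => p.
rewrite cyc3E ?(inj_eq (@lshift_inj m n)) //.
case: (split_ordP p) => q ->; last by rewrite perm_sumR perm1 !eq_rlshift.
by rewrite perm_sumL cyc3E // !(inj_eq (@lshift_inj m n)); do !case: ifP => // _.
Qed.

Lemma glue_seed K m n (x1 y1 : 'S_m) (x2 y2 : 'S_n) a b hs1 hs2 :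
  handle_system x1 y1 (a :: hs1) -> handle_system x2 y2 (b :: hs2) -> 13 %| K ->
  seed K x1 y1 (a :: hs1) -> hword x2 y2 ^+ K = 1 ->
  seed K (glue_inv x1 y1 x2 y2 a b) (perm_sum y1 y2)
       (map (lshift n) hs1 ++ map (@rshift m n) hs2).
Proof.
move=> S1 S2 K13 [d [d1 d2 d3 [n1 n2 n3] cl]] w2.
have ha := sys_handle S1 (mem_head _ _); have hb := sys_handle S2 (mem_head _ _).
case: (ha) => xa xya _ _ _; case: (hb) => xb xyb _ _ _.
have sub p : handle_point y1 hs1 p -> handle_point y1 (a :: hs1) p.
  by rewrite /handle_point /= !inE => /orP[]->; rewrite ?orbT.
have nh p : ~~ handle_point y1 (a :: hs1) p -> [/\ p != a, p != y1 a & ~~ handle_point y1 hs1 p].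
  move=> h; split; last by apply: contra h; apply: sub.
    by apply: contraNneq h => ->; rewrite /handle_point inE eqxx.
  by apply: contraNneq h => ->; rewrite /handle_point /= inE [in X in _ || X]inE eqxx orbT.
have [nda ndy ndh] := nh _ n1; have [nya nyy nyh] := nh _ n2; have [_ _ nxh] := nh _ n3.
exists (lshift n d); rewrite perm_sumL glue_inv_L // !(inj_eq (@lshift_inj m n)) !hpoint_map.
split=> // H [Hy Hx] HK; rewrite -cyc3_perm_sum // 1?eq_sym //.
have mem s : (s \in lift_group H) = (perm_sum s 1 \in H) by rewrite inE.
rewrite -mem; apply: cl; last first.
  by rewrite mem; move: HK; rewrite glue_hword_exp ?w2 // ?(sys_y3 S1) ?(sys_y3 S2).
have psJ (s u : 'S_m) (v : 'S_n) : perm_sum s 1 ^ perm_sum u v = perm_sum (s ^ u) 1.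
  by rewrite !conjgE perm_sumV !perm_sumM mul1g mulVg.
split=> s; rewrite !mem => hs; first by rewrite -(psJ s y1 y2); apply: Hy.
move=> sQ.
have Qa : handle_point y1 (a :: hs1) a by rewrite /handle_point mem_head.
have Qya : handle_point y1 (a :: hs1) (y1 a) by rewrite /handle_point /= mem_head orbT.
have fixx p : x1 p = p -> s p = p -> (s ^ x1) p = p.
  move=> xp sp; rewrite conjgE !permM.
  have -> : x1^-1 p = p by rewrite -{1}xp permK.
  by rewrite sp.
(* As s fixes a and [y1 a], so does [s ^ x1], which therefore commutes with both joints: the new
   involution conjugates like x1. *)
have -> : perm_sum (s ^ x1) 1 = perm_sum s 1 ^ glue_inv x1 y1 x2 y2 a b.
  rewrite /glue_inv jointJ !conjgM psJ.
  have cj c e : (s ^ x1) c = c -> perm_sum (s ^ x1) 1 ^ joint c e = perm_sum (s ^ x1) 1 :> 'S_(m + n).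
    move=> fc; have := @joint_commute_psum m n (s ^ x1) 1 c e fc (perm1 e).
    by move=> cc; rewrite conjgE -cc mulKg.
  by rewrite !cj // fixx // sQ.
apply: Hx => // q; case: (split_ordP q) => p ->; last by rewrite perm_sumR perm1.
by rewrite hpoint_map perm_sumL => /sub/sQ->.
Qed.

(* n points, h handles; x, y, x y fix r, s, t points; P tells whether the block is seeded. *)
Definition block (K n r s t h : nat) (P : bool) : Prop :=
  exists (x y : 'S_n) (hs : seq 'I_n),
    [/\ handle_system x y hs, size hs = h,
        [/\ fixn x = r, fixn y = s & fixn (x * y) = t]
      & if P then seed K x y hs else hword x y ^+ K = 1].

(** Only the two handles and their images under y stop being fixed. *)
Lemma fixn_glue m n (x1 y1 : 'S_m) (x2 y2 : 'S_n) a b :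
  handle x1 y1 a -> handle x2 y2 b ->
  (fixn (glue_inv x1 y1 x2 y2 a b) + 4 = fixn x1 + fixn x2)%N.
Proof.
move=> ha hb; case: (ha) => xa xya _ _ _; case: (hb) => xb xyb _ _ _.
have aya := handle_aya ha; have byb := handle_aya hb.
have [XLa XRb] := glue_inv_a xa xb aya byb.
have [XLya XRyb] := glue_inv_ya xya xyb aya byb.
rewrite -fixn_perm_sum /fixn; set X := glue_inv _ _ _ _ _ _ in XLa XRb XLya XRyb *.
pose l := [:: lshift n a; lshift n (y1 a); rshift m b; rshift m (y2 b)].
have ul : uniq l.
  rewrite /= !inE !(inj_eq (@lshift_inj m n)) !(inj_eq (@rshift_inj m n)).
  by rewrite !eq_lrshift (negPf aya) (negPf byb).
have <- : #|[set p in l]| = 4 by rewrite cardsE (card_uniqP ul).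
rewrite -cardsUI [X in (_ + #|pred_of_set X|)%N](_ : _ = set0) ?cards0 ?addn0; last first.
  apply/setP => p; rewrite !inE; apply/negP => /andP[/eqP E].
  by case/or4P => /eqP P; rewrite P ?XLa ?XRb ?XLya ?XRyb in E;
     move/eqP: E; rewrite ?eq_lrshift ?eq_rlshift.
congr #|pred_of_set _|; apply/setP => p; rewrite !inE.
case: (boolP (p \in l)) => [pl|pl]; rewrite inE in pl.
  have -> : perm_sum x1 x2 p == p.
    by move: pl; rewrite !inE; case/or4P => /eqP->; rewrite ?perm_sumL ?perm_sumR ?xa ?xya ?xb ?xyb.
  by rewrite !inE in pl; rewrite pl orbT.
move: pl; rewrite !inE !negb_or => /and4P[p1 p2 p3 p4].
rewrite (negPf p1) (negPf p2) (negPf p3) (negPf p4) !orbF.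
move: p1 p2 p3 p4; case: (split_ordP p) => i ->.
  rewrite !(inj_eq (@lshift_inj m n)) => p1 p2 _ _.
  by rewrite /X glue_inv_L // perm_sumL.
rewrite !(inj_eq (@rshift_inj m n)) => _ _ p3 p4.
by rewrite /X glue_inv_R // perm_sumR.
Qed.

Lemma glue_block K n1 r1 s1 t1 h1 n2 r2 s2 t2 h2 : 13 %| K ->
  block K n1 r1 s1 t1 h1.+1 true -> block K n2 r2 s2 t2 h2.+1 false ->
  block K (n1 + n2) (r1 + r2 - 4) (s1 + s2) (t1 + t2) (h1 + h2) true.
Proof.
move=> K13 [x1 [y1 [l1 [S1 hh1 [<- <- <-] sd]]]].
move=> [x2 [y2 [l2 [S2 hh2 [<- <- <-] w2]]]].
case: l1 S1 hh1 sd => [//|a hs1] S1 [hh1] sd.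
case: l2 S2 hh2 => [//|b hs2] S2 [hh2].
have ha := sys_handle S1 (mem_head _ _); have hb := sys_handle S2 (mem_head _ _).
exists (glue_inv x1 y1 x2 y2 a b), (perm_sum y1 y2), (map (lshift n2) hs1 ++ map (@rshift n1 n2) hs2).
split.
- exact: glue_sys.
- by rewrite size_cat !size_map hh1 hh2.
- rewrite fixn_perm_sum -(fixn_glue ha hb) addnK; split=> //.
  rewrite /glue_inv glue_conj ?joint2 //.
  + by rewrite fixnJ perm_sumM fixn_perm_sum.
  + case: ha => xa xya _ _ _; case: hb => xb xyb _ _ _.
    by rewrite jointJ; apply: joint_commute_psum.
  + rewrite perm_sumX !jointJ; apply: joint_commute.
    have yy k (y : 'S_k) c : (y ^+ 2) c = y (y c) by rewrite expgS permM expg1.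
    by rewrite !yy !(inj_eq perm_inj) (negPf (handle_aya ha)) (negPf (handle_aya hb)).
- exact: glue_seed.
Qed.

(** * Verifying blocks given by tables *)

(** Entries out of range default to the point itself, and in [table_perm] a table that is not
    injective defaults to the identity. Tables thus carry no proofs; the checks exclude both
    defaults. *)
Definition table_fun d (l : seq nat) (i : 'I_d) : 'I_d := insubd i (nth 0%N l i).

Definition table_perm d (l : seq nat) : 'S_d := insubd (1 : 'S_d) (finfun (@table_fun d l)).

Lemma table_funE d (l : seq nat) (i : 'I_d) :
  (forall i, i < d -> nth 0%N l i < d) -> val (table_fun l i) = nth 0%N l i.
Proof. by move=> lt; rewrite val_insubd lt. Qed.

Lemma table_permE d (l : seq nat) (i : 'I_d) :
  (forall i, i < d -> nth 0%N l i < d) ->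
  (forall i j, i < d -> j < d -> nth 0%N l i = nth 0%N l j -> i = j) ->
  val (table_perm d l i) = nth 0%N l i.
Proof.
move=> lt inj; have ij : injectiveb (finfun (@table_fun d l)).
  apply/injectiveP => p q; rewrite !ffunE => /(congr1 val); rewrite !table_funE //.
  by move/inj=> E; apply/val_inj/E.
by rewrite /table_perm /insubd insubT /= -pvalE /= ffunE table_funE.
Qed.

(** Permutations act from left to right, and y^-1 is applied as y twice. *)
Definition word_table d (xs ys : seq nat) : seq nat :=
  let X := nth 0%N xs in let Y := nth 0%N ys in
  [seq Y (X (Y (Y (X i)))) | i <- iota 0 d].

(* The last clause gives transitivity: from every point other than 0 some generator leads
   to a smaller point. *)
Definition check_action d xs ys : bool :=
  let X := nth 0%N xs in let Y := nth 0%N ys in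
  [&& 0 < d, all (fun i => X i < d) (iota 0 d), all (fun i => Y i < d) (iota 0 d),
      all (fun i => X (X i) == i) (iota 0 d),
      all (fun i => Y (Y (Y i)) == i) (iota 0 d),
      all (fun i => iter 7 (fun p => Y (X p)) i == i) (iota 0 d)
    & all (fun i => [|| i == 0%N, X i < i, Y i < i | Y (Y i) < i]) (iota 0 d)].

Definition check_handles d (xs ys hs : seq nat) : bool :=
  let X := nth 0%N xs in let Y := nth 0%N ys in
  let W := nth 0%N (word_table d xs ys) in
  [&& all (fun a => [&& a < d, X a == a, X (Y a) == Y a, iter 13 W a == a,
                        W a != a & iter 7 W a == Y (Y a)]) hs,
      uniq hs
    & all (fun a => all (fun b => (a == b) || (b \notin traject W a 13)) hs) hs].

Lemma check_actionP d xs ys : check_action d xs ys ->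
  let X := nth 0%N xs in let Y := nth 0%N ys in
  let x := table_perm d xs in let y := table_perm d ys in
  [/\ forall p : 'I_d, val (x p) = X p, forall p : 'I_d, val (y p) = Y p,
      [/\ x * x = 1, y ^+ 3 = 1 & (x * y) ^+ 7 = 1], transitive_pair x y
    & forall k (p : 'I_d), val ((hword x y ^+ k) p) = iter k (nth 0%N (word_table d xs ys)) p].
Proof.
case/and5P => d0 /allP X1 /allP Y1 /allP X2 /and3P[/allP Y3 /allP Z7 /allP tr] X Y x y.
have io i : (i \in iota 0 d) = (i < d) by rewrite mem_iota.
have {}X1 i : i < d -> X i < d by rewrite -io => /X1.
have {}Y1 i : i < d -> Y i < d by rewrite -io => /Y1.
have {}X2 i : i < d -> X (X i) = i by rewrite -io => /X2/eqP.
have {}Y3 i : i < d -> Y (Y (Y i)) = i by rewrite -io => /Y3/eqP.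
have xE (p : 'I_d) : val (x p) = X p.
  apply: table_permE => // i j hi hj E; rewrite -(X2 _ hi) -(X2 _ hj) /X E //.
have yE (p : 'I_d) : val (y p) = Y p.
  apply: table_permE => // i j hi hj E; rewrite -(Y3 _ hi) -(Y3 _ hj) /Y E //.
have x2 : x * x = 1.
  by apply/permP => p; apply: val_inj; rewrite permM perm1 !xE X2.
have y3 : y ^+ 3 = 1.
  by apply/permP => p; apply: val_inj; rewrite !expgS expg0 mulg1 !permM perm1 !yE Y3.
have zE k (p : 'I_d) : val (((x * y) ^+ k) p) = iter k (fun p => Y (X p)) p.
  elim: k p => [|k IH] p; first by rewrite perm1.
  by rewrite expgS permM IH permM iterSr -xE -yE.
have wE k (p : 'I_d) : val ((hword x y ^+ k) p) = iter k (nth 0%N (word_table d xs ys)) p.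
  elim: k p => [|k IH] p; first by rewrite perm1.
  rewrite expgS permM IH iterSr; congr iter.
  rewrite (nth_map 0%N) ?size_iota // nth_iota //= add0n.
  have yV q : val (y^-1 q) = Y (Y q) by rewrite expg3_inv // expgS expg1 permM !yE.
  by rewrite /hword !permM yE xE yV xE.
split=> //.
  split=> //; apply/permP => p; apply: val_inj; rewrite zE perm1.
  by apply/eqP/Z7; rewrite io.
pose o := Ordinal d0.
move=> P Px Py i j Pi.
have Pyy p : P p -> P (y (y p)) by move=> /Py/Py.
have yyy p : y (y (y p)) = p.
  by have := congr1 (fun s : {perm _} => s p) y3; rewrite !expgS expg0 mulg1 !permM perm1.
have xx p : x (x p) = p by rewrite -permM x2 perm1.
have down : forall m (p : 'I_d), p < m -> P p -> P o.
  elim=> // m IH p pm Pp.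
  have := tr p; rewrite io ltn_ord => /(_ isT); case/or4P => [/eqP E|h|h|h].
  - by have -> : o = p by apply: val_inj; exact: esym E.
  - by apply: (IH (x p)); [rewrite xE; apply: leq_trans h _ | apply: Px].
  - by apply: (IH (y p)); [rewrite yE; apply: leq_trans h _ | apply: Py].
  - by apply: (IH (y (y p))); [rewrite !yE; apply: leq_trans h _ | apply: Pyy].
(* Each step down can be reversed, since x^2 = 1 and y^3 = 1. *)
have up : P o -> forall m (p : 'I_d), p < m -> P p.
  move=> Po; elim=> // m IH p pm.
  have := tr p; rewrite io ltn_ord => /(_ isT); case/or4P => [/eqP E|h|h|h].
  - by have <- : o = p by apply: val_inj; exact: esym E.
  - by rewrite -(xx p); apply/Px/IH; rewrite xE; apply: leq_trans h _.
  - by rewrite -(yyy p); apply/Pyy/IH; rewrite yE; apply: leq_trans h _.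
  - by rewrite -(yyy p); apply/Py/IH; rewrite !yE; apply: leq_trans h _.
exact: (up (down _ i (ltn_ord i) Pi) _ j (ltn_ord j)).
Qed.

Lemma fixn_count d (s : 'S_d) (f : nat -> nat) :
  (forall p, val (s p) = f p) -> fixn s = count (fun i => f i == i) (iota 0 d).
Proof.
move=> sE; rewrite /fixn cardsE -sum1_card.
rewrite (eq_bigl (fun p : 'I_d => f p == p)); last first.
  by move=> p; rewrite -[LHS]/(s p == p) -val_eqE /= sE.
by rewrite -(big_mkord (fun i => f i == i) (fun _ => 1%N)) sum1_count /index_iota subn0.
Qed.

Lemma check_sys d xs ys hs : check_action d xs ys -> check_handles d xs ys hs ->
  let x := table_perm d xs in let y := table_perm d ys in let hs' := pmap insub hs : seq 'I_d in
  [/\ handle_system x y hs', size hs' = size hs & forall p, (p \in hs') = (val p \in hs)].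
Proof.
move=> ca; have /= [xE yE [x2 y3 z7] tr wE] := check_actionP ca.
set x := table_perm d xs in xE x2 z7 tr wE *; set y := table_perm d ys in yE y3 z7 tr wE *.
case/and3P => /allP hh uh /allP far.
have memh p : (p \in (pmap insub hs : seq 'I_d)) = (val p \in hs) by rewrite mem_pmap_sub.
have W1 p : nth 0%N (word_table d xs ys) (val p) = val (hword x y p).
  by have /esym := wE 1%N p; rewrite expg1.
have hdl a : a \in (pmap insub hs : seq 'I_d) -> handle x y a.
  rewrite memh => /hh /and5P[_ /eqP xa /eqP xya w13 /andP[w1 w7]].
  split.
  - by apply: val_inj; rewrite /= xE.
  - by apply: val_inj; rewrite /= xE yE.
  - by apply: val_inj; rewrite /= wE; apply/eqP.
  - by rewrite -val_eqE /= -W1.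
  - by apply: val_inj; rewrite /= wE expgS expg1 permM !yE; apply/eqP.
split=> //; last first.
  rewrite size_pmap_sub; apply/eqP; rewrite -all_count; apply/allP => a /hh.
  by case/and5P.
split=> //; last exact: pmap_sub_uniq.
move=> a b ha hb ab i.
have ha' := ha; have hb' := hb; rewrite !memh in ha' hb'.
have := far _ ha'; move/allP/(_ _ hb'); rewrite val_eqE (negPf ab) orFb.
apply: contra => /eqP <-.
case: (hdl a ha) => _ _ a13 a1 _.
(* The orbit has period 13, so the trajectory that was checked is all of it. *)
have -> : (hword x y ^+ i) a = (hword x y ^+ (i %% 13)) a.
  by apply/eqP; rewrite orbit13 // modn_mod.
apply/trajectP; exists (i %% 13); first by rewrite ltn_mod.
by rewrite /= wE.
Qed.

Lemma iter_dvd (f : nat -> nat) l m p : iter l f p = p -> iter (m * l) f p = p.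
Proof. by move=> E; elim: m => [|m IH] //; rewrite mulSn iterD IH. Qed.

Definition check_lens d (xs ys lens : seq nat) : bool :=
  let W := nth 0%N (word_table d xs ys) in
  all (fun i => has (fun l => iter l W i == i) lens) (iota 0 d).

Definition fix_counts d (xs ys : seq nat) r s t : bool :=
  let X := nth 0%N xs in let Y := nth 0%N ys in
  [&& count (fun i => X i == i) (iota 0 d) == r,
      count (fun i => Y i == i) (iota 0 d) == s
    & count (fun i => Y (X i) == i) (iota 0 d) == t].

Lemma fix_countsP d xs ys r s t : check_action d xs ys -> fix_counts d xs ys r s t ->
  let x := table_perm d xs in let y := table_perm d ys in
  [/\ fixn x = r, fixn y = s & fixn (x * y) = t].
Proof.
move=> ca /and3P[/eqP <- /eqP <- /eqP <-] x y.
have /= [xE yE _ _ _] := check_actionP ca.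
rewrite (fixn_count xE) (fixn_count yE) (@fixn_count _ (x * y) (fun i => nth 0%N ys (nth 0%N xs i))) //.
by move=> p; rewrite permM /= yE xE.
Qed.

Definition check_free d (xs ys hs lens : seq nat) r s t : bool :=
  [&& check_action d xs ys, check_handles d xs ys hs, fix_counts d xs ys r s t
    & check_lens d xs ys lens].

Lemma check_free_block K d xs ys hs lens r s t :
  all (fun l => l %| K) lens -> check_free d xs ys hs lens r s t ->
  block K d r s t (size hs) false.
Proof.
move=> /allP dK /and4P[ca ch fc /allP cl].
have /= [xE yE _ _ wE] := check_actionP ca.
have /= [S sz _] := check_sys ca ch.
exists (table_perm d xs), (table_perm d ys), (pmap insub hs); split=> //; first exact: fix_countsP.
apply/permP => p; apply: val_inj; rewrite /= wE perm1.
have /cl/hasP[l /dK/dvdnP[m ->] /eqP El] : val p \in iota 0 d by rewrite mem_iota /=.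
exact: iter_dvd.
Qed.

(* [cs] lists the nontrivial cycles of [s], all of length 5. *)
Definition cycles5 d (s : 'S_d) (cs : seq (seq nat)) : Prop :=
  [/\ forall p : 'I_d, val p \notin flatten cs -> s p = p,
      forall c, c \in cs -> [/\ size c = 5, uniq c & all (gtn d) c]
    & forall c i (p : 'I_d), c \in cs -> i < 5 -> val p = nth 0%N c i ->
        val (s p) = nth 0%N c (i.+1 %% 5)].

Lemma cycles5J d (s g : 'S_d) cs (f : nat -> nat) :
  (forall p, val (g p) = f p) -> cycles5 s cs -> cycles5 (s ^ g) (map (map f) cs).
Proof.
move=> gE [s1 s2 s3].
have pre c i : c \in cs -> i < 5 -> exists p : 'I_d, val p = nth 0%N c i.
  move=> /s2[sc _ /allP ac] i5.
  have lt : nth 0%N c i < d by apply: ac; rewrite mem_nth ?sc.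
  by exists (Ordinal lt).
split.
- move=> p np; rewrite conjgE !permM.
  suff -> : s (g^-1 p) = g^-1 p by rewrite permKV.
  apply: s1; apply: contra np => h; rewrite -[p](permKV g) gE.
  by rewrite -map_flatten map_f.
- move=> _ /mapP[c hc ->]; have [sc uc /allP ac] := s2 c hc.
  split; first by rewrite size_map.
    rewrite map_inj_in_uniq // => i j /ac /= hi /ac /= hj.
    rewrite -[i]/(val (Ordinal hi)) -[j]/(val (Ordinal hj)) -!gE.
    by move/val_inj/perm_inj ->.
  by apply/allP => _ /mapP[i /ac /= hi ->]; rewrite -[i]/(val (Ordinal hi)) -gE /=.
move=> _ i p /mapP[c hc ->] i5; have [sc uc ac] := s2 c hc.
have [q Eq] := pre c i hc i5.
rewrite (nth_map 0%N) ?sc // -Eq -gE => /val_inj ->.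
rewrite (nth_map 0%N) ?sc ?ltn_mod // conjgE !permM permK gE.
by rewrite (s3 c i).
Qed.

(* wd spells a conjugating word, true for x and false for y; it fails when x would be
   applied to a permutation that moves a handle point. *)
Fixpoint cycles_along (xs ys hp : seq nat) (wd : seq bool) (cs : seq (seq nat)) :
    option (seq (seq nat)) :=
  if wd is b :: wd' then
    if b then
      if has (fun p => p \in hp) (flatten cs) then None
      else cycles_along xs ys hp wd' (map (map (nth 0%N xs)) cs)
    else cycles_along xs ys hp wd' (map (map (nth 0%N ys)) cs)
  else Some cs.

Lemma cycles_alongP d xs ys hp (x y : 'S_d) (Q : pred 'I_d) (H : {group 'S_d}) :
  (forall p, val (x p) = nth 0%N xs p) -> (forall p, val (y p) = nth 0%N ys p) ->
  (forall p, Q p -> val p \in hp) -> core_closed x y Q H ->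
  forall wd cs cs' s, cycles_along xs ys hp wd cs = Some cs' ->
  s \in H -> cycles5 s cs -> exists2 s', s' \in H & cycles5 s' cs'.
Proof.
move=> xE yE Qh [Hy Hx]; elim=> [|b wd IH] cs cs' s /=.
  by case=> <- hs c5; exists s.
case: b; last by move=> E hs c5; apply: (IH _ _ (s ^ y) E); [exact: Hy | exact: cycles5J].
case: ifP => // /negbT nh E hs c5; apply: (IH _ _ (s ^ x) E); last exact: cycles5J.
apply: Hx => // q /Qh qh; case: c5 => s1 _ _; apply: s1.
by apply: contra nh => h; apply/hasP; exists (val q).
Qed.

Lemma cycles5_iter d (s : 'S_d) cs c i k (p : 'I_d) :
  cycles5 s cs -> c \in cs -> i < 5 -> val p = nth 0%N c i ->
  val ((s ^+ k) p) = nth 0%N c ((i + k) %% 5).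
Proof.
move=> [_ _ s3] hc i5 Ep; elim: k => [|k IH].
  by rewrite perm1 addn0 modn_small.
rewrite expgSr permM (s3 c _ _ hc _ IH) ?ltn_mod // addnS.
by rewrite -[((i + k) %% 5).+1]addn1 modnDml addn1.
Qed.

(** Conjugation by s carries a link of u and [s u] along the whole cycle. *)
Lemma cycles5_link d (s : 'S_d) cs (H : {group 'S_d}) c (u p : 'I_d) :
  cycles5 s cs -> c \in cs -> val u \in c -> val p \in c -> s \in H ->
  link H u (s u) -> link H u p.
Proof.
move=> c5 hc uc pc hs lu; case: (c5) => _ s2 _; have [sc un _] := s2 c hc.
have step i : link H ((s ^+ i) u) ((s ^+ i.+1) u).
  elim: i => [|i IH]; first by rewrite perm1 expg1.
  by rewrite expgSr [s ^+ i.+2]expgSr !permM; apply: linkJ => // t ht; apply: groupJ.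
have all i : link H u ((s ^+ i) u).
  elim: i => [|i IH]; first by rewrite perm1; apply: link_refl.
  exact: link_trans IH (step i).
have iu : index (val u) c < 5 by rewrite -sc index_mem.
have ip : index (val p) c < 5 by rewrite -sc index_mem.
have -> : p = (s ^+ (index (val p) c + (5 - index (val u) c))) u.
  apply: val_inj; rewrite (cycles5_iter _ c5 hc iu) ?nth_index //.
  rewrite addnC -addnA subnK ?(ltnW iu) // modnDr modn_small //.
  by rewrite nth_index.
exact: all.
Qed.

Lemma cycles5_moved d (s : 'S_d) cs c (u : 'I_d) :
  cycles5 s cs -> c \in cs -> val u \in c -> s u != u.
Proof.
move=> c5 hc uc; case: (c5) => _ s2 s3; have [sc un _] := s2 c hc.
have iu : index (val u) c < 5 by rewrite -sc index_mem.
rewrite -val_eqE (s3 c _ _ hc iu) ?nth_index // -[in X in _ != X](nth_index 0%N uc).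
rewrite nth_uniq ?sc ?ltn_mod //.
by move: (index _ _) iu => [|[|[|[|[|]]]]].
Qed.

(* cs lists the cycles of length 5 of w, all other cycle lengths divide K. The conjugate cs'
   along wd meets cs in u only, so that the commutator of the two is a 3-cycle at u. *)
Definition check_seed d (xs ys hs lens : seq nat) (cs : seq (seq nat)) (wd : seq bool)
    (u : nat) : bool :=
  let X := nth 0%N xs in let Y := nth 0%N ys in
  let W := nth 0%N (word_table d xs ys) in let hp := hs ++ map Y hs in
  if cycles_along xs ys hp wd cs is Some cs' then
    let c := head [::] [seq c <- cs | u \in c] in
    let c' := head [::] [seq c <- cs' | u \in c] in
    let l := c ++ c' in let l2 := l ++ map Y l ++ map (fun p => Y (Y p)) l in
    [&& [&& u < d, all (fun c => [&& size c == 5, uniq c & all (gtn d) c]) cs,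
        uniq (flatten cs)
      & all (fun c => all (fun i => W (nth 0%N c i) == nth 0%N c (i.+1 %% 5)) (iota 0 5)) cs],
      all (fun i => (i \in flatten cs) || has (fun l => iter l W i == i) lens) (iota 0 d),
      [&& u \in c, u \in c', c \in cs & c' \in cs'],
      all (fun p => (p == u) || (p \notin flatten cs')) (flatten cs),
      all (fun p => p \notin hp) (flatten cs),
      has (fun e => Y e \in l) l,
      has (fun f => (f \notin hp) && (X f \in l2)) l2
    & has (fun p => [&& Y p != p, X (Y p) != Y p, X (Y p) != p, p \notin hp,
                    Y p \notin hp & X (Y p) \notin hp]) (iota 0 d)]
  else false.

Definition check_seeded d xs ys hs lens cs wd u r s t : bool :=
  [&& check_action d xs ys, check_handles d xs ys hs, fix_counts d xs ys r s t
    & check_seed d xs ys hs lens cs wd u].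

Lemma check_seeded_block K d xs ys hs lens cs wd u r s t :
  all (fun l => l %| K) lens -> K = 1 %[mod 5] ->
  check_seeded d xs ys hs lens cs wd u r s t -> block K d r s t (size hs) true.
Proof.
move=> /allP dK K5 /and4P[ca ch fc].
have /= [xE yE [x2 y3 z7] tr wE] := check_actionP ca.
have /= [S sz memh] := check_sys ca ch.
rewrite /check_seed; set hp := hs ++ _.
case E: cycles_along => [cs'|//]; set c := head _ _; set c' := head _ _.
set l := c ++ c'; set l2 := l ++ _.
case/and5P => /and4P[ud /allP c5s uf /allP cW] /allP ln /and4P[uc uc' hc hc'] /allP one.
case/and4P => /allP nhp /hasP[e el yel] /hasP[f fl /andP[fh xfl]] /hasP[p].
rewrite mem_iota => /= pd /and5P[p1 p2 p3 p4 /andP[p5 p6]].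
set x := table_perm d xs in xE tr wE S x2 z7 *; set y := table_perm d ys in yE tr wE S y3 z7 *.
set hs' : seq 'I_d := pmap insub hs in S sz memh *.
exists x, y, hs'; split=> //; first exact: fix_countsP.
have hpE q : handle_point y hs' q = (val q \in hp).
  rewrite /handle_point /hp mem_cat memh; congr (_ || _).
  apply/mapP/mapP => [[a ha ->]|[a ha Eq]].
    by exists (val a); [move: ha; rewrite memh | rewrite /= yE].
  have ad : a < d by case/and3P: ch => /allP /(_ _ ha) /and5P[].
  exists (Ordinal ad); first by rewrite memh.
  by apply: val_inj; rewrite /= yE.
pose P := Ordinal pd.
have yP : val (y P) = nth 0%N ys p by rewrite /= yE.
have xyP : val (x (y P)) = nth 0%N xs (nth 0%N ys p) by rewrite /= xE yE.
exists P; rewrite -!val_eqE !hpE xyP yP; split=> // H cl HK.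
pose U := Ordinal ud; set w := hword x y in wE HK *.
have wW (q : 'I_d) : val (w q) = nth 0%N (word_table d xs ys) q.
  by have := wE 1%N q; rewrite expg1.
have c5w q k : q \in flatten cs -> iter 5 (nth 0%N (word_table d xs ys)) q = q ->
   k = 1 %[mod 5] -> iter k (nth 0%N (word_table d xs ys)) q = nth 0%N (word_table d xs ys) q.
  move=> _ E5 k5; rewrite (divn_eq k 5) k5 addnC iterD iter_dvd //.
have cyc : cycles5 (w ^+ K) cs.
  split.
  - move=> q nq; apply: val_inj; rewrite /= wE.
    have := ln (val q); rewrite mem_iota ltn_ord => /(_ isT).
    rewrite (negPf nq) /= => /hasP[m /dK/dvdnP[j ->] /eqP Em].
    exact: iter_dvd.
  - by move=> b /c5s/and3P[/eqP ? ? ?].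
  move=> b i q hb i5 Eq; rewrite /= wE.
  have bW j : j < 5 -> nth 0%N (word_table d xs ys) (nth 0%N b j) = nth 0%N b (j.+1 %% 5).
    by move=> j5; apply/eqP; have := cW b hb; move/allP; apply; rewrite mem_iota.
  have bI j : iter j (nth 0%N (word_table d xs ys)) q = nth 0%N b ((i + j) %% 5).
    elim: j => [|j IH]; first by rewrite addn0 modn_small.
    rewrite iterS IH bW ?ltn_mod // addnS.
    by rewrite -[((i + j) %% 5).+1]addn1 modnDml addn1.
  by rewrite bI -modnDmr K5 modnDmr addn1.
have Qh q : handle_point y hs' q -> val q \in hp by rewrite hpE.
have [v Hv c5v] := cycles_alongP xE yE Qh cl E HK cyc.
case: (cl) => Hy _.
have sU := @cycles5_moved _ _ _ _ U cyc hc uc.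
have tU := @cycles5_moved _ _ _ _ U c5v hc' uc'.
(* The supports of w^K and of its conjugate v meet in U only, as [comm_cyc3] requires. *)
have st q : q != U -> (w ^+ K) q = q \/ v q = q.
  move=> qU; have [qc|qc] := boolP (val q \in flatten cs); last first.
    by left; case: cyc => s1 _ _; apply: s1.
  right; case: c5v => t1 _ _; apply: t1; have := one _ qc.
  by rewrite -[u]/(val U) val_eqE (negPf qU).
have c3 := comm_cyc3 (sU : (w ^+ K) U != U) (tU : v U != U) st.
have stU : (w ^+ K) U != v U.
  apply/eqP => E1; have [E2|E2] := st _ sU.
    by move/perm_inj: E2 => E2; rewrite E2 eqxx in sU.
  by rewrite E1 in E2; move/perm_inj: E2 => E2; rewrite E2 eqxx in tU.
have Hc : cyc3 U (v U) ((w ^+ K) U) \in H by rewrite -c3 groupR.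
have lt : link H U (v U) by right; exists ((w ^+ K) U); split; rewrite // eq_sym.
have ls : link H U ((w ^+ K) U).
  right; exists (v U); split; rewrite // 1?eq_sym //.
  rewrite -(@cyc3V _ ((w ^+ K) U)) ?groupV // 1?eq_sym //.
  by rewrite (@cyc3_rot _ ((w ^+ K) U)) // 1?eq_sym.
have ll q : val q \in l -> link H U q.
  rewrite mem_cat => /orP[] hq.
    exact: (cycles5_link cyc hc _ hq HK ls).
  exact: (cycles5_link c5v hc' _ hq Hv lt).
have cd q : q \in l -> q < d.
  rewrite mem_cat => /orP[] hq.
    by have /and3P[_ _ /allP h] := c5s c hc; exact: h.
  by case: c5v => _ /(_ c' hc') [_ _ /allP h] _; exact: h.
(* Both e and [y e] are linked to U, so its class is stable under y; this extends it from the two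
   5-cycles in l to l2. *)
have ly q : link H U q -> link H U (y q).
  move=> lq; have lye := ll (y (Ordinal (cd e el))); rewrite /= yE in lye.
  apply: link_trans (lye yel) _; apply: linkJ => //.
  exact: link_trans (link_sym (ll (Ordinal (cd e el)) el)) lq.
have ll2 q : val q \in l2 -> link H U q.
  rewrite !mem_cat -mem_cat -/l => /or3P[/ll //|/mapP[a al Eq]|/mapP[a al Eq]].
    have -> : q = y (Ordinal (cd a al)) by apply: val_inj; rewrite /= yE.
    exact/ly/ll.
  have -> : q = y (y (Ordinal (cd a al))) by apply: val_inj; rewrite /= !yE.
  exact/ly/ly/ll.
have fd : f < d.
  move: fl; rewrite !mem_cat -mem_cat -/l => /or3P[/cd //|/mapP[a al ->]|/mapP[a al ->]].
    by rewrite -[a]/(val (Ordinal (cd a al))) -yE.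
  by rewrite -[a]/(val (Ordinal (cd a al))) -!yE.
have [sc uqc ac] : [/\ size c = 5, uniq c & all (gtn d) c].
  by have /and3P[/eqP] := c5s c hc.
have cp i : i < 5 -> exists2 q : 'I_d, val q = nth 0%N c i & val q \in c.
  move=> i5; have hi : nth 0%N c i \in c by rewrite mem_nth ?sc.
  by exists (Ordinal (allP ac _ hi)).
have [q0 E0 q0c] := cp 0%N isT; have [q1 E1 q1c] := cp 1%N isT.
have [q2 E2 q2c] := cp 2 isT.
have lc q : val q \in c -> link H U q by move=> qc; apply: ll; rewrite mem_cat qc.
have nc q : val q \in c -> ~~ handle_point y hs' q.
  by move=> qc; rewrite hpE; apply: nhp; apply/flattenP; exists c.
have LA : forall i j, link H i j.
  (* The spare points are three points of the 5-cycle c, which avoids all handle points. *)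
  apply: (@link_all _ x y (handle_point y hs') H U (Ordinal (cd e el)) (Ordinal fd) q0 q1 q2) => //.
  - move=> q /orP[]; first by move/(sys_handle S) => [].
    by case/mapP=> a /(sys_handle S) [_ xya _ _ _] ->.
  - exact: ll.
  - exact/ly/ll.
  - exact: ll2.
  - by apply: ll2; rewrite /= xE.
  - by rewrite hpE.
  - by split; apply: lc.
  - by split; apply: nc.
  - by split; rewrite -val_eqE /= ?E0 ?E1 ?E2 nth_uniq // sc.
apply: link_cyc3 => //.
- by rewrite -val_eqE /= yE eq_sym.
- by rewrite -val_eqE /= xE yE.
- by rewrite -val_eqE /= xE yE.
Qed.

(** * The blocks *)

Section Blocks.
Local Open Scope nat_scope.

(* The table of y: consecutive triples, and s fixed points at the end. The tables below
   are those of x and were found by a computer search. *)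
Definition triangles d s : seq nat :=
  [seq if i < d - s then (if i %% 3 == 2 then i - 2 else i.+1) else i | i <- iota 0 d].

Definition blockG : seq nat :=
  [:: 0; 1; 3; 2; 6; 9; 4; 11; 12; 5; 15; 7; 8; 18; 21; 10; 24; 27; 13; 30; 28; 14; 33;
   25; 16; 23; 34; 17; 20; 31; 19; 29; 36; 22; 26; 39; 32; 37; 38; 35; 40; 41].

(** With three handles this block raises the number of free handles by one, and x gains two fixed
    points when it is attached. *)
Lemma blockG_block K : all (fun l => l %| K) [:: 1; 13] ->
  block K 42 6 0 0 3 false.
Proof.
move=> dK; apply: (@check_free_block K 42 blockG (triangles 42 0) [:: 0; 37; 40] _ 6 0 0 dK).
by vm_compute.
Qed.

Definition blockA : seq nat :=
  [:: 0; 1; 3; 2; 6; 9; 4; 11; 12; 5; 13; 7; 8; 10].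

(** The only handle is consumed in the gluing, so each copy lowers the number of free handles by one
    and ends a branch. *)
Lemma blockA_block K : all (fun l => l %| K) [:: 1; 13] ->
  block K 14 2 2 0 1 false.
Proof.
move=> dK; apply: (@check_free_block K 14 blockA (triangles 14 2) [:: 0] _ 2 2 0 dK).
by vm_compute.
Qed.

Definition blockC : seq nat :=
  [:: 0; 1; 3; 2; 6; 9; 4; 11; 12; 5; 15; 7; 8; 18; 21; 10; 24; 27; 13; 30; 28; 14; 33;
   25; 16; 23; 34; 17; 20; 31; 19; 29; 36; 22; 26; 39; 32; 37; 38; 35; 42; 43; 40; 41; 45;
   44; 46; 48; 47].

Lemma blockC_block K : all (fun l => l %| K) [:: 1; 13; 19] ->
  block K 49 5 1 0 2 false.
Proof.
move=> dK; apply: (@check_free_block K 49 blockC (triangles 49 1) [:: 0; 37] _ 5 1 0 dK).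
by vm_compute.
Qed.

Definition blockB : seq nat :=
  [:: 0; 1; 3; 2; 6; 9; 4; 11; 12; 5; 15; 7; 8; 18; 21; 10; 24; 27; 13; 30; 28; 14; 33;
   25; 16; 23; 34; 17; 20; 31; 19; 29; 36; 22; 26; 39; 32; 37; 38; 35; 42; 43; 40; 41; 45;
   44; 48; 51; 46; 53; 50; 47; 54; 49; 52; 56; 55].

Lemma blockB_block K : all (fun l => l %| K) [:: 1; 13; 27] ->
  block K 57 5 0 1 2 false.
Proof.
move=> dK; apply: (@check_free_block K 57 blockB (triangles 57 0) [:: 0; 37] _ 5 0 1 dK).
by vm_compute.
Qed.

Definition blockD : seq nat :=
  [:: 0; 1; 3; 2; 6; 9; 4; 11; 12; 5; 15; 7; 8; 18; 21; 10; 24; 27; 13; 30; 28; 14; 33;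
   25; 16; 23; 34; 17; 20; 31; 19; 29; 36; 22; 26; 39; 32; 37; 38; 35; 42; 43; 40; 41; 45;
   44; 48; 51; 46; 53; 54; 47; 57; 49; 50; 58; 63; 52; 55; 60; 59; 62; 61; 56].

Lemma blockD_block K : all (fun l => l %| K) [:: 1; 13; 17] ->
  block K 64 4 1 1 2 false.
Proof.
move=> dK; apply: (@check_free_block K 64 blockD (triangles 64 1) [:: 0; 37] _ 4 1 1 dK).
by vm_compute.
Qed.

Definition blockE : seq nat :=
  [:: 0; 1; 3; 2; 6; 9; 4; 11; 12; 5; 15; 7; 8; 18; 21; 10; 24; 27; 13; 30; 28; 14; 33;
   25; 16; 23; 34; 17; 20; 31; 19; 29; 36; 22; 26; 39; 32; 37; 38; 35; 42; 43; 40; 41; 45;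
   44; 48; 51; 46; 53; 54; 47; 57; 49; 50; 60; 63; 52; 66; 69; 55; 72; 68; 56; 75; 67; 58;
   65; 62; 59; 78; 73; 61; 71; 81; 64; 77; 76; 70; 83; 84; 74; 87; 79; 80; 90; 93; 82; 95;
   96; 85; 99; 102; 86; 101; 88; 89; 105; 100; 91; 98; 94; 92; 104; 103; 97; 107; 106].

Lemma blockE_block K : all (fun l => l %| K) [:: 1; 13; 39] ->
  block K 108 4 0 3 2 false.
Proof.
move=> dK; apply: (@check_free_block K 108 blockE (triangles 108 0) [:: 0; 37] _ 4 0 3 dK).
by vm_compute.
Qed.

Definition blockF : seq nat :=
  [:: 0; 1; 3; 2; 6; 9; 4; 11; 12; 5; 15; 7; 8; 18; 21; 10; 24; 27; 13; 30; 28; 14; 33;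
   25; 16; 23; 34; 17; 20; 31; 19; 29; 36; 22; 26; 39; 32; 37; 38; 35; 42; 43; 40; 41; 45;
   44; 48; 51; 46; 53; 54; 47; 57; 49; 50; 60; 63; 52; 66; 69; 55; 72; 68; 56; 75; 67; 58;
   65; 62; 59; 78; 73; 61; 71; 81; 64; 77; 76; 70; 83; 84; 74; 87; 79; 80; 90; 93; 82; 95;
   96; 85; 99; 102; 86; 105; 88; 89; 108; 100; 91; 98; 111; 92; 112; 114; 94; 117; 120; 97;
   123; 126; 101; 103; 129; 104; 128; 118; 106; 116; 132; 107; 133; 124; 109; 122; 135;
   110; 136; 115; 113; 131; 130; 119; 121; 138; 125; 127; 141; 134; 140; 139; 137; 143;
   142].

Lemma blockF_block K : all (fun l => l %| K) [:: 1; 13; 57] ->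
  block K 144 4 0 4 2 false.
Proof.
move=> dK; apply: (@check_free_block K 144 blockF (triangles 144 0) [:: 0; 37] _ 4 0 4 dK).
by vm_compute.
Qed.

Definition blockP : seq nat :=
  [:: 0; 1; 3; 2; 6; 9; 4; 11; 12; 5; 15; 7; 8; 18; 21; 10; 24; 27; 13; 30; 28; 14; 33;
   25; 16; 23; 34; 17; 20; 31; 19; 29; 36; 22; 26; 39; 32; 37; 38; 35; 42; 43; 40; 41; 45;
   44; 48; 51; 46; 53; 54; 47; 57; 49; 50; 60; 63; 52; 66; 69; 55; 72; 75; 56; 78; 67; 58;
   65; 81; 59; 84; 73; 61; 71; 87; 62; 90; 93; 64; 82; 96; 68; 79; 95; 70; 99; 102; 74;
   105; 108; 76; 111; 114; 77; 100; 83; 80; 98; 97; 85; 94; 117; 86; 120; 123; 88; 125;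
   113; 89; 126; 112; 91; 110; 107; 92; 129; 132; 101; 134; 131; 103; 135; 138; 104; 137;
   106; 109; 128; 127; 115; 136; 119; 116; 141; 118; 121; 130; 124; 122; 140; 139; 133;
   143; 142].

Lemma blockP_block K : all (fun l => l %| K) [:: 1; 6; 13; 46] -> K = 1 %[mod 5] ->
  block K 144 4 0 4 2 true.
Proof.
move=> dK K5; apply: (@check_seeded_block K 144 blockP (triangles 144 0) [:: 0; 37] _
  [:: [:: 89; 113; 123; 121; 125]; [:: 104; 107; 108; 106; 135]]
  [:: false; true; false; true; false; false; true; false; true; false; true; false; false;
      true; false; false] 113 4 0 4 dK K5).
by vm_compute.
Qed.

Definition blockR : seq nat :=
  [:: 0; 1; 3; 2; 6; 9; 4; 11; 12; 5; 15; 7; 8; 18; 21; 10; 24; 27; 13; 30; 28; 14; 33;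
   25; 16; 23; 34; 17; 20; 31; 19; 29; 36; 22; 26; 39; 32; 37; 38; 35; 42; 43; 40; 41; 45;
   44; 48; 51; 46; 53; 54; 47; 57; 49; 50; 60; 63; 52; 58; 65; 55; 66; 69; 56; 67; 59; 61;
   64; 72; 62; 75; 78; 68; 80; 81; 70; 84; 87; 71; 90; 73; 74; 93; 85; 76; 83; 86; 77; 91;
   96; 79; 88; 95; 82; 97; 92; 89; 94].

(** A second seeded block: here y has fixed points and x y has none, opposite to P. This helps to
    keep the counts of two configurations apart. *)
Lemma blockR_block K : all (fun l => l %| K) [:: 1; 7; 13; 16; 19] -> K = 1 %[mod 5] ->
  block K 98 6 2 0 2 true.
Proof.
move=> dK K5; apply: (@check_seeded_block K 98 blockR (triangles 98 2) [:: 0; 37] _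
  [:: [:: 77; 96; 92; 97; 83]; [:: 85; 94; 95; 89; 87]]
  [:: false; true; false; false] 85 6 2 0 dK K5).
by vm_compute.
Qed.

Definition cycle_lengths : seq nat :=
  [:: 1; 2; 6; 7; 13; 16; 17; 19; 27; 39; 46; 57].

(* w^K is trivial on all cycles of w except those of length 5, on which it is w itself. *)
Definition good_exp (K : nat) : Prop := all (fun l => l %| K) cycle_lengths /\ K = 1 %[mod 5].

Lemma good_exp_exists : exists K, good_exp K.
Proof.
(* No length is a multiple of 5, so all fourth powers are 1 modulo 5. *)
exists (\prod_(l <- cycle_lengths) l ^ 4); split.
  apply/allP => l hl; apply: (@dvdn_trans (l ^ 4)); first exact: dvdn_exp.
  by rewrite (big_rem l) //= dvdn_mulr.
have : all (fun l => (l %% 5) ^ 4 %% 5 == 1) cycle_lengths by [].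
elim: cycle_lengths => [|l L IH] /=; first by rewrite big_nil.
case/andP => /eqP El /IH EL; rewrite big_cons -modnMm EL modnMm muln1 -modnXm.
by rewrite El.
Qed.

Lemma good_exp13 K : good_exp K -> 13 %| K.
Proof. by case=> /allP h _; apply: h. Qed.

Lemma block_eq K P n r s t h n' r' s' t' h' :
  block K n r s t h P -> n = n' -> r = r' -> s = s' -> t = t' -> h = h' ->
  block K n' r' s' t' h' P.
Proof. by move=> B <- <- <- <- <-. Qed.

Lemma attach_many K N R S T h n r s t : good_exp K -> 4 <= r ->
  block K N R S T h.+1 true -> block K n r s t 2 false ->
  forall k, block K (N + n * k) (R + (r - 4) * k) (S + s * k) (T + t * k) h.+1 true.
Proof.
move=> gK r4 B1 B2; elim=> [|k IH]; first by rewrite !muln0 !addn0.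
apply: block_eq (glue_block (good_exp13 gK) IH B2) _ _ _ _ _; rewrite ?mulnS //; last lia.
- by move: (n * k) => q; lia.
- by move: ((r - 4) * k) => q; lia.
- by move: (s * k) => q; lia.
- by move: (t * k) => q; lia.
Qed.

Lemma attach_G K N R S T h : good_exp K -> block K N R S T h.+1 true ->
  block K 42 6 0 0 3 false ->
  forall k, block K (N + 42 * k) (R + 2 * k) S T (h + k).+1 true.
Proof.
move=> gK B1 B2; elim=> [|k IH]; first by rewrite !muln0 !addn0.
by apply: block_eq (glue_block (good_exp13 gK) IH B2) _ _ _ _ _; lia.
Qed.

Lemma attach_A K N R S T h k : good_exp K -> block K N R S T (h + k).+1 true ->
  block K 14 2 2 0 1 false ->
  block K (N + 14 * k) (R - 2 * k) (S + 2 * k) T h.+1 true.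
Proof.
move=> gK B1 B2; elim: k h B1 => [|k IH] h B1.
  by apply: block_eq B1 _ _ _ _ _; lia.
rewrite addnS -addSn in B1.
by apply: block_eq (glue_block (good_exp13 gK) (IH _ B1) B2) _ _ _ _ _; lia.
Qed.

(* The seeded block P (cP true) or R (cP false), and the numbers of copies of the blocks
   A to F and G attached to it. *)
Record counts := Counts { cP : bool; cG : nat; cA : nat; cB : nat; cC : nat;
                          cD : nat; cE : nat; cF : nat }.

(** The degree, then the fixed points of x, y and x y. For x every attached block counts with four
    points less: B and C add 1, G adds 2, A takes 2, and D, E, F add nothing. *)
Definition csize c := (if cP c then 144 else 98) + 57 * cB c + 49 * cC c + 64 * cD c
  + 108 * cE c + 144 * cF c + 42 * cG c + 14 * cA c.
Definition cfx c := (if cP c then 4 else 6) + cB c + cC c + 2 * cG c - 2 * cA c.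
Definition cfy c := (if cP c then 0 else 2) + cC c + cD c + 2 * cA c.
Definition cfz c := (if cP c then 4 else 0) + cB c + cD c + 3 * cE c + 4 * cF c.

Lemma counts_block K c : good_exp K -> cA c <= cG c ->
  block K (csize c) (cfx c) (cfy c) (cfz c) (2 + (cG c - cA c)) true.
Proof.
move=> gK ag; have d1 l : all (fun i => i \in cycle_lengths) l -> all (fun i => i %| K) l.
  by case: gK => /allP h _ /allP sl; apply/allP => i /sl/h.
have B0 : block K (if cP c then 144 else 98) (if cP c then 4 else 6)
   (if cP c then 0 else 2) (if cP c then 4 else 0) 2 true.
  case: gK => _ K5; case: (cP c); first exact: (blockP_block (d1 _ _) K5).
  exact: (blockR_block (d1 _ _) K5).
have bG : block K 42 6 0 0 3 false by apply/blockG_block/d1.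
have bA : block K 14 2 2 0 1 false by apply/blockA_block/d1.
have bB : block K 57 5 0 1 2 false by apply/blockB_block/d1.
have bC : block K 49 5 1 0 2 false by apply/blockC_block/d1.
have bD : block K 64 4 1 1 2 false by apply/blockD_block/d1.
have bE : block K 108 4 0 3 2 false by apply/blockE_block/d1.
have bF : block K 144 4 0 4 2 false by apply/blockF_block/d1.
have B1 := attach_many gK (isT : 4 <= 5) B0 bB (cB c).
have B2 := attach_many gK (isT : 4 <= 5) B1 bC (cC c).
have B3 := attach_many gK (isT : 4 <= 4) B2 bD (cD c).
have B4 := attach_many gK (isT : 4 <= 4) B3 bE (cE c).
have B5 := attach_many gK (isT : 4 <= 4) B4 bF (cF c).
have B6 := attach_G gK B5 bG (cG c).
(* The copies of A come last, since they consume the handles that the copies of G supply. *)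
have E7 : (1 + cG c).+1 = (1 + (cG c - cA c) + cA c).+1 by lia.
rewrite E7 in B6.
apply: block_eq (attach_A gK B6 bA) _ _ _ _ _;
  rewrite /csize /cfx /cfy /cfz; case: (cP c); lia.
Qed.

End Blocks.

Import GRing.Theory.

(** * Elementary and embedded matrices *)

Section Matrices.
Local Open Scope ring_scope.

Definition elem (F : fieldType) n (i j : 'I_n) (c : F) : 'M[F]_n :=
  1%:M + c *: delta_mx i j.

Definition mul_closed (F : fieldType) n (P : 'M[F]_n -> Prop) : Prop :=
  [/\ P 1%:M, forall A B, P A -> P B -> P (A *m B)
    & forall i j c, i != j -> P (elem i j c)].

Lemma elem_mul (F : fieldType) n (i j : 'I_n) (c d : F) : i != j ->
  elem i j c *m elem i j d = elem i j (c + d).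
Proof.
move=> ij; rewrite /elem mulmxDl mul1mx mulmxDr mulmx1 -scalemxAl -scalemxAr.
by rewrite mul_delta_mx_0 1?eq_sym // !scaler0 addr0 scalerDl addrA addrAC.
Qed.

Lemma elemK (F : fieldType) n (i j : 'I_n) (c : F) (A : 'M[F]_n) : i != j ->
  elem i j (- c) *m (elem i j c *m A) = A.
Proof. by move=> ij; rewrite mulmxA elem_mul // addNr /elem scale0r addr0 mul1mx. Qed.

Lemma elem_row (F : fieldType) n (i j k l : 'I_n) (c : F) (A : 'M[F]_n) :
  (elem i j c *m A) k l = A k l + (if k == i then c * A j l else 0).
Proof.
rewrite /elem mulmxDl mul1mx mxE -scalemxAl; congr (_ + _); rewrite !mxE.
have [->|ki] := eqVneq k i.
  rewrite (bigD1 j) //= big1 ?addr0 ?mxE ?eqxx ?mul1r // => m mj.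
  by rewrite mxE (negPf mj) andbF mul0r.
by rewrite big1 ?mulr0 // => m _; rewrite mxE (negPf ki) mul0r.
Qed.

(** The rows b add up under multiplication, so b may be taken with a single nonzero entry. *)
Lemma unitri_upper (F : fieldType) n (P : 'M[F]_(1 + n) -> Prop) (b : 'rV_n) :
  mul_closed P -> P (block_mx 1 b 0 1%:M).
Proof.
move=> [P1 PM Pe]; rewrite (matrix_sum_delta b) big_ord1.
apply: (big_ind (fun b : 'rV_n => P (block_mx 1 b 0 1%:M))) => [|b1 b2 h1 h2|j _].
- by rewrite -scalar_mx_block.
- have -> : block_mx 1 (b1 + b2) 0 1%:M =
      block_mx 1 b2 0 1%:M *m block_mx 1 b1 0 1%:M :> 'M[F]_(1 + n).
    by rewrite mulmx_block !mulmx1 !mul0mx !mul1mx !mulmx0 !addr0 add0r.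
  exact: PM.
have -> : block_mx 1 (b 0 j *: delta_mx 0 j) 0 1%:M =
   elem (lshift n 0) (rshift 1 j) (b 0 j) :> 'M[F]_(1 + n).
  rewrite /elem (scalar_mx_block 1 n 1) -[delta_mx (lshift n 0) _]submxK.
  rewrite scale_block_mx add_block_mx; congr block_mx; apply/matrixP => u v;
    rewrite !mxE ?eq_lrshift ?eq_rlshift ?andbF ?mulr0 ?addr0 //.
  by rewrite !(inj_eq (@rshift_inj 1 n)) !(inj_eq (@lshift_inj 1 n)) add0r.
by apply: (Pe); rewrite eq_lrshift.
Qed.

Lemma unitri_lower (F : fieldType) n (P : 'M[F]_(1 + n) -> Prop) (b : 'cV_n) :
  mul_closed P -> P (block_mx 1 0 b 1%:M).
Proof.
move=> [P1 PM Pe]; rewrite (matrix_sum_delta b).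
apply: (big_ind (fun b : 'cV_n => P (block_mx 1 0 b 1%:M))) => [|b1 b2 h1 h2|j _].
- by rewrite -scalar_mx_block.
- have -> : block_mx 1 0 (b1 + b2) 1%:M =
      block_mx 1 0 b1 1%:M *m block_mx 1 0 b2 1%:M :> 'M[F]_(1 + n).
    by rewrite mulmx_block !mulmx1 !mul0mx !mul1mx !mulmx0 !addr0 !add0r.
  exact: PM.
rewrite big_ord1.
have -> : block_mx 1 0 (b j 0 *: delta_mx j 0) 1%:M =
   elem (rshift 1 j) (lshift n 0) (b j 0) :> 'M[F]_(1 + n).
  rewrite /elem (scalar_mx_block 1 n 1) -[delta_mx _ (lshift n 0)]submxK.
  rewrite scale_block_mx add_block_mx; congr block_mx; apply/matrixP => u v;
    rewrite !mxE ?eq_lrshift ?eq_rlshift ?andbF ?mulr0 ?addr0 //.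
  by rewrite !(inj_eq (@rshift_inj 1 n)) !(inj_eq (@lshift_inj 1 n)) add0r.
by apply: (Pe); rewrite eq_rlshift.
Qed.

Lemma det_elem (F : fieldType) n (i j : 'I_n) (c : F) : i != j -> \det (elem i j c) = 1.
Proof.
wlog ij : i j / (j < i)%N.
  move=> H ij; case: (ltngtP j i) => [h|h|/val_inj E]; first exact: H.
    rewrite -det_tr (_ : _^T = elem j i c); first by apply: H; rewrite // eq_sym.
    by rewrite /elem linearD linearZ /= trmx1 trmx_delta.
  by rewrite E eqxx in ij.
move=> nij; rewrite det_trig.
  rewrite big1 // => k _; rewrite !mxE eqxx; have [->|_] := eqVneq k i.
    by rewrite (negPf nij) mulr0 addr0.
  by rewrite mulr0 addr0.
apply/is_trig_mxP => k l kl; rewrite !mxE.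
have [E|_] := eqVneq k l; first by rewrite E ltnn in kl.
have [E|_] := eqVneq k i; last by rewrite mulr0 addr0.
have [E'|_] := eqVneq l j; last by rewrite mulr0 addr0.
by move: kl; rewrite E E' ltnNge (ltnW ij).
Qed.

(** Gaussian elimination by induction on the degree. With a predicate in place of a group the
    induction can pass to the lower right block. *)
Lemma SL_elem (F : fieldType) n (P : 'M[F]_n -> Prop) (A : 'M[F]_n) :
  mul_closed P -> \det A = 1 -> P A.
Proof.
elim: n P A => [|n IH] P A Pc dA; case: (Pc) => P1 PM Pe.
  by have -> : A = 1%:M by apply/matrixP => -[].
have back (i j : 'I_n.+1) c : i != j -> P (elem i j c *m A) -> P A.
  by move=> ij h; rewrite -(elemK c A ij); apply: (PM) => //; apply: (Pe).
have detE (i j : 'I_n.+1) c (B : 'M[F]_n.+1) : i != j -> \det (elem i j c *m B) = \det B.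
  by move=> ij; rewrite det_mulmx det_elem // mul1r.
(* With corner 1 the matrix factors into a lower unitriangular matrix, the Schur complement and an
   upper unitriangular matrix. *)
have one B : \det B = 1 -> B 0 0 = 1 -> P B.
  move=> dB B00; rewrite -[B](@submxK _ 1 n 1 n).
  set b := ursubmx _; set c := dlsubmx _; set D := drsubmx _.
  have -> : ulsubmx (B : 'M_(1 + n)) = 1.
    by apply/matrixP => i j; rewrite !ord1 !mxE -[RHS]B00; congr (B _ _); apply: val_inj.
  have Ef : block_mx 1 b c D = block_mx 1 0 c 1%:M *m
     (block_mx 1 0 0 (D - c *m b) *m block_mx 1 b 0 1%:M) :> 'M[F]_(1 + n).
    rewrite !mulmx_block !mulmx1 !mul0mx !mul1mx !mulmx0 !addr0 !add0r.
    by rewrite (mulmx1 c : c *m 1 = c) addrC subrK.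
  rewrite Ef; apply: (PM); first exact: unitri_lower.
  apply: (PM); last exact: unitri_upper.
  apply: (IH (fun X => P (block_mx 1 0 0 X : 'M[F]_(1 + n)))).
    split=> [|X Y hX hY|i j d ij]; first by rewrite -scalar_mx_block.
      have -> : block_mx 1 0 0 (X *m Y) =
         block_mx 1 0 0 X *m block_mx 1 0 0 Y :> 'M[F]_(1 + n).
        by rewrite mulmx_block !mulmx1 !mul0mx !mulmx0 !addr0 !add0r.
      exact: PM.
    have -> : block_mx 1 0 0 (elem i j d) =
       elem (rshift 1 i) (rshift 1 j) d :> 'M[F]_(1 + n).
      rewrite /elem (scalar_mx_block 1 n 1) -[delta_mx (rshift 1 i) _]submxK.
      rewrite scale_block_mx add_block_mx; congr block_mx; apply/matrixP => u v;
        rewrite !mxE ?eq_lrshift ?eq_rlshift ?andbF ?mulr0 ?addr0 //.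
    by apply: (Pe); rewrite (inj_eq (@rshift_inj 1 n)).
  move: dB; rewrite -[B](@submxK _ 1 n 1 n) -/b -/c -/D.
  have -> : ulsubmx (B : 'M_(1 + n)) = 1.
    by apply/matrixP => i j; rewrite !ord1 !mxE -[RHS]B00; congr (B _ _); apply: val_inj.
  have d1 : \det (block_mx 1 0 c 1%:M : 'M[F]_(1 + n)) = 1.
    by rewrite det_lblock !det1 mulr1.
  have d2 : \det (block_mx 1 0 0 (D - c *m b) : 'M[F]_(1 + n)) = \det (D - c *m b).
    by rewrite det_lblock det1 mul1r.
  have d3 : \det (block_mx 1 b 0 1%:M : 'M[F]_(1 + n)) = 1.
    by rewrite det_ublock !det1 mulr1.
  have e : \det (block_mx 1 0 c 1%:M *m
     (block_mx 1 0 0 (D - c *m b) *m block_mx 1 b 0 1%:M) : 'M[F]_(1 + n)) = \det (D - c *m b).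
    by rewrite !det_mulmx d1 d2 d3 mul1r mulr1.
  by rewrite Ef => <-; exact: esym e.
have two i : i != 0 -> A i 0 != 0 -> P A.
  move=> i0 Ai; apply: (back 0 i ((1 - A 0 0) / A i 0)); first by rewrite eq_sym.
  apply: one; first by rewrite detE // eq_sym.
  by rewrite elem_row eqxx divfK // addrC subrK.
have [i /andP[i0 Ai]|nz] := pickP (fun i => (i != 0) && (A i 0 != 0)); first exact: (two i).
have Az i : i != 0 -> A i 0 = 0.
  by move=> i0; apply/eqP; have := nz i; rewrite i0 /= => /negbFE.
(* Now the first column is zero below the corner. In degree 1 the corner is the determinant;
   otherwise adding the first row to the second one leads back to the previous case. *)
case: n IH P A Pc dA P1 PM Pe back detE one two nz Az => [|n] IH P A Pc dA P1 PM Pe back detE one two nz Az.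
  by apply: one => //; rewrite -dA det_mx11.
have A0 : A 0 0 != 0.
  apply: contra_eq_neq dA => A0; rewrite (expand_det_col A 0) big1 ?oner_neq0 1?eq_sym ?oner_neq0 //.
  by move=> i _; have [->|/Az->] := eqVneq i 0; rewrite ?A0 mul0r.
pose i1 : 'I_n.+2 := lift 0 0.
have i10 : i1 != 0 by [].
apply: (back i1 0 1 i10).
pose B := elem i1 0 1 *m A.
have dB : \det B = 1 by rewrite detE.
have B1 : B i1 0 != 0 by rewrite /B elem_row eqxx Az // add0r mul1r.
rewrite -/B -(elemK ((1 - B 0 0) / B i1 0) B (_ : 0 != i1)) //.
apply: (PM); first by apply: (Pe); rewrite eq_sym.
apply: one; first by rewrite detE // eq_sym.
by rewrite elem_row eqxx divfK // addrC subrK.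
Qed.

(** * Matrices placed on selected coordinates *)

Definition selm (F : fieldType) m n (f : 'I_m -> 'I_n) : 'M[F]_(m, n) :=
  \matrix_(i, j) (f i == j)%:R.

(** For injective f this is A on the basis vectors indexed by f and the identity on the others.
    Written as a correction of the identity it multiplies well, because S S^T = 1. *)
Definition embm (F : fieldType) m n (f : 'I_m -> 'I_n) (A : 'M[F]_m) : 'M[F]_n :=
  1%:M + (selm F f)^T *m (A - 1%:M) *m selm F f.

Lemma selm_tr (F : fieldType) m n (f : 'I_m -> 'I_n) : injective f ->
  selm F f *m (selm F f)^T = 1%:M.
Proof.
move=> fi; apply/matrixP => i j; rewrite !mxE (bigD1 (f i)) //= big1 => [|k kf].
  by rewrite !mxE eqxx mul1r addr0 (inj_eq fi) eq_sym.
by rewrite !mxE eq_sym (negPf kf) mul0r.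
Qed.

Lemma selm_tr0 (F : fieldType) m n (f g : 'I_m -> 'I_n) : (forall i j, f i != g j) ->
  selm F f *m (selm F g)^T = 0.
Proof.
move=> fg; apply/matrixP => i j; rewrite !mxE big1 // => k _; rewrite !mxE.
by have [<-|_] := eqVneq (f i) k; rewrite ?mul0r // eq_sym (negPf (fg i j)) mulr0.
Qed.

Lemma embm1 (F : fieldType) m n (f : 'I_m -> 'I_n) : embm f (1%:M : 'M[F]_m) = 1%:M.
Proof. by rewrite /embm subrr mulmx0 mul0mx addr0. Qed.

Lemma embmM (F : fieldType) m n (f : 'I_m -> 'I_n) (A B : 'M[F]_m) : injective f ->
  embm f (A *m B) = embm f A *m embm f B.
Proof.
move=> fi; rewrite /embm; set S := selm F f.
have e : S^T *m (A - 1%:M) *m S *m (S^T *m (B - 1%:M) *m S) =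
         S^T *m ((A - 1%:M) *m (B - 1%:M)) *m S.
  by rewrite !mulmxA -[_ *m S *m S^T]mulmxA selm_tr // mulmx1.
have eAB : A *m B - 1%:M = (A - 1%:M) + ((B - 1%:M) + (A - 1%:M) *m (B - 1%:M)).
  rewrite -{1}(subrK 1%:M A) -{1}(subrK 1%:M B) mulmxDl mulmxDr mulmx1 mul1mx.
  move: (A - _) (B - _) => U V. by rewrite [in LHS]addrA addrK -addrA addrC -addrA.
rewrite [RHS]mulmxDl mul1mx [X in _ = _ + X]mulmxDr mulmx1 e -!addrA; congr (_ + _).
by rewrite eAB !mulmxDr !mulmxDl addrCA.
Qed.

Lemma embm_comm (F : fieldType) m n (f g : 'I_m -> 'I_n) (A B : 'M[F]_m) :
  (forall i j, f i != g j) -> embm f A *m embm g B = embm g B *m embm f A.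
Proof.
move=> fg; have gf i j : g i != f j by rewrite eq_sym.
have z (h k : 'I_m -> 'I_n) (U V : 'M[F]_m) : (forall i j, h i != k j) ->
    (selm F h)^T *m U *m selm F h *m ((selm F k)^T *m V *m selm F k) = 0.
  by move=> hk; rewrite !mulmxA -[_ *m selm F h *m _]mulmxA selm_tr0 // mulmx0 !mul0mx.
rewrite /embm ![(1%:M + _) *m _]mulmxDl !mul1mx ![_ *m (1%:M + _)]mulmxDr !mulmx1.
by rewrite !z // !addr0 -!addrA; congr (_ + _); rewrite addrC.
Qed.

Lemma selm_perm (F : fieldType) m n (f : 'I_m -> 'I_n) (s : 'S_n) :
  selm F f *m perm_mx s = selm F (s \o f).
Proof.
apply/matrixP => i j; rewrite !mxE (bigD1 (f i)) //= big1 => [|k kf].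
  by rewrite !mxE eqxx mul1r addr0.
by rewrite !mxE eq_sym (negPf kf) mul0r.
Qed.

Lemma embm_perm (F : fieldType) m n (f : 'I_m -> 'I_n) (A : 'M[F]_m) (s : 'S_n) :
  embm f A *m perm_mx s = perm_mx s *m embm (s \o f) A.
Proof.
rewrite /embm mulmxDl mulmxDr mul1mx mulmx1; congr (_ + _).
rewrite -!mulmxA selm_perm [RHS]mulmxA; congr (_ *m _).
by rewrite -selm_perm trmx_mul tr_perm_mx mulmxA -perm_mxM mulgV perm_mx1 mul1mx.
Qed.

Lemma embm_ext (F : fieldType) m n (f g : 'I_m -> 'I_n) (A : 'M[F]_m) :
  f =1 g -> embm f A = embm g A.
Proof.
move=> fg; rewrite /embm; suff -> : selm F f = selm F g by [].
by apply/matrixP => i j; rewrite !mxE fg.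
Qed.

Lemma selm_row (F : fieldType) m n (f : 'I_m -> 'I_n) i :
  row i (selm F f) = delta_mx 0 (f i).
Proof. by apply/rowP => q; rewrite !mxE eqxx eq_sym. Qed.

Lemma embm_permE (F : fieldType) m n (f : 'I_m -> 'I_n) (u : 'S_m) (s : 'S_n) :
  injective f -> (forall i, s (f i) = f (u i)) -> (forall p, (forall i, f i != p) -> s p = p) ->
  embm f (perm_mx u : 'M[F]_m) = perm_mx s.
Proof.
move=> fi sf so; apply/row_matrixP => p.
have [/existsP[i /eqP <-]|/existsPn np] := boolP [exists i, f i == p].
  have e (X : 'M[F]_n) : row (f i) X = row i (selm F f *m X).
    by rewrite row_mul selm_row -rowE.
  rewrite !e selm_perm; congr row; rewrite /embm mulmxDr mulmx1 !mulmxA selm_tr // mul1mx.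
  rewrite mulmxBl mul1mx addrC subrK; apply/matrixP => k q; rewrite !mxE /= sf.
  rewrite (bigD1 (u k)) //= big1 => [|l lk]; rewrite !mxE ?eqxx ?mul1r ?addr0 //.
  by rewrite eq_sym (negPf lk) mul0r.
apply/rowP => q; rewrite mxE [RHS]mxE /embm -mulmxA mxE [X in _ + X]mxE.
rewrite big1 ?addr0 => [|k _]; last by rewrite !mxE (negPf (np k)) mul0r.
by rewrite !mxE so.
Qed.

Fact to_gl_key : unit. Proof. exact: tt. Qed.

Definition to_gl (F : finFieldType) n (A : 'M[F]_n.+1) : {'GL_n.+1[F]} :=
  locked_with to_gl_key (insubd (1%g : {'GL_n.+1[F]}) A).

Lemma to_glE (F : finFieldType) n (A : 'M[F]_n.+1) : A \in unitmx -> GLval (to_gl A) = A.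
Proof. by move=> Au; rewrite /to_gl unlock /insubd insubT. Qed.

Lemma to_glM (F : finFieldType) n (A B : 'M[F]_n.+1) : A \in unitmx -> B \in unitmx ->
  to_gl (A *m B) = (to_gl A * to_gl B)%g.
Proof.
move=> Au Bu; apply: val_inj; rewrite [RHS]GL_MxE /= to_glE ?to_glE // ?unitmx_mul ?Au //.
Qed.

End Matrices.

(** * Linear gluing *)

Lemma even_cyc3 (T : finType) (H : {group {perm T}}) (s : {perm T}) :
  (forall i j k, i != j -> k != i -> k != j -> cyc3 i j k \in H) ->
  ~~ odd_perm s -> s \in H.
Proof.
move=> Hc; have two a b c d : a != b -> c != d -> tperm a b * tperm c d \in H.
  move=> ab cd; have share u v w : u != v -> u != w -> tperm u v * tperm u w \in H.
    move=> uv uw; have [->|vw] := eqVneq v w; first by rewrite tperm2 group1.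
    by apply: Hc; rewrite // eq_sym.
  have [E|ac] := eqVneq a c.
    by rewrite -E; apply: share; rewrite // E.
  have [E|ad] := eqVneq a d; first by rewrite [tperm c d]tpermC -E; apply: share; rewrite // E eq_sym.
  (* Disjoint transpositions: (a b)(c d) is the product of (a b)(a c) and (a c)(c d). *)
  rewrite -[tperm a b](mulgK (tperm a c)) tpermV -!mulgA mulgA.
  apply: groupM; first exact: share.
  by rewrite [tperm a c]tpermC; apply: share; rewrite // eq_sym.
case: (prod_tpermP s) => ts -> dts; rewrite odd_perm_prod //.
have [k] := ubnP (size ts); elim: k ts dts => // k IH [|[a b] [|[c d] ts]] //=.
  by rewrite big_nil group1.
case/and3P => ab cd dts; rewrite !ltnS => sz; rewrite negbK => od.
rewrite !big_cons mulgA groupM //; first exact: two.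
by apply: IH => //; apply: leq_trans sz.
Qed.

(** The exponents 3 and 7 are odd, so y and x y are even, and hence x is. This puts the matrix of x
    into the glued group once the even permutations are there. *)
Lemma odd_hurwitz (T : finType) (x y : {perm T}) :
  y ^+ 3 = 1 -> (x * y) ^+ 7 = 1 -> ~~ odd_perm x /\ ~~ odd_perm y.
Proof.
move=> y3 z7; have oy : odd_perm y = false.
  by have := congr1 (@odd_perm T) y3; rewrite !expgS expg0 mulg1 !odd_permM odd_perm1; case: (odd_perm y).
have oz : odd_perm (x * y) = false.
  have := congr1 (@odd_perm T) z7; rewrite !expgS expg0 mulg1 !(odd_permM (x * y)) odd_perm1.
  by case: (odd_perm (x * y)).
by move: oz; rewrite odd_permM oy addbF => ->.
Qed.

(* phi s is the matrix of the permutation s, and e f a fixed involutory matrix acting on the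
   span of the basis vectors indexed by f. *)
Record handle_rep (T : finType) (I : finType) (gT : finGroupType)
    (phi : {perm T} -> gT) (e : (I -> T) -> gT) : Prop := HandleRep {
  repM : forall s t, phi (s * t) = phi s * phi t;
  repJ : forall f s, injective f -> e f ^ phi s = e (s \o f) :> gT;
  rep_ext : forall f g, f =1 g -> e f = e g;
  rep2 : forall f, injective f -> e f * e f = 1 :> gT;
  rep_comm : forall f g, injective f -> injective g -> (forall i j, f i != g j) ->
    commute (e f) (e g)
}.

Lemma rep1 (T I : finType) (gT : finGroupType) (phi : {perm T} -> gT) (e : (I -> T) -> gT) :
  handle_rep phi e -> phi 1 = 1.
Proof. by move=> R; apply: (mulgI (phi 1)); rewrite -(repM R) !mulg1. Qed.

Lemma repX (T I : finType) (gT : finGroupType) (phi : {perm T} -> gT) (e : (I -> T) -> gT) :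
  handle_rep phi e -> forall s k, phi (s ^+ k) = phi s ^+ k.
Proof. by move=> R s; elim=> [|k IH]; rewrite ?(rep1 R) // !expgS (repM R) IH. Qed.

Lemma repV (T I : finType) (gT : finGroupType) (phi : {perm T} -> gT) (e : (I -> T) -> gT) :
  handle_rep phi e -> forall s, phi s^-1 = (phi s)^-1.
Proof.
by move=> R s; apply: (mulgI (phi s)); rewrite -(repM R) !mulgV (rep1 R).
Qed.

Lemma rep_conj (T I : finType) (gT : finGroupType) (phi : {perm T} -> gT) (e : (I -> T) -> gT) :
  handle_rep phi e -> forall s t, phi (s ^ t) = phi s ^ phi t.
Proof. by move=> R s t; rewrite !conjgE !(repM R) (repV R). Qed.

Lemma rep_hword (T I : finType) (gT : finGroupType) (phi : {perm T} -> gT) (e : (I -> T) -> gT) :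
  handle_rep phi e -> forall x y, phi (hword x y) = hword (phi x) (phi y).
Proof. by move=> R x y; rewrite /hword !(repM R) (repV R). Qed.

Lemma linear_glue (T I : finType) (gT : finGroupType) (phi : {perm T} -> gT)
    (e : (I -> T) -> gT) (x y : {perm T}) hs (f : I -> T) :
  handle_rep phi e -> handle_system x y hs -> injective f -> (forall i, f i \in hs) ->
  let E := e f in let B := e (y \o f) in let X := phi x * E * B in
  [/\ X * X = 1 :> gT, X * phi y = phi (x * y) ^ B :> gT
    & forall K, 13 %| K -> hword X (phi y) ^+ K = phi (hword x y ^+ K)].
Proof.
move=> R S fi fh E B X; set w := hword x y.
have h i : handle x y (f i) := sys_handle S (fh i).
have E2 : E * E = 1 by apply: (rep2 R).
have si (s : {perm T}) : injective (s \o f) by apply: inj_comp => //; apply: perm_inj.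
have EJ s : E ^ phi s = e (s \o f) by apply: (repJ R).
have EB : E ^ phi y = B by rewrite EJ.
have cfix (s : {perm T}) : (forall i, s (f i) = f i) -> commute E (phi s).
  by move=> sf; apply: commute_conj; rewrite EJ; apply: (rep_ext R).
have cBfix (s : {perm T}) : (forall i, s (y (f i)) = y (f i)) -> commute B (phi s).
  by move=> sf; apply: commute_conj; rewrite (repJ R) //; apply: (rep_ext R) => i /=; rewrite sf.
have cx : commute E (phi x) by apply: cfix => i; case: (h i).
have cBx : commute B (phi x) by apply: cBfix => i; case: (h i).
have Ew i : E ^ (hword (phi x) (phi y) ^+ i) = e ((w ^+ i) \o f).
  by rewrite -(rep_hword R) -(repX R) EJ.
(* Conjugates along w are equal if the exponents agree modulo 13 and act on disjoint sets of points
   otherwise, since the handles lie on different 13-cycles. *)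
have cw i j : commute (E ^ (hword (phi x) (phi y) ^+ i)) (E ^ (hword (phi x) (phi y) ^+ j)).
  rewrite !Ew; have [ij|ij] := boolP (i == j %[mod 13]).
    have -> : e ((w ^+ i) \o f) = e ((w ^+ j) \o f).
      by apply: (rep_ext R) => k /=; apply/eqP; case: (h k) => _ _ w13 w1 _; rewrite orbit13.
    exact: commute_refl.
  apply: (rep_comm R) => // k l /=; have [->|kl] := eqVneq k l.
    by case: (h l) => _ _ w13 w1 _; rewrite orbit13.
  apply: far_orbit; first by case: (h l).
  by apply: (sys_far S) => //; rewrite (inj_eq fi).
have E7 : E ^ (hword (phi x) (phi y) ^+ 7) = E ^ (phi y ^+ 2).
  by rewrite Ew -(repX R) EJ; apply: (rep_ext R) => k /=; case: (h k).
have y3 : phi y ^+ 3 = 1 by rewrite -(repX R) (sys_y3 S) (rep1 R).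
split.
- rewrite /X -EB; apply: glue_involution; rewrite ?EB //.
    by rewrite -(repM R) (sys_x2 S) (rep1 R).
  apply: (rep_comm R) => // i j /=; rewrite (handle_ya (h i) (h j)) //.
- rewrite /X -EB glue_conj ?EB -?(repM R) //.
  rewrite -(repX R) EJ -[B]/(e (y \o f)); apply: (rep_comm R) => // i j /=.
  by rewrite expgS permM expg1 (inj_eq perm_inj) (handle_ya (h i) (h j)).
move=> K /dvdnP[k ->]; rewrite /X -EB glue_word ?EB // -(rep_hword R) -conjXg -(repX R) -/w.
suff c : commute (strand_prod E (phi w)) (phi (w ^+ (k * 13))).
  by rewrite [LHS]conjgE -(c : _ = _) mulKg.
apply: (big_ind (fun s => commute s (phi (w ^+ (k * 13)))));
  [exact/commute_sym/commute1 | move=> s t cs ct; apply/commute_sym/commuteM; exact/commute_sym |].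
move=> i _; rewrite -(repX R) EJ; apply: commute_conj; rewrite (repJ R) //; apply: (rep_ext R) => j /=.
have [_ _ w13 _ _] := h j.
rewrite -permM -expgD addnC expgD permM mulnC expgM.
suff -> : ((w ^+ 13) ^+ k) (f j) = f j by [].
by elim: k => [|k IH]; rewrite ?expg0 ?perm1 // expgS permM w13.
Qed.

Lemma linear_core (T I : finType) (gT : finGroupType) (phi : {perm T} -> gT)
    (e : (I -> T) -> gT) (x y : {perm T}) hs K (f : I -> T) (G : {group gT}) :
  handle_rep phi e -> 13 %| K -> handle_system x y hs -> seed K x y hs ->
  injective f -> (forall i, f i \in hs) ->
  phi x * e f * e (y \o f) \in G -> phi y \in G ->
  (forall s, ~~ odd_perm s -> phi s \in G) /\ e f * e (y \o f) \in G.
Proof.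
move=> R K13 S [d [d1 d2 d3 [n1 n2 n3] cl]] fi fh XG YG.
have [X2 Xy Xw] := linear_glue R S fi fh.
set E := e f in X2 Xy Xw XG *; set B := e (y \o f) in X2 Xy Xw XG *.
set X := _ * B in X2 Xy Xw XG.
have h i : handle x y (f i) := sys_handle S (fh i).
have yfi : injective (y \o f) by apply: inj_comp => //; apply: perm_inj.
pose H := [set s | phi s \in G].
have Hg : group_set H.
  apply/group_setP; split=> [|s t]; first by rewrite inE (rep1 R) group1.
  by rewrite !inE (repM R) => hs1 ht; apply: groupM.
have mem s : (s \in Group Hg) = (phi s \in G) by rewrite inE.
have cH : core_closed x y (handle_point y hs) (Group Hg).
  split=> s; rewrite !mem (rep_conj R) => sG; first by rewrite groupJ.
  move=> sQ.
  have sx p : x p = p -> s p = p -> (s ^ x) p = p.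
    move=> xp sp; rewrite conjgE !permM.
    have -> : x^-1 p = p by rewrite -{1}xp permK.
    by rewrite sp.
  have sxf i : (s ^ x) (f i) = f i.
    by apply: sx; [case: (h i) | apply: sQ; rewrite /handle_point fh].
  have sxyf i : (s ^ x) (y (f i)) = y (f i).
    by apply: sx; [case: (h i) | apply: sQ; rewrite /handle_point map_f ?orbT].
  (* Since [s ^ x] fixes the handle points, its matrix commutes with E and B: X conjugates the
     matrix of s as x does. *)
  rewrite -(rep_conj R); suff <- : phi s ^ X = phi (s ^ x) by rewrite groupJ.
  rewrite /X !conjgM -(rep_conj R).
  have cE g : injective g -> (forall i, (s ^ x) (g i) = g i) ->
      phi (s ^ x) ^ e g = phi (s ^ x).
    move=> gi sg; apply/conjg_fixP/commgP/commute_sym/commute_conj.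
    by rewrite (repJ R) //; apply: (rep_ext R).
  by rewrite !cE.
have HK : hword x y ^+ K \in Group Hg.
  rewrite mem -Xw //; apply: groupX.
  exact: (groupM (groupM (groupM XG (groupVr YG)) XG) YG).
have cd := cl _ cH HK.
have l1 : link (Group Hg) d (y d).
  by right; exists (x (y d)); split; rewrite // eq_sym.
have l2 : link (Group Hg) d (x (y d)).
  right; exists (y d); split; rewrite // 1?eq_sym //.
  rewrite -(@cyc3V _ (x (y d))) ?groupV // 1?eq_sym //.
  by rewrite (@cyc3_rot _ (x (y d))) // eq_sym.
have LA : forall i j, link (Group Hg) i j.
  (* The 3-cycle of the seed serves everywhere: its points d, [y d] and [x (y d)] show stability
     under y and x and are also the spare points. *)
  apply: (@link_all _ x y (handle_point y hs) (Group Hg) d d (y d) d (y d) (x (y d))) => //.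
  - move=> q /orP[]; first by move/(sys_handle S) => [].
    by case/mapP=> a /(sys_handle S) [_ xya _ _ _] ->.
  - exact: (sys_tr S).
  - exact: link_refl.
  - by split=> //; apply: link_refl.
  - by split; rewrite // eq_sym.
have ev s : ~~ odd_perm s -> phi s \in G.
  move=> os; rewrite -mem; apply: even_cyc3 os => i j k ij ki kj.
  exact: link_cyc3.
split=> //; have [ox _] := odd_hurwitz (sys_y3 S) (sys_z7 S).
have -> : E * B = (phi x)^-1 * X by rewrite /X -mulgA mulKg.
by rewrite groupM // groupV ev.
Qed.

Definition perm_gl (F : finFieldType) n (s : 'S_n.+1) : {'GL_n.+1[F]} := to_gl (perm_mx s).

Definition emb_gl (F : finFieldType) m n (f : 'I_m -> 'I_n.+1) (A : 'M[F]_m) : {'GL_n.+1[F]} :=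
  to_gl (embm f A).

Lemma perm_glM (F : finFieldType) n (s t : 'S_n.+1) : perm_gl F (s * t) = perm_gl F s * perm_gl F t.
Proof. by rewrite /perm_gl perm_mxM to_glM ?unitmx_perm. Qed.

Lemma perm_gl1 (F : finFieldType) n : perm_gl F (1 : 'S_n.+1) = 1.
Proof. by apply: val_inj; rewrite [LHS]to_glE ?unitmx_perm // perm_mx1. Qed.

Lemma embm_unit (F : fieldType) m n (f : 'I_m -> 'I_n) (A : 'M[F]_m) :
  injective f -> A \in unitmx -> embm f A \in unitmx.
Proof.
move=> fi Au; have := embmM A (invmx A) fi; rewrite mulmxV // embm1.
by move/esym/mulmx1_unit => [].
Qed.

Lemma emb_glM (F : finFieldType) m n (f : 'I_m -> 'I_n.+1) (A B : 'M[F]_m) :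
  injective f -> A \in unitmx -> B \in unitmx -> emb_gl f (A *m B) = emb_gl f A * emb_gl f B.
Proof. by move=> fi Au Bu; rewrite /emb_gl embmM // to_glM ?embm_unit. Qed.

Lemma emb_gl_ext (F : finFieldType) m n (f g : 'I_m -> 'I_n.+1) (A : 'M[F]_m) :
  f =1 g -> emb_gl f A = emb_gl g A.
Proof. by move=> fg; rewrite /emb_gl (embm_ext _ fg). Qed.

Lemma emb_glJ (F : finFieldType) m n (f : 'I_m -> 'I_n.+1) (A : 'M[F]_m) s :
  injective f -> A \in unitmx -> emb_gl f A ^ perm_gl F s = emb_gl (s \o f) A.
Proof.
move=> fi Au; apply: (mulgI (perm_gl F s)); rewrite -conjgC.
have sf : injective (s \o f) by apply: inj_comp => //; apply: perm_inj.
by rewrite /perm_gl /emb_gl -!to_glM ?embm_perm ?unitmx_perm ?embm_unit.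
Qed.

Lemma emb_gl_comm (F : finFieldType) m n (f g : 'I_m -> 'I_n.+1) (A B : 'M[F]_m) :
  injective f -> injective g -> A \in unitmx -> B \in unitmx ->
  (forall i j, f i != g j) -> commute (emb_gl f A) (emb_gl g B).
Proof.
move=> fi gi Au Bu fg; rewrite /commute /emb_gl -!to_glM ?embm_unit //.
by rewrite embm_comm.
Qed.

Lemma emb_gl_rep (F : finFieldType) m n (A : 'M[F]_m) : (A *m A = 1%:M)%R ->
  handle_rep (@perm_gl F n) (fun f => emb_gl f A).
Proof.
move=> A2; have Au : A \in unitmx by case/mulmx1_unit: A2.
split=> [s t|f s fi|f g fg|f fi|f g fi gi fg].
- exact: perm_glM.
- exact: emb_glJ.
- exact: emb_gl_ext.
- by rewrite -emb_glM // A2; apply: val_inj; rewrite /= [LHS]to_glE embm1 // unitmx1.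
- exact: emb_gl_comm.
Qed.

(** * Transvections *)

Section Transvections.
Local Open Scope ring_scope.

(** Invertibility is included because [to_gl] sends singular matrices to 1. *)
Definition mx_in (F : finFieldType) n (G : {group {'GL_n.+1[F]}}) (M : 'M[F]_n.+1) : Prop :=
  M \in unitmx /\ to_gl M \in G.

Lemma mx_in1 (F : finFieldType) n (G : {group {'GL_n.+1[F]}}) : mx_in G 1%:M.
Proof.
split; first exact: unitmx1.
by have -> : to_gl 1%:M = 1%g :> {'GL_n.+1[F]}; [apply: val_inj; rewrite [LHS]to_glE ?unitmx1 | apply: group1].
Qed.

Lemma mx_inM (F : finFieldType) n (G : {group {'GL_n.+1[F]}}) (M N : 'M[F]_n.+1) :
  mx_in G M -> mx_in G N -> mx_in G (M *m N).
Proof. by move=> [Mu MG] [Nu NG]; split; rewrite ?unitmx_mul ?Mu // to_glM // groupM. Qed.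

Lemma mx_inV (F : finFieldType) n (G : {group {'GL_n.+1[F]}}) (M N : 'M[F]_n.+1) :
  mx_in G M -> M *m N = 1%:M -> mx_in G N.
Proof.
move=> [Mu MG] MN; have Nu : N \in unitmx by case/mulmx1_unit: MN.
split=> //; suff -> : to_gl N = (to_gl M)^-1%g :> {'GL_n.+1[F]} by rewrite groupV.
have e : (to_gl M * to_gl N)%g = 1%g :> {'GL_n.+1[F]}.
  by rewrite -to_glM // MN; apply: val_inj; rewrite [LHS]to_glE ?unitmx1.
by rewrite -[to_gl N](mulKg (to_gl M)) e mulg1.
Qed.

Lemma mx_inJ (F : finFieldType) n (G : {group {'GL_n.+1[F]}}) (M : 'M[F]_n.+1) (s : 'S_n.+1) :
  perm_gl F s \in G -> mx_in G M -> mx_in G ((perm_mx s)^T *m M *m perm_mx s).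
Proof.
move=> sG MG; have ps : mx_in G (perm_mx s) by split; rewrite ?unitmx_perm.
apply: mx_inM => //; apply: mx_inM => //; apply: mx_inV ps _.
by rewrite tr_perm_mx -perm_mxM mulgV perm_mx1.
Qed.

Lemma delta_perm (F : fieldType) n (i j : 'I_n) (s : 'S_n) :
  (perm_mx s)^T *m delta_mx i j *m perm_mx s = delta_mx (s i) (s j) :> 'M[F]_n.
Proof.
have rowd k : (delta_mx 0 k : 'rV[F]_n) *m perm_mx s = delta_mx 0 (s k).
  by rewrite -rowE; apply/rowP => q; rewrite !mxE eqxx /= eq_sym.
have -> : delta_mx i j = (delta_mx i 0 : 'cV[F]_n) *m (delta_mx 0 j : 'rV[F]_n).
  by rewrite mul_delta_mx.
rewrite !mulmxA -mulmxA rowd.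
have -> : (perm_mx s)^T *m delta_mx i 0 = (delta_mx (s i) 0 : 'cV[F]_n).
  by rewrite -[LHS]trmxK trmx_mul trmxK trmx_delta rowd trmx_delta.
by rewrite mul_delta_mx.
Qed.

Lemma perm_mx_conj1 (F : fieldType) n (s : 'S_n) :
  (perm_mx s)^T *m perm_mx s = 1%:M :> 'M[F]_n.
Proof. by rewrite tr_perm_mx -perm_mxM mulVg perm_mx1. Qed.

(** A row vector v goes to v + c (v_i - v_j) e_k. For k different from i and j this is a
    transvection, and it fixes the all-ones vector. *)
Definition ctrans (F : fieldType) n (k i j : 'I_n) (c : F) : 'M[F]_n :=
  1%:M + c *: (delta_mx i k - delta_mx j k).

Lemma ctransJ (F : fieldType) n (k i j : 'I_n) (c : F) (s : 'S_n) :
  (perm_mx s)^T *m ctrans k i j c *m perm_mx s = ctrans (s k) (s i) (s j) c.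
Proof.
rewrite /ctrans mulmxDr mulmx1 mulmxDl perm_mx_conj1; congr (_ + _).
by rewrite -scalemxAr -scalemxAl mulmxBr mulmxBl !delta_perm.
Qed.

Lemma elemJ (F : fieldType) n (i j : 'I_n) (c : F) (s : 'S_n) :
  (perm_mx s)^T *m elem i j c *m perm_mx s = elem (s i) (s j) c.
Proof.
rewrite /elem mulmxDr mulmx1 mulmxDl perm_mx_conj1; congr (_ + _).
by rewrite -scalemxAr -scalemxAl delta_perm.
Qed.

Lemma fresh (T : finType) (l : seq T) : (size l < #|T|)%N -> exists x, x \notin l.
Proof.
move=> sl; apply/existsP; rewrite -negb_forall; apply/negP => /forallP a.
have := leq_ltn_trans (card_size l) sl; rewrite ltnNge => /negP; apply.
by apply: subset_leq_card; apply/subsetP => x _; apply: a.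
Qed.

Definition alt_in (F : finFieldType) n (G : {group {'GL_n.+1[F]}}) : Prop :=
  forall s : 'S_n.+1, ~~ odd_perm s -> perm_gl F s \in G.

Lemma cyc3_even (T : finType) (i j k : T) : i != j -> k != i -> ~~ odd_perm (cyc3 i j k).
Proof. by move=> ij ki; rewrite odd_permM !odd_tperm ij eq_sym ki. Qed.

Lemma alt_move (F : finFieldType) n (G : {group {'GL_n.+1[F]}}) (k k' : 'I_n.+1) (l : seq 'I_n.+1) :
  alt_in G -> ((size l).+2 < n.+1)%N -> k \notin l -> k' \notin l ->
  exists2 s : 'S_n.+1, perm_gl F s \in G & s k = k' /\ {in l, forall i, s i = i}.
Proof.
move=> aG sl kl k'l; have [E|kk] := eqVneq k k'.
  by exists 1%g; rewrite ?perm_gl1 ?group1 // perm1; split=> // i _; rewrite perm1.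
have [t] : exists t, t \notin [:: k, k' & l] by apply: fresh; rewrite card_ord.
rewrite !inE !negb_or => /and3P[tk tk' tl].
exists (cyc3 k k' t); first by apply/aG/cyc3_even.
rewrite cyc3E // eqxx; split=> // i il; rewrite cyc3E //.
have ni x : x \notin l -> (i == x) = false by move=> xl; apply: contraNF xl => /eqP <-.
by rewrite !ni.
Qed.

Lemma ctrans_conj_all (F : finFieldType) n (G : {group {'GL_n.+1[F]}}) (k0 i0 j0 : 'I_n.+1) c :
  (9 < n)%N -> alt_in G -> k0 != i0 -> k0 != j0 -> i0 != j0 -> mx_in G (ctrans k0 i0 j0 c) ->
  forall k i j, k != i -> k != j -> i != j -> mx_in G (ctrans k i j c).
Proof.
move=> n9 aG ki0 kj0 ij0 h0.
have mv1 k k' i j : k \notin [:: i; j] -> k' \notin [:: i; j] ->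
    mx_in G (ctrans k i j c) -> mx_in G (ctrans k' i j c).
  move=> hk hk' h; have [|s sG [sk sl]] := alt_move aG _ hk hk'.
    by rewrite /= ltnS (leq_trans _ n9).
  by have := mx_inJ sG h; rewrite ctransJ sk !sl // !inE eqxx ?orbT.
have mv2 k i i' j : i \notin [:: k; j] -> i' \notin [:: k; j] ->
    mx_in G (ctrans k i j c) -> mx_in G (ctrans k i' j c).
  move=> hk hk' h; have [|s sG [sk sl]] := alt_move aG _ hk hk'.
    by rewrite /= ltnS (leq_trans _ n9).
  by have := mx_inJ sG h; rewrite ctransJ sk !sl // !inE eqxx ?orbT.
have mv3 k i j j' : j \notin [:: k; i] -> j' \notin [:: k; i] ->
    mx_in G (ctrans k i j c) -> mx_in G (ctrans k i j' c).
  move=> hk hk' h; have [|s sG [sk sl]] := alt_move aG _ hk hk'.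
    by rewrite /= ltnS (leq_trans _ n9).
  by have := mx_inJ sG h; rewrite ctransJ sk !sl // !inE eqxx ?orbT.
move=> k i j ki kj ij.
(* The indices move one at a time, first to fresh points u, v, w and then to k, i, j, so that they
   never collide. At most eight points have to be avoided, for which [9 < n] leaves room. *)
have [u] : exists u, u \notin [:: k0; i0; j0; k; i; j].
  by apply: fresh; rewrite card_ord; rewrite /= ltnS (leq_trans _ n9).
rewrite !inE !negb_or => /and5P[u1 u2 u3 u4 /andP[u5 u6]].
have [v] : exists v, v \notin [:: u; k0; i0; j0; k; i; j].
  by apply: fresh; rewrite card_ord; rewrite /= ltnS (leq_trans _ n9).
rewrite !inE !negb_or => /and5P[v0 v1 v2 v3 /and3P[v4 v5 v6]].
have [w] : exists w, w \notin [:: u; v; k0; i0; j0; k; i; j].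
  by apply: fresh; rewrite card_ord; rewrite /= ltnS (leq_trans _ n9).
rewrite !inE !negb_or => /and5P[w0 w0' w1 w2 /and4P[w3 w4 w5 w6]].
have nin2 (p q r : 'I_n.+1) : p != q -> p != r -> p \notin [:: q; r].
  by move=> pq pr; rewrite !inE negb_or pq.
have [ik jk ji] : [/\ i != k, j != k & j != i] by rewrite ![_ == k]eq_sym [j == i]eq_sym.
have [ik0 jk0 ji0] : [/\ i0 != k0, j0 != k0 & j0 != i0].
  by rewrite ![_ == k0]eq_sym [j0 == i0]eq_sym.
have [uv vw uw] : [/\ u != v, v != w & u != w] by rewrite ![u == _]eq_sym [v == w]eq_sym.
have [ku kv] : k != u /\ k != v by rewrite ![k == _]eq_sym.
have [iv iw jw] : [/\ i != v, i != w & j != w] by rewrite ![i == _]eq_sym [j == w]eq_sym.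
have [i0u i0v j0u j0v] : [/\ i0 != u, i0 != v, j0 != u & j0 != v].
  by rewrite ![_ == u]eq_sym ![_ == v]eq_sym.
have kw : k != w by rewrite eq_sym.
apply: (mv3 _ _ w); [exact: nin2 | exact: nin2 |].
apply: (mv2 _ v); [exact: nin2 | exact: nin2 |].
apply: (mv1 u); [exact: nin2 | exact: nin2 |].
apply: (mv3 _ _ j0); [exact: nin2 | exact: nin2 |].
apply: (mv2 _ i0); [exact: nin2 | exact: nin2 |].
by apply: (mv1 k0); [exact: nin2 | exact: nin2 |].
Qed.

Lemma ring_comm_eq (R : pzRingType) (u v : R) : v * u = 0 -> v * v = 0 ->
  (1 + u) * (1 + v) = (1 + u * v) * ((1 + v) * (1 + u)).
Proof.
move=> vu vv; have -> : (1 + v) * (1 + u) = 1 + u + v.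
  by rewrite mulrDl mul1r mulrDr mulr1 vu addr0.
rewrite [RHS]mulrDl mul1r !mulrDr mulr1 -!mulrA vu vv !mulr0 !addr0.
by rewrite mulrDl mul1r !addrA mulr1.
Qed.

Lemma ctrans_add (F : fieldType) n (k i j i' j' : 'I_n) (c d : F) : k != i' -> k != j' ->
  ctrans k i j c *m ctrans k i' j' d =
  1%:M + c *: (delta_mx i k - delta_mx j k) + d *: (delta_mx i' k - delta_mx j' k).
Proof.
move=> ki kj; rewrite /ctrans mulmxDl mul1mx mulmxDr mulmx1 -scalemxAl -scalemxAr.
rewrite mulmxBl !mulmxBr !mul_delta_mx_0 // !subr0 !scaler0 addr0.
by rewrite addrAC.
Qed.

Lemma ctrans_mul (F : fieldType) n (k i j : 'I_n) (c d : F) : k != i -> k != j ->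
  ctrans k i j c *m ctrans k i j d = ctrans k i j (c + d).
Proof. by move=> ki kj; rewrite ctrans_add // /ctrans scalerDl addrA. Qed.

(** Commutators multiply the scalars; this is the source of all powers of g. *)
Lemma ctrans_comm (F : fieldType) n (k i j l m : 'I_n.+1) (c d : F) :
  k != i -> k != j -> l != i -> l != j -> l != k -> l != m -> k != m ->
  ctrans k i j c *m ctrans l k m d =
  ctrans l i j (c * d) *m (ctrans l k m d *m ctrans k i j c).
Proof.
move=> ki kj li lj lk lm km.
rewrite {1 2 4 5}/ctrans.
set u := c *: _; set v := d *: _.
have uv : u *m v = (c * d) *: (delta_mx i l - delta_mx j l).
  rewrite /u /v -scalemxAl -scalemxAr scalerA mulmxBl !mulmxBr.
  by rewrite !mul_delta_mx !mul_delta_mx_0 // !subr0.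
have vu : v *m u = 0.
  rewrite /u /v -scalemxAl -scalemxAr mulmxBl !mulmxBr !mul_delta_mx_0 //.
  by rewrite !subr0 !scaler0.
have vv : v *m v = 0.
  rewrite /v -scalemxAl -scalemxAr mulmxBl !mulmxBr !mul_delta_mx_0 //.
  by rewrite !subr0 !scaler0.
rewrite /ctrans -uv; exact: (ring_comm_eq (R := 'M[F]_n.+1) vu vv).
Qed.

(* The sign leaves the freedom to replace g by - g. *)
Definition gen_scalar (F : fieldType) (g : F) : Prop :=
  forall c : F, c != 0 -> exists e : nat, c = g ^+ e.+1 \/ c = - g ^+ e.+1.

(** Commutators with the transvection of scalar g raise the power of g by one, and inverses supply
    the sign. *)
Lemma ctrans_all (F : finFieldType) n (G : {group {'GL_n.+1[F]}}) (k0 i0 j0 : 'I_n.+1) g :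
  (9 < n)%N -> alt_in G -> gen_scalar g ->
  k0 != i0 -> k0 != j0 -> i0 != j0 -> mx_in G (ctrans k0 i0 j0 g) ->
  forall k i j c, k != i -> k != j -> i != j -> mx_in G (ctrans k i j c).
Proof.
move=> n9 aG gg ki0 kj0 ij0 h0.
have all c k1 i1 j1 : k1 != i1 -> k1 != j1 -> i1 != j1 -> mx_in G (ctrans k1 i1 j1 c) ->
    forall k i j, k != i -> k != j -> i != j -> mx_in G (ctrans k i j c).
  by move=> ? ? ? h; apply: ctrans_conj_all h.
have {}h0 := all g _ _ _ ki0 kj0 ij0 h0.
have inv c k i j : k != i -> k != j -> mx_in G (ctrans k i j c) -> mx_in G (ctrans k i j (- c)).
  move=> ki kj h; apply: mx_inV h _; rewrite ctrans_mul // subrr /ctrans scale0r addr0 //.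
have pow e : forall k i j, k != i -> k != j -> i != j -> mx_in G (ctrans k i j (g ^+ e.+1)).
  elim: e => [|e IH]; first by rewrite expr1.
  have [l] : exists l, l \notin [:: k0; i0; j0] by apply: fresh; rewrite card_ord /= ltnS (leq_trans _ n9).
  rewrite !inE !negb_or => /and3P[lk li lj].
  have [m] : exists m, m \notin [:: l; k0; i0; j0].
    by apply: fresh; rewrite card_ord /= ltnS (leq_trans _ n9).
  rewrite !inE !negb_or => /and4P[ml mk mi mj].
  apply: (all _ l i0 j0) => //; rewrite exprSr.
  have lm : l != m by rewrite eq_sym.
  have km : k0 != m by rewrite eq_sym.
  have U := IH _ _ _ ki0 kj0 ij0; have V := h0 l k0 m lk lm km.
  have := ctrans_comm (g ^+ e.+1) g ki0 kj0 li lj lk lm km.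
  set X := ctrans l i0 j0 _; set P := ctrans l k0 m g *m _ => E.
  have PG : mx_in G P by apply: mx_inM.
  have [Pu PG'] := PG.
  have -> : X = (ctrans k0 i0 j0 (g ^+ e.+1) *m ctrans l k0 m g) *m invmx P.
    by rewrite E mulmxK.
  by apply: mx_inM; [apply: mx_inM | apply: mx_inV PG _; rewrite mulmxV].
move=> k i j c ki kj ij; have [->|/gg[e [->|->]]] := eqVneq c 0.
- by rewrite /ctrans scale0r addr0; apply: mx_in1.
- exact: pow.
- by apply: inv => //; apply: pow.
Qed.

Lemma elem_all (F : finFieldType) n (G : {group {'GL_n.+1[F]}}) (i0 l0 : 'I_n.+1) :
  (9 < n)%N -> alt_in G -> i0 != l0 ->
  (forall c, mx_in G (elem i0 l0 c)) ->
  forall i l c, i != l -> mx_in G (elem i l c).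
Proof.
move=> n9 aG il0 h i l c il.
have mv1 p p' q : p != q -> p' != q -> mx_in G (elem p q c) -> mx_in G (elem p' q c).
  move=> hp hp' H; have [|||s sG [sp sq]] := @alt_move _ _ _ p p' [:: q] aG; rewrite ?inE //=.
    by rewrite ltnS (leq_trans _ n9).
  by have := mx_inJ sG H; rewrite elemJ sp sq // inE.
have mv2 p q q' : q != p -> q' != p -> mx_in G (elem p q c) -> mx_in G (elem p q' c).
  move=> hp hp' H; have [|||s sG [sq sp]] := @alt_move _ _ _ q q' [:: p] aG; rewrite ?inE //=.
    by rewrite ltnS (leq_trans _ n9).
  by have := mx_inJ sG H; rewrite elemJ sp ?sq // inE.
have [u] : exists u, u \notin [:: i0; l0; i; l].
  by apply: fresh; rewrite card_ord /= ltnS (leq_trans _ n9).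
rewrite !inE !negb_or => /and4P[u1 u2 u3 u4].
apply: (mv1 u) => //; apply: (mv2 _ l0); rewrite 1?eq_sym // 1?eq_sym //.
by apply: (mv1 i0) => //; apply: h.
Qed.

Lemma SL_in (F : finFieldType) n (G : {group {'GL_n.+1[F]}}) :
  (forall i l c, i != l -> mx_in G (elem i l c)) ->
  forall u : {'GL_n.+1[F]}, \det (GLval u) = 1 -> u \in G.
Proof.
move=> h u du; have [_] : mx_in G (GLval u).
  apply: (@SL_elem F n.+1 (mx_in G)) du; split; [exact: mx_in1 | by move=> A B; apply: mx_inM | exact: h].
suff -> : to_gl (GLval u) = u by [].
by apply: val_inj; rewrite [LHS]to_glE // GL_unitmx.
Qed.

(** * Matrices through their action on basis vectors *)

Definition evec (F : fieldType) n (p : 'I_n) : 'rV[F]_n := delta_mx 0 p.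

Lemma evec_eq (F : fieldType) m n (M N : 'M[F]_(m, n)) :
  (forall p, evec F p *m M = evec F p *m N) -> M = N.
Proof. by move=> h; apply/row_matrixP => p; rewrite !rowE; apply: h. Qed.

Lemma evec_embm (F : fieldType) m n (f : 'I_m -> 'I_n) (A : 'M[F]_m) i : injective f ->
  evec F (f i) *m embm f A = \sum_k A i k *: evec F (f k).
Proof.
move=> fi; rewrite /evec -selm_row -row_mul /embm mulmxDr mulmx1 !mulmxA selm_tr // mul1mx.
rewrite mulmxBl mul1mx addrC subrK row_mul mulmx_sum_row; apply: eq_bigr => k _.
by rewrite mxE selm_row.
Qed.

Lemma evec_embm_out (F : fieldType) m n (f : 'I_m -> 'I_n) (A : 'M[F]_m) p :
  (forall i, f i != p) -> evec F p *m embm f A = evec F p.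
Proof.
move=> np; rewrite /embm mulmxDr mulmx1 !mulmxA.
have -> : evec F p *m (selm F f)^T = 0.
  by rewrite -rowE; apply/rowP => k; rewrite !mxE (negPf (np k)).
by rewrite !mul0mx addr0.
Qed.

Lemma evec_perm (F : fieldType) n (s : 'S_n) p : evec F p *m perm_mx s = evec F (s p).
Proof. by rewrite -rowE; apply/rowP => q; rewrite !mxE eqxx /= eq_sym. Qed.

Lemma evec_ctrans (F : fieldType) n (k i j p : 'I_n) (c : F) :
  evec F p *m ctrans k i j c = evec F p + (c * ((p == i)%:R - (p == j)%:R)) *: evec F k.
Proof.
have ed a : evec F p *m delta_mx a k = (p == a)%:R *: evec F k.
  have [->|pa] := eqVneq p a; first by rewrite /evec mul_delta_mx scale1r.
  by rewrite /evec mul_delta_mx_0 // scale0r.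
by rewrite /ctrans mulmxDr mulmx1 -scalemxAr mulmxBr !ed -scalerBl scalerA.
Qed.

Lemma row_ctrans (F : fieldType) n (k i j : 'I_n) (d : F) : k != i -> k != j -> i != j ->
  [/\ evec F i *m ctrans k i j d = evec F i + d *: evec F k,
      evec F j *m ctrans k i j d = evec F j - d *: evec F k
    & forall p, p != i -> p != j -> evec F p *m ctrans k i j d = evec F p].
Proof.
move=> ki kj ij; split=> [||p pi pj]; rewrite evec_ctrans ?eqxx.
- by rewrite (negPf ij) subr0 mulr1.
- by rewrite [j == i]eq_sym (negPf ij) sub0r mulrN1 scaleNr.
- by rewrite (negPf pi) (negPf pj) subrr mulr0 scale0r addr0.
Qed.

Lemma evec_elem (F : fieldType) n (i j p : 'I_n) (c : F) :
  evec F p *m elem i j c = evec F p + (c * (p == i)%:R) *: evec F j.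
Proof.
rewrite /elem mulmxDr mulmx1 -scalemxAr; have [->|pa] := eqVneq p i.
  by rewrite /evec mul_delta_mx mulr1.
by rewrite /evec mul_delta_mx_0 // mulr0 scale0r scaler0.
Qed.

(* Multiplying by the conjugate under s cancels the factor at f. *)
Lemma isolate (F : finFieldType) m n (f g : 'I_m -> 'I_n.+1) (A : 'M[F]_m)
    (G : {group {'GL_n.+1[F]}}) (s : 'S_n.+1) :
  injective f -> injective g -> (forall i j, f i != g j) -> A *m A = 1%:M ->
  (emb_gl f A * emb_gl g A \in G)%g -> perm_gl F s \in G -> (forall i, s (f i) = f i) ->
  mx_in G (embm g A *m embm (s \o g) A).
Proof.
move=> fi gi fg A2 EG sG sf; have Au : A \in unitmx by case/mulmx1_unit: A2.
have sgi : injective (s \o g) by apply: inj_comp => //; apply: perm_inj.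
split; first by rewrite unitmx_mul !embm_unit.
have := groupM EG (groupJ EG sG).
have -> : ((emb_gl f A * emb_gl g A) ^ perm_gl F s)%g = (emb_gl f A * emb_gl (s \o g) A)%g.
  by rewrite conjMg !emb_glJ //; congr (_ * _)%g; apply: emb_gl_ext => i /=.
have c : (emb_gl f A * emb_gl g A)%g = (emb_gl g A * emb_gl f A)%g :> {'GL_n.+1[F]} by apply: emb_gl_comm.
have E2 : (emb_gl f A * emb_gl f A)%g = 1%g :> {'GL_n.+1[F]}.
  by rewrite -emb_glM // A2 /emb_gl embm1 -perm_mx1; apply: perm_gl1.
have e : (emb_gl f A * emb_gl g A * (emb_gl f A * emb_gl (s \o g) A) = emb_gl g A * emb_gl (s \o g) A)%g.
  by rewrite c -(@mulgA _ (emb_gl g A)) (@mulgA _ (emb_gl f A)) E2 mul1g.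
rewrite e.
by rewrite /emb_gl -to_glM ?embm_unit.
Qed.

(* In the basis (e1, g e0 + e1) this is a transposition. *)
Definition swap2 (F : fieldType) (g : F) : 'M[F]_2 :=
  \matrix_(i, j) (if i == 0 then (if j == 0 then - 1 else 0) else (if j == 0 then g else 1)).

Lemma swap2K (F : fieldType) (g : F) : swap2 g *m swap2 g = 1%:M.
Proof.
apply/matrixP => i j; rewrite !mxE !big_ord_recl big_ord0 !mxE /= addr0.
by case: (i) => [[|[|]]] //= ?; case: (j) => [[|[|]]] //= ?;
  rewrite ?mxE -?val_eqE /= ?mulr0 ?mul0r ?addr0 ?add0r ?mulr1 ?mul1r ?mulrNN ?mulr1 ?mulrN1 ?addNr.
Qed.

Definition pairf (T : Type) (a b : T) : 'I_2 -> T := fun i => if i == 0 then a else b.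

Lemma pairf_inj (T : eqType) (a b : T) : a != b -> injective (pairf a b).
Proof.
move=> ab i j; rewrite /pairf; have [->|i0] := eqVneq i 0; have [->|j0] := eqVneq j 0 => // E.
- by rewrite E eqxx in ab.
- by rewrite E eqxx in ab.
by apply/val_inj; case: i i0 => -[|[|]] //; case: j j0 {E} => -[|[|]].
Qed.

Lemma evec_swap2 (F : fieldType) n (a b : 'I_n) (g : F) : a != b ->
  [/\ evec F a *m embm (pairf a b) (swap2 g) = - evec F a,
      evec F b *m embm (pairf a b) (swap2 g) = g *: evec F a + evec F b
    & forall p, p != a -> p != b -> evec F p *m embm (pairf a b) (swap2 g) = evec F p].
Proof.
move=> ab; have fi := pairf_inj ab.
have one : (1 : 'I_2) == 0 = false by [].
split.
- have := evec_embm (swap2 g) 0 fi; rewrite !big_ord_recl big_ord0 !mxE /pairf /= => ->.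
  by rewrite scaleN1r scale0r !addr0.
- have := evec_embm (swap2 g) 1 fi; rewrite !big_ord_recl big_ord0 !mxE /pairf /= => ->.
  by rewrite scale1r addr0.
move=> p pa pb; apply: evec_embm_out => i; rewrite /pairf.
by case: ifP => _; rewrite eq_sym.
Qed.

(** Both factors negate e_a. The signs cancel on e_a, and the multiples of e_a added at u and b end
    up opposite. *)
Lemma swap2_transvection (F : fieldType) n (a b u : 'I_n) (g : F) : a != b -> a != u -> b != u ->
  embm (pairf a b) (swap2 g) *m embm (pairf a u) (swap2 g) = ctrans a u b g.
Proof.
move=> ab au bu; have [Aa Ab Ao] := evec_swap2 g ab; have [Ua Uu Uo] := evec_swap2 g au.
apply: evec_eq => p; rewrite mulmxA evec_ctrans.
have [->|pa] := eqVneq p a.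
  by rewrite Aa mulNmx Ua opprK (negPf ab) (negPf au) subrr mulr0 scale0r addr0.
have [->|pb] := eqVneq p b.
  rewrite Ab mulmxDl -scalemxAl Ua Uo // 1?eq_sym //.
  by rewrite [u == b]eq_sym (negPf bu) sub0r mulrN1 scaleNr scalerN addrC.
rewrite Ao //; have [->|pu] := eqVneq p u; first by rewrite Uu subr0 mulr1 addrC.
by rewrite Uo // subrr mulr0 scale0r addr0.
Qed.

Lemma swap2_SL (F : finFieldType) n (G : {group {'GL_n.+1[F]}}) (x y : 'S_n.+1) hs K a0 a1 (g : F) :
  (9 < n)%N -> (13 %| K)%N -> handle_system x y hs -> seed K x y hs ->
  a0 \in hs -> a1 \in hs -> a0 != a1 -> gen_scalar g -> g != 2%:R ->
  (perm_gl F x * emb_gl (pairf a0 a1) (swap2 g) * emb_gl (y \o pairf a0 a1) (swap2 g) \in G)%g ->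
  perm_gl F y \in G ->
  forall u : {'GL_n.+1[F]}, \det (GLval u) = 1 -> u \in G.
Proof.
move=> n9 K13 S sd h0 h1 a01 gg g2 XG YG; set f := pairf a0 a1; set A := swap2 g.
have fi : injective f by apply: pairf_inj.
have fh i : f i \in hs by rewrite /f /pairf; case: ifP.
have [aG EG] := linear_core (emb_gl_rep n (swap2K g)) K13 S sd fi fh XG YG.
set b0 := y a0; set b1 := y a1.
have gE : y \o f =1 pairf b0 b1 by move=> i; rewrite /f /pairf /=; case: ifP.
have b01 : b0 != b1 by rewrite (inj_eq perm_inj).
have gi : injective (pairf b0 b1) by apply: pairf_inj.
have fg i j : f i != pairf b0 b1 j.
  by rewrite -gE /= (handle_ya (sys_handle S (fh i)) (sys_handle S (fh j))).
have {}EG : (emb_gl f A * emb_gl (pairf b0 b1) A \in G)%g by rewrite -(emb_gl_ext _ gE).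
have [u] : exists u, u \notin [:: a0; a1; b0; b1].
  by apply: fresh; rewrite card_ord /= ltnS (leq_trans _ n9).
rewrite !inE !negb_or => /and4P[ua0 ua1 ub0 ub1].
have [t] : exists t, t \notin [:: u; a0; a1; b0; b1].
  by apply: fresh; rewrite card_ord /= ltnS (leq_trans _ n9).
rewrite !inE !negb_or => /and5P[tu ta0 ta1 tb0 tb1].
have ab i j : pairf a0 a1 i != pairf b0 b1 j := fg i j.
have a0b1 : a0 != b1 := ab 0 1. have a1b1 : a1 != b1 := ab 1 1.
have a0b0 : a0 != b0 := ab 0 0. have a1b0 : a1 != b0 := ab 1 0.
have b1u : b1 != u by rewrite eq_sym.
have b0u : b0 != u by rewrite eq_sym.
(* Among the points carrying D this 3-cycle moves b1 only, so [isolate] leaves two factors that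
   share b0. *)
pose s := cyc3 b1 u t.
have sE := cyc3E b1u tb1 tu.
have sf i : s (f i) = f i.
  rewrite /f /pairf; case: (i == 0); rewrite sE.
    by rewrite (negPf a0b1) [a0 == u]eq_sym (negPf ua0) [a0 == t]eq_sym (negPf ta0).
  by rewrite (negPf a1b1) [a1 == u]eq_sym (negPf ua1) [a1 == t]eq_sym (negPf ta1).
have sg : s \o pairf b0 b1 =1 pairf b0 u.
  move=> i; rewrite /pairf /=; case: (i == 0); rewrite sE ?eqxx //.
  by rewrite (negPf b01) (negPf b0u) [b0 == t]eq_sym (negPf tb0).
have sG : perm_gl F s \in G by apply/aG/cyc3_even.
have := isolate fi gi fg (swap2K g) EG sG sf.
rewrite (embm_ext _ sg) swap2_transvection // => T0.
have TA := ctrans_all n9 aG gg b0u b01 ub1 T0.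
pose D := embm f A *m embm (pairf b0 b1) A.
have DG : mx_in G D.
  split; first by rewrite unitmx_mul !embm_unit //; case/mulmx1_unit: (swap2K g).
  by rewrite to_glM ?embm_unit //; case/mulmx1_unit: (swap2K g).
have [A0 A1 Ao] := evec_swap2 g a01; have [B0 B1 Bo] := evec_swap2 g b01.
have Dout p : p \notin [:: a0; a1; b0; b1] -> evec F p *m D = evec F p.
  by rewrite !inE !negb_or => /and4P[? ? ? ?]; rewrite mulmxA Ao // Bo.
have Db0 : evec F b0 *m D = - evec F b0 by rewrite mulmxA Ao 1?eq_sym // B0.
have Db1 : evec F b1 *m D = g *: evec F b0 + evec F b1 by rewrite mulmxA Ao 1?eq_sym // B1.
have Da0 : evec F a0 *m D = - evec F a0 by rewrite mulmxA A0 mulNmx Bo.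
have Da1 : evec F a1 *m D = g *: evec F a0 + evec F a1.
  by rewrite mulmxA A1 mulmxDl -scalemxAl !Bo.
clearbody D.
(* D negates e_b0, so with T the first transvection D T D T doubles the entry at u and cancels the
   one at b0. The last factor cancels the entry - c g at b1 and adds - c g at u. The resulting 2 - g
   measures how far D is from fixing the all-ones vector. *)
have key c : D *m ctrans t u b0 c *m D *m ctrans t u b0 c *m ctrans t b1 u (c * g) =
    elem u t (c * (2%:R - g)).
  have Du : evec F u *m D = evec F u by apply: Dout; rewrite !inE !negb_or ua0 ua1 ub0.
  have Dt : evec F t *m D = evec F t by apply: Dout; rewrite !inE !negb_or ta0 ta1 tb0.
  have [Cu Cb Co] := row_ctrans c tu tb0 ub0.
  have [C'b C'u C'o] := row_ctrans (c * g) tb1 tu b1u.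
  apply: evec_eq => p; rewrite !mulmxA evec_elem.
  have L := (@mulmxDl F, @mulNmx F).
  have Lz (d : F) (v : 'rV[F]_n.+1) (M : 'M[F]_n.+1) : (d *: v) *m M = d *: (v *m M).
    by rewrite scalemxAl.
  have Ct := Co t tu tb0; have C't := C'o t tb1 tu.
  have [->|pu] := eqVneq p u.
    rewrite !(L, Lz, Du, Dt, Cu, Ct, C'u, C't) mulr1n mulr1.
    by apply/rowP => q; rewrite !mxE; ring.
  rewrite mulr0 scale0r addr0.
  have C'b0 := C'o b0 b01 b0u.
  have [->|pb0] := eqVneq p b0.
    rewrite !(L, Lz, Db0, Dt, Cb, Ct, C'b0, C't).
    by apply/rowP => q; rewrite !mxE; ring.
  have Cb1 : evec F b1 *m ctrans t u b0 c = evec F b1 by rewrite Co // eq_sym.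
  have [->|pb1] := eqVneq p b1.
    rewrite !(L, Lz, Db0, Db1, Dt, Cb, Cb1, Ct, C'b0, C'b, C't).
    by apply/rowP => q; rewrite !mxE; ring.
  have [u0 u1] : a0 != u /\ a1 != u by rewrite ![_ == u]eq_sym.
  have [Ca0 Ca1] := (Co a0 u0 a0b0, Co a1 u1 a1b0).
  have [C'a0 C'a1] := (C'o a0 a0b1 u0, C'o a1 a1b1 u1).
  have [->|pa0] := eqVneq p a0.
    by rewrite !(L, Da0, Ca0, C'a0) opprK.
  have [->|pa1] := eqVneq p a1.
    rewrite !(L, Lz, Da0, Da1, Ca0, Ca1, C'a0, C'a1).
    by apply/rowP => q; rewrite !mxE; ring.
  have Dp : evec F p *m D = evec F p by apply: Dout; rewrite !inE !negb_or pa0 pa1 pb0.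
  by rewrite Dp Co // Dp Co // C'o.
apply: SL_in; apply: (elem_all n9 aG (i0 := u) (l0 := t)); first by rewrite eq_sym.
move=> c; have := key (c / (2%:R - g)); rewrite divfK ?subr_eq0 1?eq_sym // => <-.
have tu' : u != t by rewrite eq_sym.
by apply: mx_inM (mx_inM (mx_inM (mx_inM DG _) DG) _) _; apply: TA.
Qed.

(* In the basis (e0, e1 + g e2, e2) this is a transposition; the sum of the basis vectors
   is fixed. *)
Definition swap3 (F : fieldType) (g : F) : 'M[F]_3 :=
  \matrix_(i, j) (if i == 0 then (if j == 0 then 0 else if j == 1 then 1 else g)
    else if i == 1 then (if j == 0 then 1 else if j == 1 then 0 else - g)
    else if j == 2 then 1 else 0).

Lemma swap3K (F : fieldType) (g : F) : swap3 g *m swap3 g = 1%:M.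
Proof.
apply/matrixP => i j; rewrite !mxE !big_ord_recl big_ord0 !mxE /= addr0.
by case: (i) => [[|[|[|]]]] //= ?; case: (j) => [[|[|[|]]]] //= ?;
  rewrite -?val_eqE /= ?mulr0n ?mulr1n; ring.
Qed.

Definition trif (T : Type) (a b c : T) : 'I_3 -> T :=
  fun i => if i == 0 then a else if i == 1 then b else c.

Lemma trif_inj (T : eqType) (a b c : T) : a != b -> a != c -> b != c -> injective (trif a b c).
Proof.
move=> ab ac bc [[|[|[|]]] //= ?] [[|[|[|]]] //= ?]; rewrite /trif -!val_eqE /= => E; apply: val_inj => //=.
all: by move: ab ac bc; rewrite E ?eqxx.
Qed.

Lemma evec_swap3 (F : fieldType) n (a b c : 'I_n) (g : F) : a != b -> a != c -> b != c ->
  [/\ evec F a *m embm (trif a b c) (swap3 g) = evec F b + g *: evec F c,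
      evec F b *m embm (trif a b c) (swap3 g) = evec F a - g *: evec F c,
      evec F c *m embm (trif a b c) (swap3 g) = evec F c
    & forall p, p != a -> p != b -> p != c -> evec F p *m embm (trif a b c) (swap3 g) = evec F p].
Proof.
move=> ab ac bc; have fi := trif_inj ab ac bc.
split.
- have := evec_embm (swap3 g) 0 fi; rewrite !big_ord_recl big_ord0 !mxE /trif -!val_eqE /= => ->.
  by rewrite scale0r scale1r add0r addr0.
- have := evec_embm (swap3 g) 1 fi; rewrite !big_ord_recl big_ord0 !mxE /trif -!val_eqE /= => ->.
  by rewrite scale0r scale1r scaleNr add0r addr0.
- have := evec_embm (swap3 g) 2 fi; rewrite !big_ord_recl big_ord0 !mxE /trif -!val_eqE /= => ->.
  by rewrite !scale0r scale1r !add0r addr0.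
move=> p pa pb pc; apply: evec_embm_out => i; rewrite /trif.
by case: ifP => _; [rewrite eq_sym | case: ifP => _; rewrite eq_sym].
Qed.

(** For g = 0 the factors are the transpositions (a b) and (u b), whose product is the 3-cycle; the
    terms in g make up the transvection. The 3-cycle is even and can be divided out in the group. *)
Lemma swap3_transvection (F : fieldType) n (a b c u : 'I_n) (g : F) :
  a != b -> a != c -> b != c -> u != a -> u != b -> u != c ->
  embm (trif a b c) (swap3 g) *m embm (trif u b c) (swap3 g) =
  ctrans c u b g *m perm_mx (cyc3 a u b).
Proof.
move=> ab ac bc ua ub uc; have [Aa Ab Ac Ao] := evec_swap3 g ab ac bc.
have [Uu Ub Uc Uo] := evec_swap3 g ub uc bc.
have cb : c != b by rewrite eq_sym.
have cu : c != u by rewrite eq_sym.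
have [Ru Rb Ro] := row_ctrans g cu cb ub.
have au : a != u by rewrite eq_sym.
have ba : b != a by rewrite eq_sym.
have bu : b != u by rewrite eq_sym.
have ca : c != a by rewrite eq_sym.
have sE := cyc3E au ba bu.
have Lz (d : F) (v : 'rV[F]_n) (M : 'M[F]_n) : (d *: v) *m M = d *: (v *m M).
  by rewrite scalemxAl.
have L := (@mulmxDl F, @mulNmx F).
apply: evec_eq => p; rewrite !mulmxA.
have [->|pa] := eqVneq p a.
  by rewrite Aa Ro // evec_perm sE eqxx !(L, Lz, Ub, Uc) subrK.
have [->|pb] := eqVneq p b.
  rewrite Ab Rb !(L, Lz, Uc, evec_perm) !sE eqxx (negPf ba) (negPf bu) (negPf ca) (negPf cu) (negPf cb).
  by rewrite Uo.
have [->|pc] := eqVneq p c.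
  by rewrite Ac Uc Ro // evec_perm sE (negPf ca) (negPf cu) (negPf cb).
rewrite Ao //; have [->|pu] := eqVneq p u.
  rewrite Uu Ru !(L, Lz, evec_perm) !sE eqxx (negPf ua) (negPf ca) (negPf cu) (negPf cb) //.
by rewrite Uo // Ro // evec_perm sE (negPf pa) (negPf pu) (negPf pb).
Qed.

Lemma swap3_ctrans (F : finFieldType) n (G : {group {'GL_n.+1[F]}}) (x y : 'S_n.+1) hs K a0 a1 a2 (g : F) :
  (9 < n)%N -> (13 %| K)%N -> handle_system x y hs -> seed K x y hs ->
  a0 \in hs -> a1 \in hs -> a2 \in hs -> a0 != a1 -> a0 != a2 -> a1 != a2 -> gen_scalar g ->
  (perm_gl F x * emb_gl (trif a0 a1 a2) (swap3 g) * emb_gl (y \o trif a0 a1 a2) (swap3 g) \in G)%g ->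
  perm_gl F y \in G ->
  forall k i j c, k != i -> k != j -> i != j -> mx_in G (ctrans k i j c).
Proof.
move=> n9 K13 S sd h0 h1 h2 a01 a02 a12 gg XG YG; set f := trif a0 a1 a2; set A := swap3 g.
have fi : injective f by apply: trif_inj.
have fh i : f i \in hs by rewrite /f /trif; case: ifP => // _; case: ifP.
have [aG EG] := linear_core (emb_gl_rep n (swap3K g)) K13 S sd fi fh XG YG.
set b0 := y a0; set b1 := y a1; set b2 := y a2.
have gE : y \o f =1 trif b0 b1 b2.
  by move=> i; rewrite /f /trif /=; case: ifP => // _; case: ifP.
have b01 : b0 != b1 by rewrite (inj_eq perm_inj).
have b02 : b0 != b2 by rewrite (inj_eq perm_inj).
have b12 : b1 != b2 by rewrite (inj_eq perm_inj).
have gi : injective (trif b0 b1 b2) by apply: trif_inj.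
have fg i j : f i != trif b0 b1 b2 j.
  by rewrite -gE /= (handle_ya (sys_handle S (fh i)) (sys_handle S (fh j))).
have {}EG : (emb_gl f A * emb_gl (trif b0 b1 b2) A \in G)%g by rewrite -(emb_gl_ext _ gE).
have [u] : exists u, u \notin [:: a0; a1; a2; b0; b1; b2].
  by apply: fresh; rewrite card_ord /= ltnS (leq_trans _ n9).
rewrite !inE !negb_or => /and5P[ua0 ua1 ua2 ub0 /andP[ub1 ub2]].
have [t] : exists t, t \notin [:: u; a0; a1; a2; b0; b1; b2].
  by apply: fresh; rewrite card_ord /= ltnS (leq_trans _ n9).
rewrite !inE !negb_or => /and5P[tu ta0 ta1 ta2 /and3P[tb0 tb1 tb2]].
have b0u : b0 != u by rewrite eq_sym.
pose s := cyc3 b0 u t.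
have sE := cyc3E b0u tb0 tu.
have s_out p : p != b0 -> u != p -> t != p -> s p = p.
  by move=> pb pu pt; rewrite sE (negPf pb) ![p == _]eq_sym (negPf pu) (negPf pt).
have ab i : f i != b0 := fg i 0.
have sf i : s (f i) = f i.
  apply: s_out; first exact: ab.
    by rewrite /f /trif; case: (i == 0) => //; case: (i == 1).
  by rewrite /f /trif; case: (i == 0) => //; case: (i == 1).
have sg : s \o trif b0 b1 b2 =1 trif u b1 b2.
  move=> i; rewrite /trif /=; case: (i == 0); first by rewrite sE eqxx.
  by case: (i == 1); apply: s_out => //; rewrite eq_sym.
have sG : perm_gl F s \in G by apply/aG/cyc3_even.
have := isolate fi gi fg (swap3K g) EG sG sf.
rewrite (embm_ext _ sg) swap3_transvection // => T0.
have b10 : b1 != b0 by rewrite eq_sym.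
have T1 : mx_in G (ctrans b2 u b1 g).
  have pG : mx_in G (perm_mx (cyc3 b0 u b1)).
    by split; [rewrite unitmx_perm | apply/aG/cyc3_even].
  have pV : mx_in G (perm_mx (cyc3 b0 u b1)^-1).
    by apply: mx_inV pG _; rewrite -perm_mxM mulgV perm_mx1.
  have := mx_inM T0 pV.
  by rewrite -mulmxA -perm_mxM mulgV perm_mx1 mulmx1.
by apply: (ctrans_all n9 aG gg _ _ _ T1); rewrite // eq_sym.
Qed.

(** * The quotient by the all-ones vector *)

Definition onesv (F : fieldType) n : 'rV[F]_n := const_mx 1.

Lemma onesvE (F : fieldType) n : onesv F n = \sum_p evec F p.
Proof.
apply/rowP => q; rewrite mxE summxE (bigD1 q) //= big1 => [|p pq]; rewrite !mxE ?eqxx ?addr0 //.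
by rewrite eq_sym (negPf pq).
Qed.

Lemma onesv_perm (F : fieldType) n (s : 'S_n) : onesv F n *m perm_mx s = onesv F n.
Proof.
rewrite !onesvE mulmx_suml (eq_bigr (fun p => evec F (s p))) => [|p _]; last exact: evec_perm.
by rewrite [RHS](reindex_inj (@perm_inj _ s)).
Qed.

Lemma onesv_embm (F : fieldType) m n (f : 'I_m -> 'I_n) (A : 'M[F]_m) :
  onesv F m *m A = onesv F m -> onesv F n *m embm f A = onesv F n.
Proof.
move=> h; rewrite /embm mulmxDr mulmx1 !mulmxA.
have -> : onesv F n *m (selm F f)^T = onesv F m.
  apply/rowP => i; rewrite !mxE (bigD1 (f i)) //= big1 => [|p pf]; rewrite !mxE ?eqxx ?mul1r ?addr0 //.
  by rewrite eq_sym (negPf pf).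
by rewrite mulmxBr h mulmx1 subrr mul0mx addr0.
Qed.

Lemma onesv_swap3 (F : fieldType) (g : F) : onesv F 3 *m swap3 g = onesv F 3.
Proof.
apply/rowP => i; rewrite !mxE !big_ord_recl big_ord0 !mxE.
by case: i => [[|[|[|]]]] //= ?; rewrite -?val_eqE /=; ring.
Qed.

(* quoV is the projection along the all-ones vector, written in the images of all basis
   vectors but the first; quoU is a section of it. *)
Definition quoU (F : fieldType) n : 'M[F]_(n, n.+1) := \matrix_(i, j) (lift ord0 i == j)%:R.
Definition quoV (F : fieldType) n : 'M[F]_(n.+1, n) :=
  \matrix_(j, i) (if j == ord0 then - 1 else (lift ord0 i == j)%:R).
Definition quomx (F : fieldType) n (X : 'M[F]_n.+1) : 'M[F]_n := quoU F n *m X *m quoV F n.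

Lemma evec_quoU (F : fieldType) n (i : 'I_n) : evec F i *m quoU F n = evec F (lift ord0 i).
Proof. by rewrite -rowE; apply/rowP => q; rewrite !mxE eqxx /= eq_sym. Qed.

Lemma evec_quoV (F : fieldType) n (i : 'I_n) : evec F (lift ord0 i) *m quoV F n = evec F i.
Proof.
by rewrite -rowE; apply/rowP => q; rewrite !mxE eqxx /= (inj_eq lift_inj).
Qed.

Lemma evec_quoV0 (F : fieldType) n : evec F (ord0 : 'I_n.+1) *m quoV F n = - onesv F n.
Proof. by rewrite -rowE; apply/rowP => q; rewrite !mxE eqxx. Qed.

Lemma quoUV (F : fieldType) n : quoU F n *m quoV F n = 1%:M.
Proof. by apply: evec_eq => p; rewrite mulmxA evec_quoU evec_quoV mulmx1. Qed.

Lemma onesv_quoV (F : fieldType) n : onesv F n.+1 *m quoV F n = 0.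
Proof.
rewrite onesvE mulmx_suml big_ord_recl /= evec_quoV0.
by rewrite (eq_bigr (fun p => evec F p)) => [|p _]; rewrite ?evec_quoV // -onesvE addNr.
Qed.

Lemma quoVU (F : fieldType) n :
  quoV F n *m quoU F n = 1%:M - (delta_mx ord0 0 : 'cV[F]_n.+1) *m onesv F n.+1.
Proof.
apply: evec_eq => p; rewrite mulmxBr mulmx1 !mulmxA.
have [i ->|->] := unliftP ord0 p.
  rewrite evec_quoV evec_quoU /evec mul_delta_mx_0 ?mul0mx ?subr0 //.
rewrite evec_quoV0 mulNmx [in RHS]/evec mul_delta_mx onesvE mulmx_suml.
have -> : delta_mx 0 0 = 1%:M :> 'M[F]_1 by apply/matrixP => i j; rewrite !mxE !ord1.
rewrite mul1mx onesvE big_ord_recl /= opprD addrA subrr add0r; congr (- _).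
by apply: eq_bigr => i _; rewrite evec_quoU.
Qed.

(** The product V U differs from 1 by a column times the all-ones vector, which X fixes and V kills.
    Hence V intertwines X with its quotient. *)
Lemma quoV_act (F : fieldType) n (X : 'M[F]_n.+1) :
  onesv F n.+1 *m X = onesv F n.+1 -> quoV F n *m quomx X = X *m quoV F n.
Proof.
move=> h; rewrite /quomx !mulmxA quoVU mulmxBl mul1mx -!mulmxA h mulmxBl -!mulmxA.
by rewrite onesv_quoV mulmx0 subr0.
Qed.

Lemma quomxM (F : fieldType) n (X Y : 'M[F]_n.+1) :
  onesv F n.+1 *m Y = onesv F n.+1 -> quomx (X *m Y) = quomx X *m quomx Y.
Proof. by move=> h; rewrite [in LHS]/quomx mulmxA -mulmxA -quoV_act // mulmxA. Qed.

Lemma quomx1 (F : fieldType) n : quomx 1%:M = 1%:M :> 'M[F]_n.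
Proof. by rewrite /quomx mulmx1 quoUV. Qed.

Lemma onesv_inv (F : fieldType) n (X : 'M[F]_n.+1) : X \in unitmx ->
  onesv F n.+1 *m X = onesv F n.+1 -> onesv F n.+1 *m invmx X = onesv F n.+1.
Proof. by move=> Xu h; rewrite -{1}h mulmxK. Qed.

Lemma quomx_unit (F : fieldType) n (X : 'M[F]_n.+1) : X \in unitmx ->
  onesv F n.+1 *m X = onesv F n.+1 -> quomx X \in unitmx.
Proof.
move=> Xu h; have := quomxM X (onesv_inv Xu h); rewrite mulmxV // quomx1.
by move/esym/mulmx1_unit => [].
Qed.

(** The section avoids the first basis vector, so the term at [ord0] disappears: a transvection
    fixing the all-ones vector becomes an elementary matrix. *)
Lemma quomx_ctrans (F : fieldType) n (k i : 'I_n) (c : F) :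
  quomx (ctrans (lift ord0 k) (lift ord0 i) ord0 c) = elem i k c.
Proof.
apply: evec_eq => p; rewrite /quomx !mulmxA evec_quoU evec_ctrans evec_elem.
rewrite [lift _ _ == ord0]eq_sym (negPf (neq_lift _ _)) subr0 (inj_eq lift_inj).
by rewrite mulmxDl -scalemxAl !evec_quoV.
Qed.

Lemma quotient_SL (F : finFieldType) n (G : {group {'GL_n.+1[F]}}) (X Y : 'M[F]_n.+2) :
  X \in unitmx -> Y \in unitmx ->
  onesv F n.+2 *m X = onesv F n.+2 -> onesv F n.+2 *m Y = onesv F n.+2 ->
  to_gl (quomx X) \in G -> to_gl (quomx Y) \in G ->
  (forall H : {group {'GL_n.+2[F]}}, to_gl X \in H -> to_gl Y \in H ->
     forall k i j c, k != i -> k != j -> i != j -> mx_in H (ctrans k i j c)) ->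
  forall u : {'GL_n.+1[F]}, \det (GLval u) = 1 -> u \in G.
Proof.
move=> Xu Yu oX oY XG YG hyp.
(* The preimage of G in the stabiliser of the all-ones vector. *)
pose H := [set u : {'GL_n.+2[F]} |
  (onesv F n.+2 *m GLval u == onesv F n.+2) && (to_gl (quomx (GLval u)) \in G)].
have Hg : group_set H.
  apply/group_setP; split=> [|u v].
    rewrite inE GL_1E mulmx1 eqxx /=.
    have -> : quomx (1 : 'M[F]_n.+2) = 1%:M by rewrite quomx1.
    by case: (mx_in1 G).
  rewrite !inE => /andP[/eqP ou uG] /andP[/eqP ov vG].
  have gu (w : {'GL_n.+2[F]}) : GLval w \in unitmx := valP w.
  by rewrite GL_MxE mulmxA ou ov eqxx quomxM // to_glM ?groupM // quomx_unit //; apply: gu.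
have mem M : M \in unitmx -> onesv F n.+2 *m M = onesv F n.+2 -> to_gl (quomx M) \in G ->
    to_gl M \in Group Hg.
  by move=> Mu oM MG; rewrite inE to_glE // oM eqxx.
apply: SL_in => i l c il.
have l0 (k : 'I_n.+1) : lift ord0 k != ord0 by rewrite eq_sym neq_lift.
have li : lift ord0 l != lift ord0 i by rewrite (inj_eq lift_inj) eq_sym.
have [] := hyp (Group Hg) (mem _ Xu oX XG) (mem _ Yu oY YG) _ _ ord0 c li (l0 l) (l0 i).
set M := ctrans _ _ _ _ => Mu; rewrite inE to_glE // => /andP[/eqP oM MG].
by rewrite -quomx_ctrans; split=> //; apply: quomx_unit.
Qed.

End Transvections.

(** * Ranks of elements *)

(** Orbits have 1 or p points, so each orbit O contributes p = #|O| + (p - 1) [#|O| = 1]. *)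
Lemma card_porbits_prime (T : finType) (s : {perm T}) p : prime p -> s ^+ p = 1 ->
  (p * #|porbits s| = #|T| + p.-1 * fixn s)%N.
Proof.
move=> pp sp; have pd x : #|porbit s x| = 1%N \/ #|porbit s x| = p.
  have : #|porbit s x| %| p.
    rewrite porbitE; apply: dvdn_trans (dvdn_orbit _ _ _) _.
    by rewrite -orderE order_dvdn sp.
  by case/primeP: pp => _ h /h /orP[] /eqP; [left | right].
have sumT : (\sum_(O in porbits s) #|O| = #|T|)%N.
  have e : porbits s = orbit 'P <[s]> @: setT.
    apply/setP => O; apply/imsetP/imsetP => -[x _ ->]; by exists x; rewrite ?inE ?porbitE.
  rewrite e acts_sum_card_orbit ?cardsT //.
  by apply/subsetP => g _; rewrite !inE; apply/subsetP => x _; rewrite inE.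
have fx : (\sum_(O in porbits s) (#|O| == 1%N) = fixn s)%N.
  rewrite -big_mkcondr /= sum1_card /fixn -(card_in_imset (f := porbit s)).
    apply: eq_card => O; apply/andP/imsetP => [[/imsetP[x _ ->] h]|[x]].
      exists x => //; rewrite inE; case/cards1P: h => y h.
      have := porbit_id s x; have := mem_porbit s 1 x; rewrite expg1 h !inE => /eqP-> /eqP->.
      by [].
    rewrite inE => /eqP sx ->; split; first exact: imset_f.
    apply/cards1P; exists x; apply/setP => y; rewrite inE; apply/idP/eqP => [|->]; last exact: porbit_id.
    case/porbitP => i ->; elim: i => [|i IH]; first by rewrite perm1.
    by rewrite expgSr permM IH.
  move=> x y; rewrite !inE => /eqP sx /eqP sy e.
  have := porbit_id s x; rewrite e => /porbitP[i ->].
  by elim: i => [|i IH]; rewrite ?perm1 // expgSr permM IH.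
rewrite -sumT -fx -sum1_card !big_distrr -big_split /=; apply: eq_bigr => O /imsetP[x _ ->].
rewrite muln1; case: (pd x) => ->; first by rewrite eqxx muln1 add1n prednK ?prime_gt0.
by case: eqP pp => [->|]; rewrite // muln0 addn0.
Qed.

Section PermutationRank.
Local Open Scope ring_scope.

Lemma porbits_reps n (s : 'S_n) : exists r : 'I_#|porbits s| -> 'I_n,
  (forall i j, (r i \in porbit s (r j)) = (i == j)) /\
  forall p, exists i, r i \in porbit s p.
Proof.
have h (i : 'I_#|porbits s|) : exists x, enum_val i = porbit s x.
  by have /imsetP[x _ e] := enum_valP i; exists x.
have [r rE] := fin_all_exists h.
exists r; split=> [i j|p].
  by rewrite -eq_porbit_mem -!rE (inj_eq enum_val_inj).
have pO : porbit s p \in porbits s by apply: imset_f.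
exists (enum_rank_in pO (porbit s p)).
by rewrite -eq_porbit_mem -rE enum_rankK_in.
Qed.

(** The indicator vectors of the orbits are fixed, and representatives of the orbits show that they
    are independent. *)
Lemma mxrank_perm_le (F : fieldType) n (s : 'S_n) :
  (\rank (perm_mx s - 1%:M : 'M[F]_n)%R <= n - #|porbits s|)%N.
Proof.
have [r [rE rS]] := porbits_reps s.
pose B : 'M[F]_(#|porbits s|, n) := \matrix_(i, q) (q \in porbit s (r i))%:R.
have BS : B *m (selm F r)^T = 1%:M.
  apply/matrixP => i j; rewrite !mxE (bigD1 (r j)) //= big1 => [|q qr]; rewrite !mxE ?eqxx.
    by rewrite rE addr0 mulr1 eq_sym.
  by rewrite eq_sym (negPf qr) mulr0.
have BP : B *m (perm_mx s - 1%:M) = 0.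
  rewrite mulmxBr mulmx1; apply/eqP; rewrite subr_eq0; apply/eqP.
  have -> : perm_mx s = perm_mx (s^-1)^-1 :> 'M[F]_n by rewrite invgK.
  rewrite -col_permE; apply/matrixP => i q; rewrite !mxE.
  by rewrite -!eq_porbit_mem -(porbit_perm s 1 (_ q)) expg1 permKV.
have rB : \rank B = #|porbits s|.
  by apply/eqP/row_freeP; exists (selm F r)^T.
have le : (\rank B <= \rank (kermx (perm_mx s - 1%:M : 'M[F]_n)%R))%N by apply/mxrankS/sub_kermxP.
rewrite mxrank_ker rB in le.
have := rank_leq_row (perm_mx s - 1%:M : 'M[F]_n); move: le; set k := \rank _ => le kn.
by rewrite leq_subRL 1?addnC -?leq_subRL // (leq_trans le) ?leq_subr.
Qed.

(* An eigenvector of a permutation is determined by its values on representatives of the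
   orbits. *)
Lemma mxrank_perm_ge (F : fieldType) n (s : 'S_n) (a : F) :
  (n - #|porbits s| <= \rank (perm_mx s - a%:M)%R)%N.
Proof.
have [r [rE rS]] := porbits_reps s.
set M := perm_mx s - a%:M; set K := kermx M.
have inj (v : 'rV[F]_n) : (v <= K)%MS -> v *m (selm F r)^T = 0 -> v = 0.
  move=> /sub_kermxP; rewrite /M mulmxBr mul_mx_scalar => /eqP; rewrite subr_eq0 => /eqP vP v0.
  have step p : v 0 p = a * v 0 (s p).
    have := congr1 (fun w : 'rV[F]_n => w 0 (s p)) vP; rewrite !mxE => <-.
    rewrite (bigD1 p) //= big1 => [|q qp]; rewrite !mxE ?eqxx ?mulr1 ?addr0 //.
    by rewrite (inj_eq perm_inj) (negPf qp) mulr0.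
  have steps i p : v 0 p = a ^+ i * v 0 ((s ^+ i)%g p).
    elim: i => [|i IH]; first by rewrite expr0 mul1r expg0 perm1.
    by rewrite IH step exprSr mulrA expgSr permM.
  have vr i : v 0 (r i) = 0.
    have := congr1 (fun w : 'rV[F]_#|porbits s| => w 0 i) v0; rewrite !mxE => <-.
    rewrite (bigD1 (r i)) //= big1 => [|q qp]; rewrite !mxE ?eqxx ?mulr1 ?addr0 //.
    by rewrite eq_sym (negPf qp) mulr0.
  apply/rowP => p; have [i /porbitP[k kE]] := rS p.
  by rewrite mxE (steps k) -kE vr mulr0.
have cap : \rank (K :&: kermx (selm F r)^T)%MS = 0%N.
  apply/eqP; rewrite mxrank_eq0; apply/eqP/row_matrixP => i; rewrite row0.
  have := row_sub i (K :&: kermx (selm F r)^T)%MS; rewrite sub_capmx => /andP[vK /sub_kermxP v0].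
  exact: inj.
have := mxrank_mul_ker K (selm F r)^T; rewrite cap addn0 => e.
have := rank_leq_col (K *m (selm F r)^T); rewrite e /K mxrank_ker => h.
by rewrite leq_subLR addnC -leq_subLR.
Qed.

End PermutationRank.

(** A nontrivial power of an element of prime order generates the same cyclic group. *)
Lemma fixn_expg (T : finType) (s : {perm T}) p i :
  prime p -> s ^+ p = 1 -> s ^+ i != 1 -> fixn (s ^+ i) = fixn s.
Proof.
move=> pp sp si; have fixX (u : {perm T}) x k : u x = x -> (u ^+ k) x = x.
  by move=> ux; elim: k => [|k IH]; rewrite ?perm1 // expgS permM ux.
have ip : coprime i p.
  rewrite coprime_sym prime_coprime //; apply: contra si => /dvdnP[k ->].
  by rewrite mulnC expgM sp expg1n.
have i0 : (0 < i)%N by case: i si {ip}; rewrite ?eqxx.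
have [k kE] : exists k, (s ^+ i) ^+ k = s.
  have [k l e _] := egcdnP p i0; exists k; rewrite -expgM mulnC e (eqP ip) addn1 expgSr.
  by rewrite mulnC expgM sp expg1n mul1g.
rewrite /fixn; apply: eq_card => x; rewrite !inE; apply/eqP/eqP => [h|]; last exact: fixX.
by rewrite -{1}kE; apply: fixX.
Qed.

(* The factor p keeps the bounds integral: they are (p - 1)(n - #fixed points). *)
Definition rank_range (F : finFieldType) n p (g : {'GL_n.+1[F]}) (lo hi : nat) : Prop :=
  forall i, g ^+ i != 1 ->
    (p * \rank (GLval (g ^+ i) - 1%:M)%R <= hi)%N /\
    forall a : F, (lo <= p * \rank (GLval (g ^+ i) - a%:M)%R)%N.

Lemma perm_glX (F : finFieldType) n (s : 'S_n.+1) i : perm_gl F s ^+ i = perm_gl F (s ^+ i).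
Proof. by elim: i => [|i IH]; rewrite ?perm_gl1 // !expgS IH perm_glM. Qed.

Lemma rank_range_perm (F : finFieldType) n p (s : 'S_n.+1) c :
  prime p -> s ^+ p = 1 -> (c = p.-1 * (n.+1 - fixn s))%N -> rank_range p (perm_gl F s) c c.
Proof.
move=> pp sp -> i; rewrite perm_glX => si.
have {}si : s ^+ i != 1 by apply: contra si => /eqP ->; rewrite perm_gl1.
have sip : (s ^+ i) ^+ p = 1 by rewrite -expgM mulnC expgM sp expg1n.
have := card_porbits_prime pp sip; rewrite (fixn_expg pp sp si) card_ord => e.
have -> : (p.-1 * (n.+1 - fixn s) = p * (n.+1 - #|porbits (s ^+ i)|))%N.
  rewrite !mulnBr e -{3}(prednK (prime_gt0 pp)) mulSn subnDl //.
rewrite [GLval _]to_glE ?unitmx_perm //; split=> [|a]; rewrite leq_mul2l.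
  by rewrite mxrank_perm_le orbT.
by rewrite mxrank_perm_ge orbT.
Qed.

Lemma GLval_conj_scalar (F : finFieldType) n (g h : {'GL_n.+1[F]}) (a : F) :
  (GLval (g ^ h) - a%:M = invmx (GLval h) *m (GLval g - a%:M) *m GLval h)%R.
Proof.
have hu : GLval h \in unitmx := valP h.
rewrite conjgE !GL_MxE GL_VxE mulmxBr mulmxBl mulmxA; congr (_ - _)%R.
by rewrite mul_mx_scalar -scalemxAl mulVmx // scalemx1.
Qed.

Lemma rank_conj (F : finFieldType) n (g h : {'GL_n.+1[F]}) (a : F) :
  (\rank (GLval (g ^ h) - a%:M)%R = \rank (GLval g - a%:M)%R)%N.
Proof.
have hu : GLval h \in unitmx := valP h.
by rewrite GLval_conj_scalar mxrankMfree ?row_free_unit // eqmxMfull ?row_full_unit ?unitmx_inv.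
Qed.

Lemma rank_rangeJ (F : finFieldType) n p (g h : {'GL_n.+1[F]}) lo hi :
  rank_range p g lo hi -> rank_range p (g ^ h) lo hi.
Proof.
move=> H i; rewrite -conjXg conjg_eq1 => /H[h1 h2].
by rewrite rank_conj; split=> // a; rewrite rank_conj.
Qed.

(** Conjugacy up to the scalar a matches the eigenvalue a b on one side with b on the other. The
    upper bound at eigenvalue 1 on the side of smaller rank contradicts the lower bound, valid at
    every scalar, on the other side. *)
Lemma rank_separated (F : finFieldType) n p (g1 g2 h : {'GL_n.+1[F]}) lo1 hi1 lo2 hi2 i j (a : F) :
  (hi1 < lo2)%N || (hi2 < lo1)%N -> rank_range p g1 lo1 hi1 -> rank_range p g2 lo2 hi2 ->
  a != 0%R -> g1 ^+ i != 1 -> g2 ^+ j != 1 ->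
  GLval ((g1 ^+ i) ^ h) <> (a *: GLval (g2 ^+ j))%R.
Proof.
move=> sep R1 R2 a0 /R1[h1 l1] /R2[h2 l2] e.
have r b : (\rank (GLval (g1 ^+ i) - (a * b)%:M)%R = \rank (GLval (g2 ^+ j) - b%:M)%R)%N.
  rewrite -(rank_conj _ h) e -[X in (_ - X)%R]scalemx1 -scalerA -scalerBr scalemx1.
  by rewrite eqmx_scale.
case/orP: sep => sep.
  have := leq_trans (leq_ltn_trans h1 sep) (l2 (a^-1)%R).
  by rewrite -r mulfV // ltnn.
have := leq_trans (leq_ltn_trans h2 sep) (l1 (a * 1)%R).
by rewrite r ltnn.
Qed.

(** The projection has a kernel of dimension at most one, so each rank drops by at most 1 and never
    grows; the factor p turns this into the loss p. *)
Lemma rank_range_quo (F : finFieldType) n p (u : {'GL_n.+2[F]}) lo hi :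
  (onesv F n.+2 *m GLval u = onesv F n.+2)%R ->
  rank_range p u lo hi -> rank_range p (to_gl (quomx (GLval u))) (lo - p) hi.
Proof.
move=> ou R i.
have vu (w : {'GL_n.+2[F]}) : GLval w \in unitmx := valP w.
have [ui ue] : (onesv F n.+2 *m GLval (u ^+ i) = onesv F n.+2)%R /\
    to_gl (quomx (GLval u)) ^+ i = to_gl (quomx (GLval (u ^+ i))).
  elim: i => [|i [IH1 IH2]].
    rewrite !expg0 GL_1E mulmx1; split=> //.
    by rewrite quomx1; apply: val_inj; rewrite [RHS]to_glE ?unitmx1.
  rewrite !expgS GL_MxE mulmxA ou; split=> //.
  by rewrite IH2 quomxM // to_glM // quomx_unit.
rewrite ue => gi; have ui1 : u ^+ i != 1.
  apply: contra gi => /eqP ->; rewrite GL_1E quomx1.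
  by apply/eqP/val_inj; rewrite [LHS]to_glE ?unitmx1.
have [h1 h2] := R i ui1; set M := GLval (u ^+ i) in ui h1 h2 *.
have Mu : M \in unitmx by apply: vu.
have qa (a : F) : (quomx M - a%:M = quoU F n.+1 *m (M - a%:M) *m quoV F n.+1)%R.
  by rewrite /quomx mulmxBr mulmxBl mul_mx_scalar -scalemxAl quoUV scalemx1.
rewrite to_glE ?quomx_unit //; split=> [|a].
  apply: leq_trans h1; rewrite leq_mul2l qa.
  by rewrite (leq_trans (mxrankM_maxl _ _)) ?mxrankM_maxr ?orbT.
rewrite leq_subLR; apply: leq_trans (h2 a) _; rewrite -mulnS leq_mul2l; apply/orP; right.
rewrite -(mxrank_mul_ker (M - a%:M)%R (quoV F n.+1)).
have -> : ((M - a%:M) *m quoV F n.+1 = quoV F n.+1 *m (quomx M - a%:M))%R.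
  by rewrite mulmxBl mulmxBr quoV_act // mul_mx_scalar mul_scalar_mx.
have kV : (\rank (kermx (quoV F n.+1)) <= 1)%N.
  rewrite mxrank_ker; have := congr1 (@mxrank F _ _) (quoUV F n.+1); rewrite mxrank1 => e.
  have := mxrankM_maxr (quoU F n.+1) (quoV F n.+1); rewrite e => e'.
  by rewrite leq_subLR addn1 ltnS.
have cap := mxrankS (capmxSr (M - a%:M)%R (kermx (quoV F n.+1))).
by have := leq_add (mxrankM_maxr (quoV F n.+1) (quomx M - a%:M)%R) (leq_trans cap kV); rewrite addn1.
Qed.

(** * Hurwitz triples and their quotients *)

Lemma expg_coprime1 (gT : finGroupType) (x : gT) m n :
  coprime m n -> x ^+ m = 1 -> x ^+ n = 1 -> x = 1.
Proof.
move=> mn /eqP xm /eqP xn; apply/eqP; rewrite -order_eq1 -dvdn1 -(eqP mn).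
by rewrite dvdn_gcd !order_dvdn xm xn.
Qed.

Lemma gen_abelian2 (gT : finGroupType) (G : {group gT}) (A : {set gT}) :
  <<A>> = G -> (forall u v, u \in A -> v \in A -> commute u v) -> abelian G.
Proof.
move=> <- c; rewrite /abelian gen_subG centsC gen_subG; apply/subsetP => u uA.
by apply/centP => v vA; apply: c.
Qed.

(** If one member of the triple were central, two generators would commute and G would be abelian.
    This gives the exact orders, also modulo the centre. *)
Lemma hurwitz_noncentral (gT : finGroupType) (G : {group gT}) x y z :
  ~~ abelian G -> <<[set x; y; z]>> = G -> x * y * z = 1 ->
  [/\ x \notin 'Z(G), y \notin 'Z(G) & z \notin 'Z(G)].
Proof.
move=> nG gG xyz; have inGen u : u \in [set x; y; z] -> u \in G.
  by rewrite -gG => h; apply: mem_gen.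
have xG : x \in G by apply: inGen; rewrite !inE eqxx.
have yG : y \in G by apply: inGen; rewrite !inE eqxx orbT.
have zG : z \in G by apply: inGen; rewrite !inE eqxx orbT.
have zE : z = (x * y)^-1 by apply: (mulgI (x * y)); rewrite xyz mulgV.
have two : commute x y -> abelian G.
  move=> xy; apply: (gen_abelian2 gG).
  have xz : commute x z by rewrite zE; apply/commuteV/commuteM => //; apply: commute_refl.
  have yz : commute y z by rewrite zE; apply/commuteV/commuteM; [apply: commute_sym | apply: commute_refl].
  move=> u v; rewrite !inE => /orP[/orP[]|] /eqP-> /orP[/orP[]|] /eqP->;
    by [apply: commute_refl | | apply: commute_sym].
have zc u v : u \in 'Z(G) -> v \in G -> commute u v.
  by move=> /centerP[_ c] /c.
split; apply: contra nG => h; apply: two.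
- exact: zc.
- by apply: commute_sym; apply: zc.
- have -> : y = x^-1 * z^-1 by apply: (mulgI x); rewrite mulKVg zE invgK.
  apply: commuteM; first exact/commuteV/commute_refl.
  by apply/commuteV/commute_sym/zc.
Qed.

Lemma hurwitz_intro (gT : finGroupType) (G : {group gT}) x y z :
  ~~ abelian G -> <<[set x; y; z]>> = G -> x ^+ 2 = 1 -> y ^+ 3 = 1 -> z ^+ 7 = 1 ->
  x * y * z = 1 -> hurwitz_triple G x y z.
Proof.
move=> nG gG x2 y3 z7 xyz; have [nx ny nz] := hurwitz_noncentral nG gG xyz.
have ord u p : u \notin 'Z(G) -> prime p -> u ^+ p = 1 -> #[u] = p.
  move=> nu pp up; apply: nt_prime_order => //.
  by apply: contraNneq nu => ->; apply: group1.
split=> //; last by split; apply: ord.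
by split; rewrite -gG mem_gen // !inE eqxx ?orbT.
Qed.

Lemma hurwitz_quotient (gT : finGroupType) (G : {group gT}) x y z :
  ~~ abelian G -> hurwitz_triple G x y z ->
  hurwitz_triple (G / 'Z(G)) (coset 'Z(G) x) (coset 'Z(G) y) (coset 'Z(G) z).
Proof.
move=> nG [[xG yG zG] [ox oy oz] xyz gG].
have nZ : G \subset 'N('Z(G)) by apply/normal_norm/center_normal.
have [nx ny nz] := hurwitz_noncentral nG gG xyz.
have ord u p : u \in G -> u \notin 'Z(G) -> prime p -> #[u] = p -> #[coset 'Z(G) u] = p.
  move=> uG nu pp up; apply: nt_prime_order => //.
    by rewrite -morphX ?(subsetP nZ) // -up expg_order morph1.
  by apply: contra nu => /eqP e; rewrite coset_idr // (subsetP nZ).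
split.
- by split; apply: mem_quotient.
- by split; apply: ord.
- by rewrite -!morphM ?groupM ?(subsetP nZ) // xyz morph1.
have := congr1 (fun A : {set gT} => A / 'Z(G)) gG; rewrite quotient_gen.
  by move=> /= <-; rewrite !quotientU !quotient_set1 ?(subsetP nZ).
by rewrite !subUset !sub1set ?(subsetP nZ).
Qed.

(** Nontrivial powers of elements of different prime orders are never conjugate, so only
    corresponding members need to be compared. *)
Lemma dhb_intro (gT : finGroupType) (G : {group gT}) x1 y1 z1 x2 y2 z2 :
  hurwitz_triple G x1 y1 z1 -> hurwitz_triple G x2 y2 z2 ->
  (forall a b, (a, b) \in [:: (x1, x2); (y1, y2); (z1, z2)] ->
     forall g i j, g \in G -> a ^+ i != 1 -> (a ^+ i) ^ g <> b ^+ j) ->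
  doubly_hurwitz_beauville G.
Proof.
move=> H1 H2 sep; exists x1, y1, z1, x2, y2, z2; split=> // a b g i j.
case: H1 => _ [ox1 oy1 oz1] _ _; case: H2 => _ [ox2 oy2 oz2] _ _.
have mixed p q u v : prime p -> prime q -> p != q -> #[u] = p -> #[v] = q ->
    u ^+ i != 1 -> (u ^+ i) ^ g <> v ^+ j.
  move=> pp pq npq ou ov ui e.
  have o1 : ((u ^+ i) ^ g) ^+ p = 1 by rewrite -conjXg -expgM mulnC expgM -ou expg_order expg1n conj1g.
  have o2 : ((u ^+ i) ^ g) ^+ q = 1 by rewrite e -expgM mulnC expgM -ov expg_order expg1n.
  have cpq : coprime p q by rewrite prime_coprime // dvdn_prime2.
  have := expg_coprime1 cpq o1 o2; move/eqP; rewrite conjg_eq1; exact/negP.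
rewrite !inE => /orP[/orP[]|] /eqP-> /orP[/orP[]|] /eqP-> gG ui.
1,5,9: by apply: sep => //; rewrite !inE eqxx ?orbT.
- exact: (mixed 2 3).
- exact: (mixed 2 7).
- exact: (mixed 3 2).
- exact: (mixed 3 7).
- exact: (mixed 7 2).
- exact: (mixed 7 3).
Qed.

(** Conjugacy in the quotient lifts to conjugacy up to a central factor u; u = 1 covers G itself. *)
Lemma dhb_both (gT : finGroupType) (G : {group gT}) x1 y1 z1 x2 y2 z2 :
  ~~ abelian G -> hurwitz_triple G x1 y1 z1 -> hurwitz_triple G x2 y2 z2 ->
  (forall a b, (a, b) \in [:: (x1, x2); (y1, y2); (z1, z2)] ->
     forall g i j u, g \in G -> u \in 'Z(G) -> a ^+ i != 1 -> b ^+ j != 1 ->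
     (a ^+ i) ^ g <> u * b ^+ j) ->
  doubly_hurwitz_beauville G /\ doubly_hurwitz_beauville (G / 'Z(G)).
Proof.
move=> nG H1 H2 sep; split.
  apply: (dhb_intro H1 H2) => a b ab g i j gG ai e.
  apply: (sep a b ab g i j 1 gG (group1 _) ai); last by rewrite mul1g.
  by rewrite -e conjg_eq1.
have nZ : G \subset 'N('Z(G)) by apply/normal_norm/center_normal.
apply: (dhb_intro (hurwitz_quotient nG H1) (hurwitz_quotient nG H2)) => a' b' ab' gb i j gG ai e.
have [a [b [ab aE bE]]] : exists a b, [/\ (a, b) \in [:: (x1, x2); (y1, y2); (z1, z2)],
    a' = coset 'Z(G) a & b' = coset 'Z(G) b].
  move: ab'; rewrite !inE => /or3P[] /eqP[-> ->].
  - by exists x1, x2; rewrite !inE eqxx.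
  - by exists y1, y2; rewrite !inE eqxx ?orbT.
  - by exists z1, z2; rewrite !inE eqxx ?orbT.
have [aG bG] : a \in G /\ b \in G.
  case: H1 => -[? ? ?] _ _ _; case: H2 => -[? ? ?] _ _ _.
  by move: ab; rewrite !inE => /or3P[] /eqP[-> ->].
have [g _ gG' gE] := morphimP gG; rewrite gE in e.
have nN c : c \in G -> c \in 'N('Z(G)) by apply: (subsetP nZ).
have e' : coset 'Z(G) ((a ^+ i) ^ g) = coset 'Z(G) (b ^+ j).
  by rewrite morphJ ?morphX ?groupX ?nN //; move: e; rewrite aE bE.
have [||u uZ uE] := kercoset_rcoset _ _ e'; first by rewrite groupJ ?groupX ?nN.
  by rewrite groupX ?nN.
have ai' : a ^+ i != 1.
  by apply: contra ai => /eqP ai; rewrite aE -morphX ?nN // ai morph1.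
apply: (sep a b ab g i j u gG' uZ ai' _ uE).
apply: contra ai => /eqP bj; rewrite -(conjg_eq1 _ (coset 'Z(G) g)) e bE -morphX ?nN // bj.
by rewrite morph1.
Qed.

(** Commuting with the elementary matrices means commuting with every off-diagonal matrix unit. *)
Lemma center_SL_scalar (F : finFieldType) n (u : {'GL_n.+1[F]}) :
  u \in 'Z(SLgroup n.+1 F) -> exists2 a : F, a != 0%R & GLval u = (a%:M)%R.
Proof.
case/centerP => _ cu.
have c (i j : 'I_n.+1) : i != j -> (GLval u *m delta_mx i j = delta_mx i j *m GLval u)%R.
  move=> ij; have d1 : (\det (elem i j (1 : F)) = 1)%R by apply: det_elem.
  have eu : elem i j (1 : F)%R \in unitmx by rewrite unitmxE d1 GRing.unitr1.
  have := cu (to_gl (elem i j (1 : F)%R)); rewrite inE to_glE // d1 eqxx => /(_ isT) /(congr1 (@GLval _ _)).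
  rewrite !GL_MxE to_glE // /elem mulmxDr mulmxDl mulmx1 mul1mx scale1r.
  by move/addrI.
have off (k i : 'I_n.+1) : k != i -> GLval u k i = 0%R.
  move=> ki; have := congr1 (fun M : 'M[F]_n.+1 => M k k) (c i k _); rewrite eq_sym => /(_ ki).
  rewrite !mxE (bigD1 i) //= big1 => [|l li]; last by rewrite !mxE (negPf li) mulr0.
  rewrite big1 => [|l _]; rewrite !mxE ?(negPf ki) ?mul0r // !eqxx mulr1 addr0.
  by [].
have diag (i j : 'I_n.+1) : GLval u i i = GLval u j j.
  have [->|ij] := eqVneq i j; first by [].
  have := congr1 (fun M : 'M[F]_n.+1 => M i j) (c i j ij).
  rewrite !mxE (bigD1 i) //= big1 => [|l li]; last by rewrite !mxE (negPf li) mulr0.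
  rewrite (bigD1 j) //= big1 => [|l lj]; last by rewrite !mxE (negPf lj) andbF mul0r.
  by rewrite !mxE !eqxx mulr1 mul1r !addr0.
have e : GLval u = ((GLval u ord0 ord0)%:M)%R.
  apply/matrixP => i j; rewrite mxE; have [<-|ij] := eqVneq i j; last by rewrite off.
  by rewrite mulr1n; apply: diag.
exists (GLval u ord0 ord0) => //; apply/eqP => z.
have gu : GLval u \in unitmx := valP u.
have := mulmxV gu; rewrite {1}e z raddf0 mul0mx => /(congr1 (fun M : 'M[F]_n.+1 => M ord0 ord0)).
by rewrite !mxE eqxx => /eqP; rewrite eq_sym oner_eq0.
Qed.

Lemma SL_nonabelian (F : finFieldType) n : (0 < n)%N -> ~~ abelian (SLgroup n.+1 F).
Proof.
case: n => // n _; apply/negP => ab.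
have d1 : (\det (elem ord0 (lift ord0 ord0) 1 : 'M[F]_n.+2) = 1)%R by apply: det_elem.
set E := elem _ _ _ in d1; have Eu : E \in unitmx by rewrite unitmxE d1 GRing.unitr1.
have : to_gl E \in 'Z(SLgroup n.+2 F) by rewrite (center_idP ab) inE to_glE // d1.
case/center_SL_scalar => a _; rewrite to_glE // => /(congr1 (fun M : 'M[F]_n.+2 => M ord0 (lift ord0 ord0))).
by rewrite !mxE /= !mulr1n mulr1 add0r => /eqP; rewrite oner_eq0.
Qed.

Lemma SL_hurwitz (F : finFieldType) n (X Y : {'GL_n.+1[F]}) : (0 < n)%N ->
  X ^+ 2 = 1 -> Y ^+ 3 = 1 -> (X * Y) ^+ 7 = 1 ->
  (forall G : {group {'GL_n.+1[F]}}, X \in G -> Y \in G ->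
     forall u : {'GL_n.+1[F]}, (\det (GLval u) = 1)%R -> u \in G) ->
  hurwitz_triple (SLgroup_group n.+1 F) X Y (X * Y)^-1.
Proof.
move=> n0 X2 Y3 Z7 gen; set dX := (\det (GLval X))%R; set dY := (\det (GLval Y))%R.
have dE (u : {'GL_n.+1[F]}) k : (\det (GLval (u ^+ k)) = \det (GLval u) ^+ k)%R.
  by elim: k => [|k IH]; rewrite ?GL_1E ?det1 // expgS GL_MxE det_mulmx IH exprS.
have dX2 : (dX ^+ 2 = 1)%R by rewrite -dE X2 GL_1E det1.
have dY3 : (dY ^+ 3 = 1)%R by rewrite -dE Y3 GL_1E det1.
have dZ7 : ((dX * dY) ^+ 7 = 1)%R by rewrite -det_mulmx -GL_MxE -dE Z7 GL_1E det1.
(* The sixth power is 1 by the orders 2 and 3, and the seventh by the order 7. *)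
have dXY : (dX * dY = 1)%R.
  rewrite -dZ7 exprMn (exprD dX 6 1) (exprM dX 2 3) dX2 expr1n mul1r expr1.
  by rewrite (exprD dY 6 1) (exprM dY 3 2) dY3 expr1n mul1r expr1.
have dY2 : (dY ^+ 2 = 1)%R by rewrite -[LHS]mul1r -{1}dX2 -exprMn dXY expr1n.
have dY1 : dY = 1%R by rewrite -[LHS]mul1r -{1}dY2 -exprSr dY3.
have dX1 : dX = 1%R by rewrite -dXY dY1 mulr1.
have XS : X \in SLgroup n.+1 F by rewrite inE -/dX dX1.
have YS : Y \in SLgroup n.+1 F by rewrite inE -/dY dY1.
apply: hurwitz_intro => //; first exact: SL_nonabelian.
- apply/eqP; rewrite eqEsubset gen_subG !subUset !sub1set XS YS groupV groupM //=.
  apply/subsetP => u; rewrite inE => /eqP du.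
  by apply: (gen <<_>>%G) du; rewrite mem_gen // !inE eqxx ?orbT.
- by rewrite expgVn Z7 invg1.
- by rewrite mulgV.
Qed.

Definition sl_triple (F : finFieldType) n (lx hx ly hy lz hz : nat) : Prop :=
  exists x y z : {'GL_n.+1[F]},
    [/\ hurwitz_triple (SLgroup_group n.+1 F) x y z,
        rank_range 2 x lx hx, rank_range 3 y ly hy & rank_range 7 z lz hz].

Lemma rank_separated_center (F : finFieldType) n p (a b : {'GL_n.+1[F]}) lo1 hi1 lo2 hi2 :
  (hi1 < lo2)%N || (hi2 < lo1)%N -> rank_range p a lo1 hi1 -> rank_range p b lo2 hi2 ->
  forall g i j u, g \in SLgroup_group n.+1 F -> u \in 'Z(SLgroup_group n.+1 F) ->
    a ^+ i != 1 -> b ^+ j != 1 -> (a ^+ i) ^ g <> u * b ^+ j.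
Proof.
move=> sep R1 R2 g i j u _ uZ ai bj e.
have [c c0 uE] := center_SL_scalar uZ.
apply: (rank_separated (h := g) sep R1 R2 c0 ai bj).
by rewrite e GL_MxE uE mul_scalar_mx.
Qed.

Lemma sl_triples_dhb (F : finFieldType) n lx1 hx1 ly1 hy1 lz1 hz1 lx2 hx2 ly2 hy2 lz2 hz2 :
  (0 < n)%N -> sl_triple F n lx1 hx1 ly1 hy1 lz1 hz1 -> sl_triple F n lx2 hx2 ly2 hy2 lz2 hz2 ->
  (hx1 < lx2)%N || (hx2 < lx1)%N -> (hy1 < ly2)%N || (hy2 < ly1)%N ->
  (hz1 < lz2)%N || (hz2 < lz1)%N ->
  doubly_hurwitz_beauville (SLgroup_group n.+1 F) /\ doubly_hurwitz_beauville (PSLgroup n.+1 F).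
Proof.
move=> n0 [x1 [y1 [z1 [H1 Rx1 Ry1 Rz1]]]] [x2 [y2 [z2 [H2 Rx2 Ry2 Rz2]]]] sx sy sz.
have hx := rank_separated_center sx Rx1 Rx2.
have hy := rank_separated_center sy Ry1 Ry2.
have hz := rank_separated_center sz Rz1 Rz2.
apply: (dhb_both (SL_nonabelian F n0) H1 H2) => a b; rewrite !inE => /or3P[] /eqP[-> ->].
- exact: hx.
- exact: hy.
- exact: hz.
Qed.

(** * Triples of SL from blocks *)

Lemma fixn_mul_tperm (T : finType) (s : {perm T}) a b : a != b -> s a = a -> s b = b ->
  (fixn (s * tperm a b) + 2 = fixn s)%N.
Proof.
move=> ab sa sb; rewrite /fixn (cardsD1 a [set p | s p == p]) inE sa eqxx.
rewrite (cardsD1 b (_ :\ a)) !inE sb eqxx [b == a]eq_sym ab /= addnA add1n addn2 add2n.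
rewrite -(addn2 #|_ :\ b|) addn2; congr _.+2; apply: eq_card => p; rewrite !inE permM.
have [->|pa] := eqVneq p a; first by rewrite sa tpermL andbF [b == a]eq_sym (negPf ab).
have [->|pb] := eqVneq p b; first by rewrite sb tpermR (negPf ab).
have sp c : s c = c -> p != c -> s p != c.
  by move=> sc; apply: contra => /eqP e; rewrite -(inj_eq (@perm_inj _ s)) sc e.
by rewrite tpermD // eq_sym sp.
Qed.

Lemma fixnV (T : finType) (s : {perm T}) : fixn s^-1 = fixn s.
Proof.
rewrite /fixn; apply: eq_card => p; rewrite !inE.
by rewrite -(inj_eq (@perm_inj _ s)) permKV eq_sym.
Qed.

Definition glued_perm (T : finType) (x y : {perm T}) (a b : T) : {perm T} :=
  x * tperm a b * tperm (y a) (y b).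

Lemma fixn_glued_perm (T : finType) (x y : {perm T}) hs a b : handle_system x y hs ->
  a \in hs -> b \in hs -> a != b -> (fixn (glued_perm x y a b) + 4 = fixn x)%N.
Proof.
move=> S ha hb ab; have [Ha Hb] := (sys_handle S ha, sys_handle S hb).
have [xa xya _ _ _] := Ha; have [xb xyb _ _ _] := Hb.
have nab c d : handle x y c -> handle x y d -> c != y d by move=> h1 h2; rewrite (handle_ya h1 h2).
have f2 c : x (y c) = y c -> a != y c -> b != y c -> (x * tperm a b) (y c) = y c.
  by move=> xc ac bc; rewrite permM xc tpermD.
rewrite /glued_perm -[4%N]/(2 + 2)%N addnA.
rewrite fixn_mul_tperm ?(inj_eq perm_inj) //; first exact: fixn_mul_tperm.
  by apply: f2 => //; apply: nab.
by apply: f2 => //; apply: nab.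
Qed.

(** N conjugates A into a transposition matrix. Placed on the handles and on their images, which x
    fixes, it commutes with x, so the linear involution is conjugate to a permutation matrix and has
    its ranks. *)
Lemma linear_glue_conj (F : finFieldType) m n (A N : 'M[F]_m) (x y : 'S_n.+1) hs
    (f : 'I_m -> 'I_n.+1) i j : handle_system x y hs -> injective f -> (forall k, f k \in hs) ->
  N \in unitmx -> (N *m A = perm_mx (tperm i j) *m N)%R ->
  perm_gl F x * emb_gl f A * emb_gl (y \o f) A =
  perm_gl F (glued_perm x y (f i) (f j)) ^ (emb_gl f N * emb_gl (y \o f) N).
Proof.
move=> S fi fh Nu NA; set t := perm_mx (tperm i j) in NA.
have tu : t \in unitmx by apply: unitmx_perm.
have yfi : injective (y \o f) by apply: inj_comp => //; apply: perm_inj.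
have fyf k l : f k != (y \o f) l by rewrite /= (handle_ya (sys_handle S (fh k)) (sys_handle S (fh l))).
have yff k l : (y \o f) k != f l by rewrite eq_sym.
have Au : A \in unitmx.
  have -> : A = (invmx N *m (t *m N))%R by rewrite -NA mulKmx.
  by rewrite !unitmx_mul unitmx_inv Nu tu.
have eA (g : 'I_m -> 'I_n.+1) : injective g -> emb_gl g A = emb_gl g t ^ emb_gl g N.
  by move=> gi; apply: (mulgI (emb_gl g N)); rewrite -conjgC -!emb_glM // NA.
have et (g : 'I_m -> 'I_n.+1) : injective g -> emb_gl g t = perm_gl F (tperm (g i) (g j)).
  move=> gi; rewrite /emb_gl /perm_gl (@embm_permE F m n.+1 g (tperm i j) (tperm (g i) (g j))) // => [k|p np].
    case: tpermP => [->|->|ki kj]; rewrite ?tpermL ?tpermR //.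
    by rewrite tpermD // (inj_eq gi) eq_sym; apply/eqP.
  by rewrite tpermD.
have jx (g : 'I_m -> 'I_n.+1) (B : 'M[F]_m) : injective g -> B \in unitmx -> (forall k, x (g k) = g k) ->
    perm_gl F x ^ emb_gl g B = perm_gl F x.
  move=> gi Bu xg; apply/conjg_fixP/commgP/commute_sym/commute_conj.
  by rewrite emb_glJ //; apply: emb_gl_ext.
have x1 k : x (f k) = f k by case: (sys_handle S (fh k)).
have x2 k : x ((y \o f) k) = (y \o f) k by case: (sys_handle S (fh k)).
have cj (g h : 'I_m -> 'I_n.+1) (B C : 'M[F]_m) : injective g -> injective h -> B \in unitmx -> C \in unitmx ->
    (forall k l, g k != h l) -> emb_gl g B ^ emb_gl h C = emb_gl g B.
  move=> gi hi Bu Cu gh; apply/conjg_fixP/commgP; exact: emb_gl_comm.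
rewrite /glued_perm !perm_glM !conjMg -(et f) // -(et (y \o f)) // !conjgM.
rewrite !jx // -(eA f) // (cj f (y \o f)) // (cj (y \o f) f) // -eA //.
Qed.

Lemma glued_perm2 (T : finType) (x y : {perm T}) hs a b : handle_system x y hs ->
  a \in hs -> b \in hs -> glued_perm x y a b ^+ 2 = 1.
Proof.
move=> S ha hb; have [Ha Hb] := (sys_handle S ha, sys_handle S hb).
have [xa xya _ _ _] := Ha; have [xb xyb _ _ _] := Hb.
have c1 : commute x (tperm a b) by apply/commute_sym/commute_conj; rewrite tpermJ xa xb.
have c2 : commute x (tperm (y a) (y b)) by apply/commute_sym/commute_conj; rewrite tpermJ xya xyb.
have c3 : commute (tperm a b) (tperm (y a) (y b)).
  apply: commute_conj; rewrite tpermJ !tpermD // eq_sym ?(handle_ya Ha Ha) ?(handle_ya Ha Hb) //.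
    by rewrite (handle_ya Hb Ha).
  by rewrite (handle_ya Hb Hb).
have x2 : x ^+ 2 = 1 by rewrite expgS expg1 (sys_x2 S).
have t2 (u v : T) : tperm u v ^+ 2 = 1 by rewrite expgS expg1 tperm2.
rewrite /glued_perm expgMn; last by apply/commute_sym/commuteM; apply: commute_sym.
by rewrite expgMn // x2 !t2 !mulg1.
Qed.

Lemma inv_prod_rank_range (F : finFieldType) n (s : 'S_n.+1) (X Y B : {'GL_n.+1[F]}) t :
  s ^+ 7 = 1 -> fixn s = t -> X * Y = perm_gl F s ^ B ->
  (X * Y) ^+ 7 = 1 /\ rank_range 7 (X * Y)^-1 (6 * (n.+1 - t)) (6 * (n.+1 - t)).
Proof.
move=> s7 ts e; rewrite e; split; first by rewrite -conjXg perm_glX s7 perm_gl1 conj1g.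
have -> : (perm_gl F s ^ B)^-1 = perm_gl F s^-1 ^ B.
  by rewrite -conjVg; congr (_ ^ _); apply: (mulgI (perm_gl F s)); rewrite -perm_glM !mulgV perm_gl1.
by apply: rank_rangeJ; apply: rank_range_perm; rewrite ?fixnV ?ts // expgVn s7 invg1.
Qed.

(** The rows are the two vectors that [swap2 g] exchanges. *)
Definition swap2_base (F : fieldType) (g : F) : 'M[F]_2 :=
  (\matrix_(i, j) (if i == 0 then (j == 1)%:R else if j == 0 then g else 1))%R.

Lemma swap2_baseE (F : fieldType) (g : F) : (swap2_base g *m swap2 g = perm_mx (tperm 0 1) *m swap2_base g)%R.
Proof.
apply/matrixP => i j; rewrite -row_permE !mxE !big_ord_recl big_ord0 !mxE /= addr0.
case: (i) => [[|[|]]] //= ?; case: (j) => [[|[|]]] //= ?;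
  rewrite ?permE /= -?val_eqE /= ?mulr0n ?mulr1n ?mulr0 ?mul0r ?mul1r ?mulr1 ?add0r ?addr0 ?mulrN1 ?addNr //.
Qed.

Lemma swap2_base_unit (F : fieldType) (g : F) : (g != 0)%R -> swap2_base g \in unitmx.
Proof.
move=> g0; pose M : 'M[F]_2 :=
  (\matrix_(i, j) (if i == 0 then if j == 0 then - g^-1 else g^-1 else (j == 0)%:R))%R.
suff : (swap2_base g *m M = 1%:M)%R by case/mulmx1_unit.
apply/matrixP => i j; rewrite !mxE !big_ord_recl big_ord0 !mxE /= addr0.
case: (i) => [[|[|]]] //= ?; case: (j) => [[|[|]]] //= ?;
  rewrite -?val_eqE /= ?mulr0n ?mulr1n ?mulrN ?divff ?mulr0 ?mul0r ?mul1r ?oppr0 ?add0r ?addr0 ?addNr //.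
Qed.

Lemma emb_gl_glue (F : finFieldType) m n (A : 'M[F]_m) (x y : 'S_n.+1) hs (f : 'I_m -> 'I_n.+1) :
  (A *m A = 1%:M)%R -> handle_system x y hs -> injective f -> (forall i, f i \in hs) ->
  let X := perm_gl F x * emb_gl f A * emb_gl (y \o f) A in
  X * X = 1 :> {'GL_n.+1[F]} /\ X * perm_gl F y = perm_gl F (x * y) ^ emb_gl (y \o f) A :> {'GL_n.+1[F]}.
Proof.
move=> A2 S fi fh X; rewrite /X; have [] := linear_glue (emb_gl_rep n A2) S fi fh => /=.
move: (perm_gl F x) (emb_gl f A) (emb_gl (y \o f) A) (perm_gl F y) (perm_gl F (x * y)) => a b c d e.
move=> h1 h2 _; split; [exact h1 | exact h2].
Qed.

Lemma block_sl_triple (F : finFieldType) n K r s t h (g : F) :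
  (9 < n)%N -> 13 %| K -> block K n.+1 r s t h true -> (1 < h)%N ->
  gen_scalar g -> g != 0%R -> g != 2%:R%R ->
  let cx := (n.+1 - (r - 4))%N in let cy := (2 * (n.+1 - s))%N in let cz := (6 * (n.+1 - t))%N in
  sl_triple F n cx cx cy cy cz cz.
Proof.
move=> n9 K13 [x [y [hs [S hh [xr ys zt] sd]]]] h2 gg g0 g2 cx cy cz.
have [a0 [a1 [h0 h1 a01]]] : exists a0 a1, [/\ a0 \in hs, a1 \in hs & a0 != a1].
  have us := sys_uniq S; case: hs us hh {S sd} h2 => [_ <- //|a0 [_ <- //|a1 hs]] /=.
  rewrite inE negb_or => /andP[/andP[a01 _] _] _ _.
  by exists a0, a1; rewrite !inE !eqxx orbT.
set f := pairf a0 a1; set A := swap2 g.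
have fi : injective f by apply: pairf_inj.
have fh i : f i \in hs by rewrite /f /pairf; case: ifP.
set X := perm_gl F x * emb_gl f A * emb_gl (y \o f) A.
have [X2 XY] := emb_gl_glue (swap2K g) S fi fh; rewrite -/X in X2 XY.
have XE : X = perm_gl F (glued_perm x y a0 a1) ^ (emb_gl f (swap2_base g) * emb_gl (y \o f) (swap2_base g)).
  exact: (linear_glue_conj (i := 0%R) (j := 1%R) S fi fh (swap2_base_unit g0) (swap2_baseE g)).
have [Z7 RZ] := inv_prod_rank_range (sys_z7 S) zt XY.
exists X, (perm_gl F y), (X * perm_gl F y)^-1; split.
- apply: SL_hurwitz => //; first exact: leq_ltn_trans n9.
  + by rewrite perm_glX (sys_y3 S) perm_gl1.
  + by move=> G XG YG; apply: (swap2_SL n9 K13 S sd h0 h1 a01 gg g2 XG YG).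
- rewrite XE; apply: rank_rangeJ; apply: rank_range_perm => //; first exact: glued_perm2 S h0 h1.
  by rewrite /cx mul1n -xr -(fixn_glued_perm S h0 h1 a01) addnK.
- by apply: rank_range_perm => //; [apply: (sys_y3 S) | rewrite /cy ys].
- exact: RZ.
Qed.

Definition onesv_fix (F : finFieldType) n (u : {'GL_n.+1[F]}) : Prop :=
  (onesv F n.+1 *m GLval u = onesv F n.+1)%R.

Lemma onesv_fixM (F : finFieldType) n (u v : {'GL_n.+1[F]}) :
  onesv_fix u -> onesv_fix v -> onesv_fix (u * v).
Proof. by rewrite /onesv_fix GL_MxE mulmxA => -> ->. Qed.

Lemma onesv_fixV (F : finFieldType) n (u : {'GL_n.+1[F]}) : onesv_fix u -> onesv_fix u^-1.
Proof. by move=> fu; rewrite /onesv_fix GL_VxE; apply: onesv_inv => //; apply: (valP u). Qed.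

Definition quogl (F : finFieldType) n (u : {'GL_n.+2[F]}) : {'GL_n.+1[F]} :=
  to_gl (quomx (GLval u)).

Lemma quoglM (F : finFieldType) n (u v : {'GL_n.+2[F]}) :
  onesv_fix u -> onesv_fix v -> quogl (u * v) = quogl u * quogl v.
Proof.
move=> fu fv; rewrite /quogl GL_MxE quomxM // to_glM // quomx_unit //; [exact: (valP u) | exact: (valP v)].
Qed.

Lemma quogl1 (F : finFieldType) n : quogl (1 : {'GL_n.+2[F]}) = 1.
Proof. by rewrite /quogl GL_1E quomx1; apply: val_inj; rewrite [LHS]to_glE ?unitmx1. Qed.

Lemma onesv_fix1 (F : finFieldType) n : onesv_fix (1 : {'GL_n.+1[F]}).
Proof. by rewrite /onesv_fix GL_1E mulmx1. Qed.

Lemma quoglX (F : finFieldType) n (u : {'GL_n.+2[F]}) k : onesv_fix u ->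
  quogl (u ^+ k) = quogl u ^+ k.
Proof.
move=> fu; suff [] : onesv_fix (u ^+ k) /\ quogl (u ^+ k) = quogl u ^+ k by [].
elim: k => [|k [IH1 IH2]]; first by split; [apply: onesv_fix1 | rewrite !expg0 quogl1].
by rewrite !expgS; split; [apply: onesv_fixM | rewrite quoglM // IH2].
Qed.

Lemma quoglV (F : finFieldType) n (u : {'GL_n.+2[F]}) : onesv_fix u ->
  quogl u^-1 = (quogl u)^-1.
Proof.
move=> fu; apply: (mulgI (quogl u)); rewrite -quoglM //; last exact: onesv_fixV.
by rewrite !mulgV quogl1.
Qed.

Lemma to_gl_val (F : finFieldType) n (u : {'GL_n.+1[F]}) : to_gl (GLval u) = u.
Proof. by apply: val_inj; rewrite [LHS]to_glE //; apply: (valP u). Qed.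

Definition swap3_base (F : fieldType) (g : F) : 'M[F]_3 :=
  (\matrix_(i, j) (if i == 1 then (if j == 0 then 0 else if j == 1 then 1 else g) else (i == j)%:R))%R.

Lemma swap3_baseE (F : fieldType) (g : F) : (swap3_base g *m swap3 g = perm_mx (tperm 0 1) *m swap3_base g)%R.
Proof.
apply/matrixP => i j; rewrite -row_permE !mxE !big_ord_recl big_ord0 !mxE /= addr0.
case: (i) => [[|[|[|]]]] //= ?; case: (j) => [[|[|[|]]]] //= ?;
  rewrite ?permE /= -?val_eqE /= ?mulr0n ?mulr1n ?mulr0 ?mul0r ?mul1r ?mulr1 ?add0r ?addr0 ?addNr //.
Qed.

Lemma swap3_base_unit (F : fieldType) (g : F) : swap3_base g \in unitmx.
Proof.
pose M := swap3_base (- g)%R.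
suff : (swap3_base g *m M = 1%:M)%R by case/mulmx1_unit.
apply/matrixP => i j; rewrite !mxE !big_ord_recl big_ord0 !mxE /= addr0.
case: (i) => [[|[|[|]]]] //= ?; case: (j) => [[|[|[|]]]] //= ?;
  rewrite -?val_eqE /= ?mulr0n ?mulr1n ?mulr0 ?mul0r ?mul1r ?mulr1 ?add0r ?addr0 ?addNr //.
Qed.

(** The block has one point more than the degree of the special linear group, and the lower bounds
    lose 2, 3 and 7, one unit of rank times the order. *)
Lemma block_quotient_sl_triple (F : finFieldType) n K r s t h (g : F) :
  (9 < n)%N -> 13 %| K -> block K n.+2 r s t h true -> (2 < h)%N -> gen_scalar g ->
  let cx := (n.+2 - (r - 4))%N in let cy := (2 * (n.+2 - s))%N in let cz := (6 * (n.+2 - t))%N in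
  sl_triple F n (cx - 2) cx (cy - 3) cy (cz - 7) cz.
Proof.
move=> n9 K13 [x [y [hs [S hh [xr ys zt] sd]]]] h2 gg cx cy cz.
have [a0 [a1 [a2 [[h0 h1 h2'] [a01 a02 a12]]]]] : exists a0 a1 a2,
    [/\ a0 \in hs, a1 \in hs & a2 \in hs] /\ [/\ a0 != a1, a0 != a2 & a1 != a2].
  have us := sys_uniq S.
  case: hs us hh {S sd} h2 => [_ <- //|a0 [_ <- //|a1 [_ <- //|a2 hs]]] /=.
  rewrite !inE !negb_or => /and3P[/and3P[a01 a02 _] /andP[a12 _] _] _ _.
  by exists a0, a1, a2; rewrite !inE !eqxx !orbT.
set f := trif a0 a1 a2; set A := swap3 g.
have fi : injective f by apply: trif_inj.
have fh i : f i \in hs by rewrite /f /trif; case: (i == 0%R) => //; case: (i == 1%R).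
set X := perm_gl F x * emb_gl f A * emb_gl (y \o f) A; set Y := perm_gl F y.
have [X2 XY] := emb_gl_glue (swap3K g) S fi fh; rewrite -/X -/Y in X2 XY.
have XE : X = perm_gl F (glued_perm x y a0 a1) ^ (emb_gl f (swap3_base g) * emb_gl (y \o f) (swap3_base g)).
  exact: (linear_glue_conj (i := 0%R) (j := 1%R) S fi fh (swap3_base_unit g) (swap3_baseE g)).
have [Z7 RZ] := inv_prod_rank_range (sys_z7 S) zt XY.
have Au : A \in unitmx by case/mulmx1_unit: (swap3K g).
have yfi : injective (y \o f) by apply: inj_comp => //; apply: perm_inj.
have fe k : injective k -> onesv_fix (emb_gl k A).
  by move=> ki; rewrite /onesv_fix to_glE ?embm_unit // onesv_embm // onesv_swap3.
have fp u : onesv_fix (perm_gl F u) by rewrite /onesv_fix to_glE ?unitmx_perm // onesv_perm.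
have fX : onesv_fix X by rewrite /X; apply: onesv_fixM (fe _ _ yfi); apply: onesv_fixM (fp _ x) (fe _ f fi).
have fY : onesv_fix Y by apply: fp.
have fXY : onesv_fix (X * Y) by apply: onesv_fixM.
have ZE : (quogl X * quogl Y)^-1 = quogl (X * Y)^-1 by rewrite -quoglM // quoglV.
exists (quogl X), (quogl Y), (quogl X * quogl Y)^-1; split.
- apply: SL_hurwitz; first exact: leq_ltn_trans n9.
  + by rewrite -quoglX // expgS expg1 X2 quogl1.
  + by rewrite -quoglX // /Y perm_glX (sys_y3 S) perm_gl1 quogl1.
  + by rewrite -quoglM // -quoglX // Z7 quogl1.
  move=> G XG YG; apply: (quotient_SL (valP X) (valP Y) fX fY XG YG) => H.
  rewrite !to_gl_val => XH YH.
  exact: (swap3_ctrans (leqW n9) K13 S sd h0 h1 h2' a01 a02 a12 gg XH YH).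
- apply: (rank_range_quo fX); rewrite XE; apply: rank_rangeJ; apply: rank_range_perm => //.
    exact: glued_perm2 S h0 h1.
  by rewrite /cx mul1n -xr -(fixn_glued_perm S h0 h1 a01) addnK.
- apply: (rank_range_quo fY); apply: rank_range_perm => //; [apply: (sys_y3 S) | by rewrite /cy ys].
- by rewrite ZE; apply: rank_range_quo RZ; apply: onesv_fixV.
Qed.

(** * The residue classes modulo 14 *)

Lemma field_unit_generator (F : finFieldType) : exists2 u : F, u != 0%R &
  forall c : F, c != 0%R -> exists e : nat, (c = u ^+ e.+1)%R.
Proof.
have /cyclicP[u uE] : cyclic [set: {unit F}] := field_unit_group_cyclic _.
exists (val u) => [|c c0]; first by rewrite -unitfE; apply: (valP u).
have cu : c \is a GRing.unit by rewrite unitfE.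
have : FinRing.unit F cu \in <[u]> by rewrite -uE inE.
(* Adding the order of u makes the exponent positive. *)
case/cycleP => i iE; exists (i + #[u].-1)%N.
have -> : (i + #[u].-1).+1 = (i + #[u])%N by rewrite -addnS prednK ?order_gt0.
by rewrite -FinRing.val_unitX expgD expg_order mulg1 -iE.
Qed.

(* If a generator u equals 2, then - u is taken. *)
Lemma gen_scalar_exists (F : finFieldType) :
  exists g : F, [/\ gen_scalar g, g != 0%R & g != 2%:R%R].
Proof.
have [u u0 pu] := field_unit_generator F.
have [e2|n2] := eqVneq u 2%:R%R; last first.
  by exists u; split=> // c /pu[e ->]; exists e; left.
exists (- u)%R; split; last first.
(* If also - u = 2, then u + u = 0, while u + u = 2 u = u^2 is nonzero. *)
- apply/eqP => e; have : (u + u == 0)%R by rewrite -{1}[u]opprK e e2 addNr.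
  by rewrite -mulr2n -mulr_natl -e2 mulf_eq0 orbb (negPf u0).
- by rewrite oppr_eq0.
move=> c /pu[e ->]; exists e; rewrite exprNn.
by rewrite -signr_odd; case: (odd e.+1); rewrite ?expr1 ?expr0 ?mulN1r ?mul1r ?opprK; [right | left].
Qed.

Definition add_blockG (k : nat) (c : counts) : counts :=
  Counts (cP c) (cG c + k) (cA c) (cB c) (cC c) (cD c) (cE c) (cF c).

Lemma counts_sl_triple (F : finFieldType) n c : (9 < n)%N -> (cA c <= cG c)%N -> csize c = n.+1 ->
  let cx := (n.+1 - (cfx c - 4))%N in let cy := (2 * (n.+1 - cfy c))%N in
  let cz := (6 * (n.+1 - cfz c))%N in
  sl_triple F n cx cx cy cy cz cz.
Proof.
move=> n9 ag cs; have [K gK] := good_exp_exists; have [g [gg g0 g2]] := gen_scalar_exists F.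
have := counts_block gK ag; rewrite cs => B.
by apply: (block_sl_triple n9 (good_exp13 gK) B _ gg g0 g2).
Qed.

Lemma counts_quotient_sl_triple (F : finFieldType) n c : (9 < n)%N -> (cA c < cG c)%N -> csize c = n.+2 ->
  let cx := (n.+2 - (cfx c - 4))%N in let cy := (2 * (n.+2 - cfy c))%N in
  let cz := (6 * (n.+2 - cfz c))%N in
  sl_triple F n (cx - 2) cx (cy - 3) cy (cz - 7) cz.
Proof.
move=> n9 ag cs; have [K gK] := good_exp_exists; have [g [gg _ _]] := gen_scalar_exists F.
have := counts_block gK (ltnW ag); rewrite cs => B.
apply: (block_quotient_sl_triple n9 (good_exp13 gK) B _ gg).
by rewrite -addn1 leq_add2l subn_gt0.
Qed.

(** The inequalities make the truncated subtractions in the rank bounds exact, so different counts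
    give different bounds; four fixed points of x are lost in the linear gluing. *)
Definition good_pair (n : nat) (c d : counts) : bool :=
  [&& csize c == n, csize d == n, cA c <= cG c, cA d <= cG d,
      3 < cfx c <= n, 3 < cfx d <= n, cfx c != cfx d, cfy c <= n, cfy d <= n, cfy c != cfy d,
      cfz c <= n, cfz d <= n & cfz c != cfz d]%N.

Lemma good_pair_dhb n c d k (F : finFieldType) : (10 < n)%N -> good_pair n c d ->
  doubly_hurwitz_beauville (SLgroup_group (n + 42 * k) F) /\
  doubly_hurwitz_beauville (PSLgroup (n + 42 * k) F).
Proof.
move=> n9 /and5P[/eqP cn /eqP dn ca da /and5P[/andP[cx4 cxn] /andP[dx4 dxn] xx cyn
  /and5P[dyn yy czn dzn zz]]].
have [m mE] : exists m, (n + 42 * k)%N = m.+1 by exists (n + 42 * k).-1%N; lia.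
have m9 : (9 < m)%N by lia.
have ext e : (cA e <= cG e)%N -> [/\ (cA (add_blockG k e) <= cG (add_blockG k e))%N,
    csize (add_blockG k e) = (csize e + 42 * k)%N, cfx (add_blockG k e) = (cfx e + 2 * k)%N,
    cfy (add_blockG k e) = cfy e & cfz (add_blockG k e) = cfz e].
  rewrite /csize /cfx /cfy /cfz /=; case: (cP e) => h; split=> //; lia.
have [ca' cn' cx' cy' cz'] := ext c ca; have [da' dn' dx' dy' dz'] := ext d da.
rewrite cn mE in cn'; rewrite dn mE in dn'.
have T1 := counts_sl_triple F m9 ca' cn'; have T2 := counts_sl_triple F m9 da' dn'.
rewrite cx' cy' cz' in T1; rewrite dx' dy' dz' in T2; rewrite mE.
apply: (sl_triples_dhb _ T1 T2); clear T1 T2 ext; lia.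
Qed.

(* No two configurations with 503 points differ in the fixed points of x y. *)
Lemma dhb_503 (F : finFieldType) :
  doubly_hurwitz_beauville (SLgroup_group 503 F) /\ doubly_hurwitz_beauville (PSLgroup 503 F).
Proof.
have T1 := @counts_sl_triple F 502 (Counts false 3 0 3 0 0 1 0) isT isT erefl.
(* This configuration has 504 points and enough free handles for the three-handle matrix, so its
   quotient has degree 503. *)
have T2 := @counts_quotient_sl_triple F 502 (Counts false 5 0 0 4 0 0 0) isT isT erefl.
exact: (sl_triples_dhb (n := 502) isT T1 T2 isT isT isT).
Qed.

(* For each of three consecutive n in a class modulo 14, two configurations; adding blocks
   G to both reaches n + 42 k. The value 503 is replaced by 545. *)
Definition config_pairs : seq (nat * counts * counts) :=
  [:: (336, Counts false 1 0 0 4 0 0 0, Counts true 0 0 0 0 3 0 0);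
     (350, Counts false 1 1 0 4 0 0 0, Counts false 0 0 0 0 0 1 1);
     (364, Counts false 4 0 0 2 0 0 0, Counts true 1 0 2 0 1 0 0);
     (371, Counts false 3 0 0 3 0 0 0, Counts false 0 0 1 0 0 2 0);
     (385, Counts false 1 0 0 5 0 0 0, Counts true 0 0 0 1 3 0 0);
     (399, Counts false 1 1 0 5 0 0 0, Counts false 0 0 0 1 0 1 1);
     (409, Counts false 3 0 1 0 2 0 0, Counts true 0 0 1 0 1 0 1);
     (423, Counts false 2 0 0 1 3 0 0, Counts true 0 0 3 0 0 1 0);
     (436, Counts false 5 0 0 0 2 0 0, Counts true 2 0 0 0 1 0 1);
     (437, Counts false 0 0 0 3 3 0 0, Counts true 0 0 1 0 2 1 0);
     (438, Counts false 0 0 0 4 0 0 1, Counts true 1 0 0 0 0 1 1);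
     (450, Counts false 3 0 0 2 2 0 0, Counts false 0 0 0 0 1 0 2);
     (452, Counts false 0 0 0 2 4 0 0, Counts true 1 1 0 0 0 1 1);
     (464, Counts false 1 0 0 4 2 0 0, Counts false 0 0 2 0 0 1 1);
     (466, Counts false 3 0 0 2 0 0 1, Counts true 0 0 2 0 1 0 1);
     (472, Counts false 2 0 0 2 3 0 0, Counts true 1 1 0 0 2 0 1);
     (474, Counts false 4 0 0 0 1 0 1, Counts true 1 0 0 0 0 0 2);
     (481, Counts false 3 0 0 1 1 0 1, Counts true 0 0 0 1 0 0 2);
     (486, Counts false 0 0 0 4 3 0 0, Counts false 0 0 0 0 1 3 0);
     (488, Counts false 2 0 0 2 1 0 1, Counts true 1 1 0 0 0 0 2);
     (489, Counts false 3 0 1 0 1 0 1, Counts true 0 0 1 0 0 0 2);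
     (495, Counts false 1 0 0 3 1 0 1, Counts true 1 0 1 0 0 1 1);
     (499, Counts false 3 0 0 3 2 0 0, Counts false 0 0 0 1 1 0 2);
     (500, Counts false 0 0 0 6 0 1 0, Counts false 0 0 2 0 0 0 2);
     (501, Counts false 0 0 0 3 4 0 0, Counts true 0 0 1 0 3 1 0);
     (502, Counts false 0 0 0 4 1 0 1, Counts true 1 0 0 0 1 1 1);
     (509, Counts false 1 0 0 1 5 0 0, Counts true 0 0 0 1 1 1 1);
     (513, Counts false 1 0 0 5 2 0 0, Counts false 1 0 1 0 1 1 1);
     (515, Counts false 3 0 0 3 0 0 1, Counts false 0 0 1 0 0 2 1);
     (517, Counts false 0 0 0 3 2 0 1, Counts true 0 0 1 0 1 1 1);
     (527, Counts false 1 1 0 5 2 0 0, Counts false 0 0 0 1 2 1 1);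
     (529, Counts false 1 0 0 5 0 0 1, Counts true 0 0 0 1 3 0 1);
     (545, Counts false 3 0 0 1 2 0 1, Counts true 0 0 0 1 1 0 2);
     (552, Counts false 2 0 0 2 2 0 1, Counts true 1 1 0 0 1 0 2);
     (566, Counts false 0 0 0 4 2 0 1, Counts false 0 0 0 0 0 3 1);
     (580, Counts false 5 0 0 0 2 0 1, Counts true 2 0 0 0 1 0 2);
     (582, Counts false 0 0 0 4 0 0 2, Counts true 1 0 0 0 0 1 2);
     (596, Counts false 0 0 0 2 4 0 1, Counts true 1 1 0 0 0 1 2);
     (610, Counts false 3 0 0 2 0 0 2, Counts true 0 0 2 0 1 0 2);
     (631, Counts false 0 0 0 5 0 0 2, Counts true 1 0 0 1 0 1 2);
     (645, Counts false 0 0 0 3 4 0 1, Counts true 0 0 1 0 3 1 1);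
     (659, Counts false 3 0 0 3 0 0 2, Counts false 0 0 1 0 0 2 2)].

Lemma config_pairs_good : all (fun e => (10 < e.1.1)%N && good_pair e.1.1 e.1.2 e.2) config_pairs.
Proof. by vm_compute. Qed.

Lemma config_pairs_cover : all (fun r => all (fun j =>
    let n := (N_mod14 r + 42 + 14 * j)%N in
    has (fun e => e.1.1 == if n == 503 then 545 else n) config_pairs) (iota 0 3)) (iota 0 14).
Proof. by vm_compute. Qed.

Lemma has_all_exists (T : Type) (p q : pred T) (s : seq T) :
  has p s -> all q s -> exists2 x, p x & q x.
Proof. by elim: s => //= x s IH /orP[px /andP[qx _]|/IH h /andP[_ /h]//]; exists x. Qed.

Lemma config_pairs_dhb n k (F : finFieldType) : has (fun e => e.1.1 == n) config_pairs ->
  doubly_hurwitz_beauville (SLgroup_group (n + 42 * k) F) /\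
  doubly_hurwitz_beauville (PSLgroup (n + 42 * k) F).
Proof.
move=> h; have [[[n' c] d] /= /eqP <- /andP[n10 g]] := has_all_exists h config_pairs_good.
exact: good_pair_dhb g.
Qed.

Lemma dhb_residue r n (F : finFieldType) : (r < 14)%N -> n = r %[mod 14] ->
  (N_mod14 r + 42 <= n)%N ->
  doubly_hurwitz_beauville (SLgroup_group n F) /\ doubly_hurwitz_beauville (PSLgroup n F).
Proof.
move=> r14 nr le; have Nr : N_mod14 r = r %[mod 14].
  by have := isT : all (fun r => N_mod14 r == r %[mod 14]) (iota 0 14);
     move/allP => h; apply/eqP/h; rewrite mem_iota.
(* As 42 = 3 * 14, the remainder of q modulo 3 selects a tabulated degree, and the quotient counts
   the copies of G. *)
pose q := ((n - (N_mod14 r + 42)) %/ 14)%N.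
have nE : n = (N_mod14 r + 42 + 14 * (q %% 3) + 42 * (q %/ 3))%N.
  by rewrite /q; move: (N_mod14 r) Nr le nr => N; lia.
have q3 : (q %% 3) \in iota 0 3 by rewrite mem_iota ltn_mod.
have rI : r \in iota 0 14 by rewrite mem_iota.
have /allP/(_ _ q3) /= := allP config_pairs_cover _ rI.
rewrite {}nE; move: (q %/ 3)%N => k; set b := (N_mod14 r + 42 + _)%N.
have [->|_] := eqVneq b 503; last exact: config_pairs_dhb.
(* Only 503 itself is exceptional; 503 + 42 (k + 1) is reached from 545. *)
case: k => [_|k h]; first by rewrite muln0 addn0; apply: dhb_503.
by rewrite mulnS addnA; apply: config_pairs_dhb.
Qed.

Theorem corollary1p3 :
  (forall r n : nat,
     r < 14 -> n = r %[mod 14] -> N_mod14 r + 42 <= n ->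
     forall F : finFieldType,
       doubly_hurwitz_beauville (SLgroup_group n F) /\
       doubly_hurwitz_beauville (PSLgroup n F)) /\
  (forall n : nat,
     631 <= n ->
     forall F : finFieldType,
       doubly_hurwitz_beauville (SLgroup_group n F) /\
       doubly_hurwitz_beauville (PSLgroup n F)).
Proof.
split=> [r n r14 nr le F|n n631 F]; first exact: dhb_residue nr le.
have r14 : (n %% 14 < 14)%N by rewrite ltn_mod.
apply: (dhb_residue _ r14); first by rewrite modn_mod.
apply: leq_trans n631.
have := isT : all (fun r => N_mod14 r + 42 <= 631)%N (iota 0 14).
by move/allP; apply; rewrite mem_iota.
Qed.
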